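(* Let $({\bf X},\ast)$ be a hypergroup on ${\bf X}=[0,\infty)$ with Haar measure $m$ that has a Laplace representation $\phi_\lambda(x)=\int_{[-x,x]}\cos(\lambda t)\,\tau_x(dt)$, and suppose that there exist $M_0,\omega_0>0$ such that $\int_{[-x,x]}\cosh(\omega_0t)\,\tau_x(dt)\le M_0$ for all $x\ge0$. Let $E$ be a separable complex Banach space and let $(\cos(tA))_{t\in\mathbb R}$ be a strongly continuous cosine family on $E$ such that, for some $\kappa<\infty$, $\|\cos(tA)\|_{\mathcal L(E)}\le\kappa\cosh(t\omega_0)$ for all $t\ge0$. For $x\ge0$ let $$\phi_A(x)=\int_{[-x,x]}\cos(tA)\,\tau_x(dt)$$ (strong operator integral). Then: (i) $(\phi_A(x))_{x>0}$ is a uniformly bounded family of operators on $E$; (ii) for all $f\in L^1(m)$, the integral $T_A(f)=\int_0^\infty f(x)\phi_A(x)\,m(dx)$ converges in the strong operator sense and defines a bounded linear operator on $E$; (iii) for $f,g\in L^1(m)$, $T_A(f\ast g)=T_A(f)T_A(g)$, and so the map $T_A:L^1(m)\to\mathcal L(E)$ is an algebra homomorphism.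
   Context: Hypergroups on ${\bf X}=[0,\infty)$. $M^b({\bf X})$ is the space of bounded Radon measures on ${\bf X}$ and $\varepsilon_x$ is the unit point mass at $x$. A hypergroup $({\bf X},\ast)$ is a bilinear associative multiplication $\ast$ on $M^b({\bf X})$, determined by the products $\varepsilon_x\ast\varepsilon_y$, satisfying the standard (Jewett) axioms: each $\varepsilon_x\ast\varepsilon_y$ is a compactly supported probability measure, depending weakly continuously on $(x,y)$, with $\mathrm{supp}(\varepsilon_x\ast\varepsilon_y)$ depending continuously on $(x,y)$; $\varepsilon_0$ is the identity; there is a continuous involution $x\mapsto x^-$ of ${\bf X}$ compatible with $\ast$ such that $0\in\mathrm{supp}(\varepsilon_x\ast\varepsilon_y)$ iff $y=x^-$. On $[0,\infty)$ the convolution is necessarily commutative and $x^-=x$. Write $f(x\ast y)=\Lambda_xf(y)=\int_{\bf X}f(t)\,(\varepsilon_x\ast\varepsilon_y)(dt)$. The Haar measure $m$ is the (essentially unique) nontrivial positive measure with $\int\Lambda_xf\,dm=\int f\,dm$ for all $f\in C_c({\bf X})$, $x\in{\bf X}$. Convolution of functions is $(f\ast g)(x)=\int_{\bf X}f(y)\,g(x\ast y)\,m(dy)$, extended from $C_c({\bf X})$ to $L^1(m)=L^1({\bf X},m)$, which becomes a commutative Banach algebra. A continuous $\phi:{\bf X}\to\mathbb C$, not identically zero, is multiplicative if $\phi(x\ast y)=\phi(x)\phi(y)$ for all $x,y$. A character is a bounded multiplicative function with $\phi(x^-)=\overline{\phi(x)}$ (i.e. real valued) and $\phi(0)=1$;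 $\hat{\bf X}$ is the set of characters. The Plancherel measure $\pi_0$ is the unique measure on $\hat{\bf X}$, with closed support ${\bf S}\subseteq\hat{\bf X}$, such that $f\mapsto\hat f$, $\hat f(\phi)=\int f\phi\,dm$, extends from $L^1(m)\cap L^2(m)$ to a unitary $L^2(m)\to L^2(\pi_0)$. There is a unique positive character in ${\bf S}$, denoted $\phi_0$. The bounded multiplicative functions are parametrized as $\phi_\lambda$ by complex parameters $\lambda$, and characters are identified with their parameters. Laplace representation: $({\bf X},\ast)$ has a Laplace representation if $(a,b)\subseteq{\bf S}$ for some $0<a<b$ and, for every $x\ge0$, there is a positive Radon measure $\tau_x$ on $[-x,x]$ with $\tau_x([-x,x])=\phi_0(x)$ and $\phi_\lambda(x)=\int_{[-x,x]}\cos(\lambda t)\,\tau_x(dt)$ for every character $\phi_\lambda\in{\bf S}$. Cosine family: a strongly continuous family $(C(t))_{t\in\mathbb R}$ in $\mathcal L(E)$ with $C(0)=I$ and $C(s-t)+C(s+t)=2C(s)C(t)$; one writes $C(t)=\cos(tA)$, where $A$ is its generator. *)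

(* Defs.v *)
From HB Require Import structures.
From mathcomp Require Import all_boot all_order all_algebra.
From mathcomp Require Import complex.
From mathcomp Require Import all_classical all_reals all_analysis.

Set Implicit Arguments.
Unset Strict Implicit.
Unset Printing Implicit Defensive.

Import Order.TTheory GRing.Theory Num.Theory.
Import numFieldNormedType.Exports.

Local Open Scope classical_set_scope.
Local Open Scope complex_scope.
Local Open Scope ring_scope.

Section elementary.
Context {R : realType}.

(* The norm of a normed space over [R[i]] takes its values in [R[i]]; [nrm] is
   the same number seen in [R]. *)
Definition nrm (V : normedZmodType R[i]) (v : V) : R := complex.Re `|v|.

Definition cosh (x : R) : R := (expR x + expR (- x)) / 2.
Definition sinh (x : R) : R := (expR x - expR (- x)) / 2.

(* cos (a + ib) = cos a cosh b - i sin a sinh b *)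
Definition ccos (z : R[i]) : R[i] :=
  let: a +i* b := z in (cos a * cosh b) -i* (sin a * sinh b).

End elementary.

Notation borel T := (g_sigma_algebraType (@open T)).

Section measures.
Context {R : realType}.

(* On a second countable locally compact Hausdorff space, the Radon measures
   are the Borel measures that are finite on compact sets; in particular every
   finite Borel measure is Radon. *)
Definition radon (T : ptopologicalType) (mu : {measure set (borel T) -> \bar R}) :=
  forall K : set T, compact K -> (mu K < +oo)%E.

Definition msupport (T : ptopologicalType)
    (mu : {measure set (borel T) -> \bar R}) : set T :=
  [set x | forall U : set T, open U -> U x -> (0 < mu U)%E].

Section complex_valued.
Context d (T : measurableType d) (mu : {measure set T -> \bar R}).
Implicit Types (D : set T) (f g : T -> R[i]).

Definition cmeasurable D f :=
  measurable_fun D (fun x => complex.Re (f x)) /\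
  measurable_fun D (fun x => complex.Im (f x)).

Definition cintegrable D f :=
  mu.-integrable D (fun x => (complex.Re (f x))%:E) /\
  mu.-integrable D (fun x => (complex.Im (f x))%:E).

Definition cintegral D f : R[i] :=
  (\int[mu]_(x in D) complex.Re (f x)) +i* (\int[mu]_(x in D) complex.Im (f x)).

Definition L1 f := cintegrable setT f.

Definition sqnorm2 f : \bar R := (\int[mu]_x ((nrm (f x)) ^+ 2)%:E)%E.

Definition L2 f := cmeasurable setT f /\ (sqnorm2 f < +oo)%E.

End complex_valued.
End measures.

Arguments L1 {R d T}.
Arguments L2 {R d T}.

Section bochner.
Context {R : realType} d (T : measurableType d) (E : normedModType R[i]).

(* Vector-valued simple functions: finite sums of indicators times vectors
   (the sets need not be disjoint). *)
Record vsimple := VSimple {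
  vs_size : nat;
  vs_set : 'I_vs_size -> set T;
  vs_val : 'I_vs_size -> E;
  vs_measurable : forall i, measurable (vs_set i) }.

Definition vs_fun (s : vsimple) (x : T) : E :=
  \sum_i (\1_(@vs_set s i) x)%:C *: vs_val i.

Variables (mu : {measure set T -> \bar R}) (D : set T).

Definition vs_integrable (s : vsimple) :=
  forall i, (mu (D `&` @vs_set s i) < +oo)%E.

Definition vs_integral (s : vsimple) : E :=
  \sum_i (fine (mu (D `&` @vs_set s i)))%:C *: vs_val i.

Definition strongly_measurable (F : T -> E) :=
  exists s : nat -> vsimple,
    forall x, D x -> (fun n => vs_fun (s n) x) @ \oo --> F x.

Definition has_bochner_integral (F : T -> E) (v : E) :=
  strongly_measurable F /\
  exists s : nat -> vsimple,
    [/\ forall n, vs_integrable (s n),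
        (fun n => (\int[mu]_(x in D) (nrm (F x - vs_fun (s n) x))%:E)%E)
          @ \oo --> 0%E
      & (fun n => vs_integral (s n)) @ \oo --> v].

Definition bochner_integrable (F : T -> E) :=
  exists v, has_bochner_integral F v.

(* the value of the integral; 0 if [F] is not integrable *)
Definition bochner (F : T -> E) : E := xget 0 (has_bochner_integral F).

End bochner.

Arguments bochner_integrable {R d T E}.
Arguments bochner {R d T E}.

Section operators.
Context {R : realType} (E : normedModType R[i]).

Definition separable_space := exists D : set E, countable D /\ dense D.

Definition bounded_operator (T : E -> E) :=
  linear T /\ exists K : R, forall v, nrm (T v) <= K * nrm v.

Definition opnorm (T : E -> E) : R :=
  sup [set nrm (T v) | v in [set v | nrm v <= 1]].

(* [C t] is written cos(tA) when A is the generator of the family. *)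
Record cosine_family (C : R -> E -> E) : Prop := CosineFamily {
  cosine_bounded : forall t, bounded_operator (C t);
  cosine_continuous : forall v, continuous (fun t => C t v);
  cosine0 : forall v, C 0 v = v;
  cosineD : forall s t v, C (s - t) v + C (s + t) v = 2%:R *: C s (C t v) }.

End operators.

Definition halfline (R : realType) : set R := `[0, +oo[.
Arguments halfline : clear implicits.

Notation "''X_' R" := (set_type (halfline R))
  (at level 8, R at level 2, format "''X_' R").

Lemma halfline0 (R : realType) : (0 : R) \in halfline R.
Proof. by rewrite inE /halfline /= in_itv /= lexx. Qed.

HB.instance Definition _ (R : realType) :=
  isPointed.Build 'X_R (exist _ 0 (@halfline0 R)).

Section hypergroup.
Context {R : realType}.
Notation X := ('X_R).

Definition X0 : X := exist _ 0 (@halfline0 R).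

Section product.
Variable cv : X -> X -> probability (borel X) R.

(* [sigma] is the product [mu * nu] obtained from the products of point masses
   by bilinearity: [mu * nu = \int\int (e_x * e_y) mu(dx) nu(dy)].  It is stated
   for positive measures, which span the space of bounded measures. *)
Definition is_mproduct (mu nu sigma : {finite_measure set (borel X) -> \bar R}) :=
  forall A : set (borel X), measurable A ->
    sigma A = (\int[mu]_x \int[nu]_y cv x y A)%E.

End product.

(* The continuity of [supp (e_x * e_y)] is with respect to the topology on
   compact sets generated by the [{K | K meets U}] and [{K | K `<=` U}],
   [U] open (Michael's topology). *)
Record hypergroup := Hypergroup {
  hg_conv : X -> X -> probability (borel X) R;
  hg_inv : X -> X;
  hg_compact : forall x y, compact (msupport (hg_conv x y));
  hg_continuous : forall f : X -> R, continuous f ->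
    (exists K : R, forall x, `|f x| <= K) ->
    continuous (fun p : X * X => \int[hg_conv p.1 p.2]_t f t);
  hg_supp_meet : forall U : set X, open U ->
    open [set p : X * X | msupport (hg_conv p.1 p.2) `&` U !=set0];
  hg_supp_sub : forall U : set X, open U ->
    open [set p : X * X | msupport (hg_conv p.1 p.2) `<=` U];
  hg_convA : forall mu nu rho munu nurho l r :
      {finite_measure set (borel X) -> \bar R},
    is_mproduct hg_conv mu nu munu -> is_mproduct hg_conv nu rho nurho ->
    is_mproduct hg_conv munu rho l -> is_mproduct hg_conv mu nurho r ->
    forall A : set (borel X), measurable A -> l A = r A;
  hg_conv0x : forall x (A : set (borel X)), measurable A ->
    hg_conv X0 x A = \d_(x : borel X) A;
  hg_convx0 : forall x (A : set (borel X)), measurable A ->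
    hg_conv x X0 A = \d_(x : borel X) A;
  hg_inv_continuous : continuous hg_inv;
  hg_invK : involutive hg_inv;
  hg_conv_inv : forall x y (A : set (borel X)), measurable A ->
    hg_conv (hg_inv y) (hg_inv x) A = hg_conv x y (hg_inv @^-1` A);
  hg_supp0_inv : forall x y, msupport (hg_conv x y) X0 <-> y = hg_inv x }.

Variable H : hypergroup.
Implicit Types (f g phi : X -> R[i]) (m : {measure set (borel X) -> \bar R}).

(* f(x * y) *)
Definition translate (x : X) f (y : X) : R[i] := cintegral (hg_conv H x y) setT f.

(* continuity of a complex function is for the usual topology of [R[i]], which
   the library attaches to [R[i]^o] *)
Definition ccontinuous f := continuous (f : X -> R[i]^o).

Definition Cc f :=
  ccontinuous f /\ exists2 K : set X, compact K & forall x, ~ K x -> f x = 0.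

Record haar_measure m : Prop := HaarMeasure {
  haar_radon : radon m;
  haar_nontrivial : m setT != 0%E;
  haar_invariant : forall f, Cc f -> forall x,
    cintegral m setT (translate x f) = cintegral m setT f }.

(* For [f] and [g] in [L1 m] the integrals converge for [m]-almost every [x]
   (and the inner ones for almost every [y]), so that this is a representative
   of the class of f * g. *)
Definition fconv m f g (x : X) : R[i] :=
  cintegral m setT (fun y => f y * translate x g y).

Record multiplicative phi : Prop := Multiplicative {
  mult_continuous : ccontinuous phi;
  mult_nonzero : exists x, phi x != 0;
  multM : forall x y, translate x phi y = phi x * phi y }.

Definition bounded_multiplicative phi :=
  multiplicative phi /\ exists K : R, forall x, nrm (phi x) <= K.

Record character phi : Prop := Character {
  char_bounded_mult : bounded_multiplicative phi;
  char_inv : forall x, phi (hg_inv H x) = (phi x)^*;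
  char0 : phi X0 = 1 }.

(* the dual, with the compact-open topology *)
Definition dual_set : set {compact-open, X -> R[i]^o} := [set phi | character phi].
Definition dual := set_type dual_set.

End hypergroup.

Section dual_instances.
Context {R : realType} (H : @hypergroup R).

Lemma character1 : (fun=> 1 : R[i]^o) \in dual_set H.
Proof.
rewrite inE; split; last by [].
- split; last by exists (nrm (1 : R[i])) => x.
  split.
  + exact: cst_continuous.
  + by exists X0; exact: oner_neq0.
  + move=> x y; rewrite /translate /cintegral /= /Rintegral.
    rewrite !integral_cst //= [X in (1 * X)%E]probability_setT mul0e mule1 /=.
    by rewrite mulr1.
- by move=> x; rewrite /= rmorph1.
Qed.

HB.instance Definition _ := Topological.on (dual H).
HB.instance Definition _ :=
  isPointed.Build (dual H) (exist (fun phi => phi \in dual_set H) _ character1).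

End dual_instances.

Section laplace.
Context {R : realType} (H : @hypergroup R).
Notation X := ('X_R).
Variable m : {measure set (borel X) -> \bar R}.
Variable pi0 : {measure set (borel (dual H)) -> \bar R}.

Definition fourier (f : X -> R[i]) (chi : dual H) : R[i] :=
  cintegral m setT (fun x => f x * \val chi x).

(* [U] is the unitary operator [L2 m -> L2 pi0], acting on representatives *)
Definition plancherel_measure :=
  radon pi0 /\
  exists U : (X -> R[i]) -> (dual H -> R[i]),
    [/\ forall f, L2 m f -> L2 pi0 (U f) /\ sqnorm2 pi0 (U f) = sqnorm2 m f,
        forall (a : R[i]) f g, L2 m f -> L2 m g ->
          {ae pi0, forall chi,
            U (fun x => a * f x + g x) chi = a * U f chi + U g chi},
        forall h, L2 pi0 h ->
          exists2 f, L2 m f & {ae pi0, forall chi, U f chi = h chi}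
      & forall f, L1 m f -> L2 m f ->
          {ae pi0, forall chi, U f chi = fourier f chi}].

(* the closed support S of the Plancherel measure, as a set of functions *)
Definition planch_supp : set (X -> R[i]) :=
  [set (\val chi : X -> R[i]) | chi in msupport pi0].

Record unique_positive_character (phi0 : X -> R[i]) : Prop := UniquePositive {
  pos_supp : planch_supp phi0;
  pos_gt0 : forall x, 0 < phi0 x;
  pos_unique : forall psi, planch_supp psi -> (forall x, 0 < psi x) ->
    psi = phi0 }.

(* [phi l], for [l] in the parameter set [Lam], are the bounded multiplicative
   functions *)
Definition parametrization (Lam : set R[i]) (phi : R[i] -> X -> R[i]) :=
  phi @` Lam = bounded_multiplicative H.

Definition symitv (x : X) : set R := `[- \val x, \val x]%classic.

Record laplace_representation (Lam : set R[i]) (phi : R[i] -> X -> R[i])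
    (phi0 : X -> R[i]) (tau : X -> {measure set (measurableTypeR R) -> \bar R}) :
    Prop := LaplaceRepresentation {
  laplace_itv : exists a b : R, 0 < a < b /\
    forall l : R, a < l < b -> Lam l%:C /\ planch_supp (phi l%:C);
  laplace_on : forall x, tau x (~` symitv x) = 0%E;
  laplace_mass : forall x, tau x (symitv x) = (complex.Re (phi0 x))%:E;
  laplace_cos : forall l, Lam l -> planch_supp (phi l) -> forall x,
    phi l x = cintegral (tau x) (symitv x) (fun t => ccos (l * t%:C)) }.

End laplace.

Section functional_calculus.
Context {R : realType} (E : normedModType R[i]).
Notation X := ('X_R).
Variable m : {measure set (borel X) -> \bar R}.
Variable tau : X -> {measure set (measurableTypeR R) -> \bar R}.
Variable C : R -> E -> E.

Definition phiA (x : X) (v : E) : E :=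
  bochner (tau x) (symitv x) (fun t => C t v).

Definition TA (f : X -> R[i]) (v : E) : E :=
  bochner m setT (fun x => f x *: phiA x v).

End functional_calculus.

(* Main.v *)
Require Import Defs.
From HB Require Import structures.
From mathcomp Require Import all_boot all_order all_algebra.
From mathcomp Require Import finmap complex ring lra.
From mathcomp Require Import all_classical all_reals all_analysis.
From mathcomp Require Import measurable_realfun.

Set Implicit Arguments.
Unset Strict Implicit.
Unset Printing Implicit Defensive.

Import Order.TTheory GRing.Theory Num.Theory.
Import numFieldNormedType.Exports.
Import HBSimple HBNNSimple.

Local Open Scope classical_set_scope.
Local Open Scope complex_scope.
Local Open Scope ring_scope.

(** [T_A] is multiplicative because the operators [phi_A x] are limits of
    combinations of characters, and the scalar Fourier transform is
    multiplicative.

    Let [v] be a vector. The function [t |-> C t v] is continuous and even, hence,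
    uniformly on bounded sets, a limit of sums of [cos (l_j t) v_j] whose
    frequencies [l_j] may all be taken in the interval on which the Laplace
    representation is known ([even_cos_approx]). Integrating against [tau x],
    [phi_A(x) v] is close to the sum of the [phi_{l_j}(x) v_j]; moreover
    [C s (C t v)] is the half-sum of [C (s - t) v] and [C (s + t) v], and cosines
    satisfy the same identity, so that [phi_A(x) phi_A(y) v] is close to the sum of
    the [phi_{l_j}(x) phi_{l_j}(y) v_j] ([phiA_approximable]). Let [u] and [w] be
    real integrable functions of bounded support; [u * w] is one too
    ([rconv_support]). Integrating the two approximations,
    [T(u * w) v] is close to the sum of the
    [(\int (u * w) phi_{l_j}) v_j], and [T u (T w v)] to the sum of the
    [(\int u phi_{l_j}) (\int w phi_{l_j}) v_j]. These two sums are equal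
    ([Rintegral_rconv]), hence the operators are. The general case follows by
    truncation, since [T u] is bounded by a multiple of the norm of [u]
    ([wop_rconv]), and by linearity ([cwop_fconv]).

    The multiplicativity of the scalar Fourier transform rests on the
    invariance of the Haar measure [m], which gives absolute convergence, and on
    the self-adjointness of translations,
    [\int w(x * y) p(x) m(dx) = \int w(x) p(x * y) m(dx)] ([haar_adjoint]). For
    a third function [k], the integral of [p(y) (w * k)(x * y)] in [y] and that of
    [w(t) (p * k)(x * t)] in [t] are both the double integral of
    [p(y) w(t) k(x * y * t)], as the convolution of measures is commutative and
    associative ([integral_lam_hconvC]); one concludes by letting [k] concentrate
    at [0]. The functions [w * k] then tend to [w] because of the
    support axiom: a continuous involution of the half-line is the identity
    ([continuous_involution_id]), so [0] is in the support of [x * y] only if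
    [x = y], and therefore [z] is in the support of [s * t] if and only if [t] is
    in that of [s * z] ([msupport_swap]).

    Vector-valued integrals are handled by one estimate, [has_bochner_dist], and
    no vector-valued form of Fubini's theorem is used. Identities between
    iterated integrals of nonnegative functions are reduced to continuous
    functions of compact support by [mono_functional_unique]. *)

(** * Norms and strongly measurable functions *)

Section nrm_theory.
Context {R : realType}.

Section normed.
Variable V : normedZmodType R[i].
Implicit Types v w : V.

Lemma nrmE v : `|v| = (nrm v)%:C.
Proof.
have := normr_ge0 v; rewrite /nrm; case: `|v| => a b.
by rewrite lecE /= => /andP[/eqP -> _].
Qed.

Lemma nrm_ge0 v : 0 <= nrm v.
Proof. by have := normr_ge0 v; rewrite nrmE lecR. Qed.

Lemma nrm0 : nrm (0 : V) = 0.
Proof. by rewrite /nrm normr0. Qed.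

Lemma nrmN v : nrm (- v) = nrm v.
Proof. by rewrite /nrm normrN. Qed.

Lemma nrmB v w : nrm (v - w) = nrm (w - v).
Proof. by rewrite /nrm distrC. Qed.

Lemma ler_nrmD v w : nrm (v + w) <= nrm v + nrm w.
Proof. by have := ler_normD v w; rewrite !nrmE -rmorphD lecR. Qed.

Lemma ler_nrm_dist v w u : nrm (v - w) <= nrm (v - u) + nrm (u - w).
Proof.
have -> : v - w = (v - u) + (u - w) by rewrite addrA subrK.
exact: ler_nrmD.
Qed.

Lemma ler_nrm_dist_nrm v w : `|nrm v - nrm w| <= nrm (v - w).
Proof.
have h (a b : V) : nrm a - nrm b <= nrm (a - b).
  by have := ler_nrmD (a - b) b; rewrite subrK -lerBlDr.
by rewrite ler_norml h andbT lerNl opprB nrmB h.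
Qed.

Lemma nrm_eq0 v : (nrm v == 0) = (v == 0).
Proof. by rewrite -[RHS]normr_eq0 nrmE (inj_eq (@complexI R) _ 0). Qed.

Lemma ler_nrm_sum I (r : seq I) (P : pred I) (f : I -> V) :
  nrm (\sum_(i <- r | P i) f i) <= \sum_(i <- r | P i) nrm (f i).
Proof.
elim/big_ind2 : _ => //=; first by rewrite nrm0.
by move=> a b c d ha hc; rewrite (le_trans (ler_nrmD _ _))// lerD.
Qed.
End normed.

Lemma nrm_real (r : R) : nrm (r%:C : R[i]) = `|r|.
Proof. by rewrite /nrm normc_def /= expr0n addr0 sqrtr_sqr. Qed.

Lemma normRe_le_nrm (z : R[i]) : `|complex.Re z| <= nrm z.
Proof.
case: z => a b; rewrite /nrm normc_def /=.
by rewrite -sqrtr_sqr ler_wsqrtr// lerDl sqr_ge0.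
Qed.

Section module.
Variable E : normedModType R[i].
Implicit Types v w : E.

Lemma nrmZ (a : R[i]) v : nrm (a *: v) = nrm a * nrm v.
Proof. by apply: complexI; rewrite rmorphM /= -!nrmE normrZ. Qed.

Lemma nrmZr (a : R) v : nrm (a%:C *: v) = `|a| * nrm v.
Proof. by rewrite nrmZ nrm_real. Qed.

(** A positive element of [R[i]] is a positive real, so the complex-valued norm
    and its real version define the same convergence. *)
Lemma cvg_nrmP T (F : set_system T) {FF : Filter F} (f : T -> E) v :
  f @ F --> v <-> forall e : R, 0 < e -> \forall x \near F, nrm (v - f x) < e.
Proof.
split.
- move/cvgrPdist_lt => h e e0.
  have /h : 0 < e%:C :> R[i] by rewrite ltcR.
  by apply: filterS => x; rewrite nrmE ltcR.
- move=> h; apply/cvgrPdist_lt => -[e e'].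
  rewrite ltcE /= => /andP[/eqP -> e0].
  by apply: filterS (h _ e0) => x; rewrite nrmE ltcR.
Qed.

Lemma cvg_nrm_lt (F : nat -> E) v (e : R) :
  F @ \oo --> v -> 0 < e -> \forall n \near \oo, nrm (v - F n) < e.
Proof. by move=> /cvg_nrmP h /h. Qed.

Lemma cvg_nrm_dist (F : nat -> E) v :
  F @ \oo --> v -> (fun n => nrm (v - F n)) @ \oo --> 0.
Proof.
move=> /cvg_nrmP h; apply/cvgrPdist_lt => e e0.
by apply: filterS (h _ e0) => x; rewrite sub0r normrN ger0_norm// nrm_ge0.
Qed.

Lemma cvg_nrm (F : nat -> E) v :
  F @ \oo --> v -> (fun n => nrm (F n)) @ \oo --> nrm v.
Proof.
move=> /cvg_nrmP h; apply/cvgrPdist_lt => e e0.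
apply: filterS (h _ e0) => x; exact/le_lt_trans/ler_nrm_dist_nrm.
Qed.

End module.
End nrm_theory.

Section finitely_valued.
Context {R : realType} d (T : measurableType d).

(** [F] takes finitely many values, each on a measurable set. Unlike simple
    functions, given by overlapping sets, these functions are closed under
    arbitrary operations on the values. *)
Definition finval Y (F : T -> Y) := exists (I : finType) (J : T -> I) (v : I -> Y),
  (forall i, measurable (J @^-1` [set i])) /\ (forall x, F x = v (J x)).

Lemma finval_cst Y (y : Y) : finval (fun=> y).
Proof.
exists unit, (fun=> tt), (fun=> y); split=> // -[].
by rewrite (_ : _ @^-1` _ = setT)//; apply/seteqP; split.
Qed.

Lemma finval_comp Y Z (h : Y -> Z) F : finval F -> finval (h \o F).
Proof.
move=> [I [J [v [mJ Fv]]]]; exists I, J, (h \o v); split=> // x.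
by rewrite /= Fv.
Qed.

Lemma finval_pair Y Z (F : T -> Y) (G : T -> Z) :
  finval F -> finval G -> finval (fun x => (F x, G x)).
Proof.
move=> [I [J [v [mJ Fv]]]] [I' [J' [v' [mJ' Gv']]]].
exists (I * I')%type, (fun x => (J x, J' x)), (fun p => (v p.1, v' p.2)).
split=> [[i i']|x]; last by rewrite Fv Gv'.
rewrite (_ : _ @^-1` _ = J @^-1` [set i] `&` J' @^-1` [set i']).
  exact: measurableI.
by apply/seteqP; split => x /=; [move=> [-> ->]|move=> [-> ->]].
Qed.

Lemma finval_op Y Z W (h : Y -> Z -> W) F G :
  finval F -> finval G -> finval (fun x => h (F x) (G x)).
Proof.
by move=> hF hG; exact: (finval_comp (fun p => h p.1 p.2) (finval_pair hF hG)).
Qed.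

Lemma finval_mem (A : set T) : measurable A -> finval (fun x => x \in A).
Proof.
move=> mA; exists bool, (fun x => x \in A), id; split=> // -[].
- rewrite (_ : _ @^-1` _ = A)//; apply/seteqP; split => x /=; last exact: mem_set.
  exact: set_mem.
- rewrite (_ : _ @^-1` _ = ~` A); first exact: measurableC.
  apply/seteqP; split => x /= => [h Ax|nAx]; first by rewrite mem_set in h.
  exact: memNset.
Qed.

Lemma measurable_finval Y (F : T -> Y) (h : Y -> R) :
  finval F -> measurable_fun setT (h \o F).
Proof.
move=> [I [J [v [mJ Fv]]]] _ A mA; rewrite setTI.
rewrite (_ : _ @^-1` A = \bigcup_(i in [set i | A (h (v i))]) (J @^-1` [set i])).
  by apply: fin_bigcup_measurable => // ; exact: finite_finset.
apply/seteqP; split => x /=.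
  by rewrite Fv => Ax; exists (J x).
by move=> [i Ai Jx]; rewrite Fv Jx.
Qed.

Lemma integral_finval (mu : {measure set T -> \bar R}) D (mD : measurable D)
    (I : finType) (J : T -> I) (c : I -> R) :
  (forall i, measurable (J @^-1` [set i])) -> (forall i, 0 <= c i) ->
  (\int[mu]_(x in D) (c (J x))%:E =
   \sum_i (c i)%:E * mu (D `&` J @^-1` [set i]))%E.
Proof.
move=> mJ c0.
rewrite (eq_integral (fun x =>
    \sum_i (c i)%:E * (\1_(J @^-1` [set i]) x)%:E)%E); last first.
  move=> x _; rewrite (bigD1 (J x))//= big1 ?adde0.
    by rewrite indicE mem_set// mule1.
  move=> i iJ; rewrite indicE memNset ?mule0//= => /esym e.
  by move: iJ; rewrite e eqxx.
rewrite ge0_integral_sum//; last 2 first.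
- move=> i; apply/measurable_EFinP; exact: measurable_funM.
- by move=> i x _; rewrite mule_ge0// lee_fin.
apply: eq_bigr => i _.
rewrite ge0_integralZl//; last 2 first.
- by apply/measurable_EFinP; exact: measurable_indic.
- by rewrite lee_fin.
by rewrite integral_indic// setIC.
Qed.

End finitely_valued.

Section strongly_measurable_theory.
Context {R : realType} d (T : measurableType d) (E : normedModType R[i]).
Implicit Types (F G : T -> E) (D : set T).

(** The trace of [x] on the sets of [s]: the traces cut the space into disjoint
    measurable pieces on which [vs_fun s] is constant. *)
Definition vs_pat (s : vsimple T E) (x : T) : {ffun 'I_(vs_size s) -> bool} :=
  [ffun i => x \in vs_set (i : 'I_(vs_size s))].

Definition vs_patval (s : vsimple T E) (b : {ffun 'I_(vs_size s) -> bool}) : E :=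
  \sum_i ((b i)%:R : R)%:C *: vs_val i.

Lemma vs_funE (s : vsimple T E) x : vs_fun s x = vs_patval (vs_pat s x).
Proof. by apply: eq_bigr => i _; rewrite ffunE indicE. Qed.

Lemma measurable_vs_pat (s : vsimple T E) b : measurable (vs_pat s @^-1` [set b]).
Proof.
rewrite (_ : _ @^-1` _ = \bigcap_(i in [set: 'I_(vs_size s)])
    (if b i then vs_set i else ~` vs_set i)).
  apply: fin_bigcap_measurable => [|i _]; first exact: finite_finset.
  by case: (b i); [|apply: measurableC]; exact: vs_measurable.
apply/seteqP; split => x /=.
  move=> <- i _; rewrite ffunE; case: ifPn; first exact: set_mem.
  by move/negP => h /mem_set.
move=> h; apply/ffunP => i; rewrite ffunE.
by have := h i I; case: (b i) => /= hx; [exact: mem_set|exact: memNset].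
Qed.

Lemma finval_vs_fun (s : vsimple T E) : finval (vs_fun s).
Proof.
exists {ffun 'I_(vs_size s) -> bool}, (vs_pat s), (@vs_patval s).
by split; [exact: measurable_vs_pat|exact: vs_funE].
Qed.

(** The sets on which the value is zero are emptied: the simple function is then
    integrable as soon as its norm is. *)
Lemma vsimple_of_finval (I : finType) (J : T -> I) (v : I -> E) :
  (forall i, measurable (J @^-1` [set i])) ->
  exists s : vsimple T E, (forall x, vs_fun s x = v (J x)) /\
   forall i, exists j, @vs_set _ _ _ _ s i =
     (if v j == 0 then set0 else J @^-1` [set j]).
Proof.
move=> mJ.
have mA (i : 'I_#|I|) : measurable
    (if v (enum_val i) == 0 then set0 else J @^-1` [set enum_val i]).
  by case: ifP => // _; exact: mJ.
exists (VSimple (fun i => v (enum_val i)) mA); split => [x|i]; last first.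
  by exists (enum_val i).
rewrite /vs_fun /= (bigD1 (enum_rank (J x)))//= big1 ?addr0.
  rewrite enum_rankK; case: ifPn => [/eqP ->|_]; first by rewrite scaler0.
  by rewrite indicE mem_set//= scale1r.
move=> i iJ; rewrite indicE memNset ?scale0r//.
by case: ifP => _ /= [] // Jx; move: iJ; rewrite Jx enum_valK eqxx.
Qed.

(** Strong measurability in terms of finitely valued functions, which makes its
    closure properties immediate. *)
Lemma strongly_measurableP D F : strongly_measurable D F <->
  exists2 f : nat -> T -> E, forall n, finval (f n) &
    forall x, D x -> (fun n => f n x) @ \oo --> F x.
Proof.
split=> [[s sF]|[f ff fF]].
  by exists (fun n => vs_fun (s n)) => // n; exact: finval_vs_fun.
have /choice[s sf] n : exists s : vsimple T E, forall x, vs_fun s x = f n x.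
  have [I [J [v [mJ fv]]]] := ff n.
  have [s [sf _]] := vsimple_of_finval v mJ.
  by exists s => x; rewrite sf fv.
exists s => x Dx; rewrite (_ : (fun _ => _) = fun n => f n x); first exact: fF.
by apply/funext => n; rewrite sf.
Qed.

Lemma strongly_measurable_cst D (v : E) : strongly_measurable D (fun=> v).
Proof.
apply/strongly_measurableP; exists (fun _ _ => v); first by move=> n; exact: finval_cst.
by move=> x _; exact: cvg_cst.
Qed.

Lemma strongly_measurableD D F G : strongly_measurable D F ->
  strongly_measurable D G -> strongly_measurable D (F \+ G).
Proof.
move=> /strongly_measurableP[f ff fF] /strongly_measurableP[g gg gG].
apply/strongly_measurableP; exists (fun n x => f n x + g n x) => [n|x Dx].
  exact: (finval_op (fun x y => x + y)).
by apply: cvgD; [exact: fF|exact: gG].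
Qed.

Lemma strongly_measurableZ D (a : R[i]) F : strongly_measurable D F ->
  strongly_measurable D (fun x => a *: F x).
Proof.
move=> /strongly_measurableP[f ff fF].
apply/strongly_measurableP; exists (fun n x => a *: f n x) => [n|x Dx].
  exact: (finval_comp (fun x => a *: x)).
by apply: cvgZr; exact: fF.
Qed.

Lemma strongly_measurableN D F : strongly_measurable D F ->
  strongly_measurable D (\- F).
Proof.
move=> /(strongly_measurableZ (-1)).
by congr strongly_measurable; apply/funext => x; rewrite scaleN1r.
Qed.

Lemma strongly_measurableB D F G : strongly_measurable D F ->
  strongly_measurable D G -> strongly_measurable D (F \- G).
Proof. by move=> hF hG; exact: strongly_measurableD hF (strongly_measurableN hG). Qed.

Lemma measurable_nrm D F : strongly_measurable D F ->
  measurable_fun D (fun x => nrm (F x)).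
Proof.
move=> /strongly_measurableP[f ff fF].
apply: (@measurable_fun_cvg _ _ _ _ (fun n x => nrm (f n x))) => [n|x Dx].
  apply: (measurable_funS measurableT) => //.
  exact: (measurable_finval (fun x => nrm x)).
by apply: cvg_nrm; exact: fF.
Qed.

Lemma finval_sfun (h : {sfun T >-> R}) : finval (h : T -> R).
Proof.
pose r := fset_set (range h).
have hr x : h x \in r by rewrite in_fset_set// inE.
exists (r : finType), (fun x => FSetSub (hr x)), (fun y => \val y); split=> // y.
rewrite (_ : _ @^-1` _ = h @^-1` [set \val y]); first exact: measurable_sfunP.
by apply/seteqP; split => x /=; [move=> <-|move=> e; exact/val_inj].
Qed.

Lemma real_finval_approx D (mD : measurable D) (p : T -> R) : measurable_fun D p ->
  exists2 q : nat -> T -> R, forall n, finval (q n) &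
    forall x, D x -> (fun n => q n x) @ \oo --> p x.
Proof.
move=> /measurable_EFinP mp; have [g gp] := approximation_sfun mD mp.
exists g => [n|x Dx]; first exact: finval_sfun.
by have := gp x Dx => /fine_cvgP[].
Qed.

Lemma strongly_measurable_comp D (mD : measurable D) (p : T -> R) (h : R -> E) :
  measurable_fun D p -> continuous h -> strongly_measurable D (h \o p).
Proof.
move=> mp ch; have [q qq qp] := real_finval_approx mD mp.
apply/strongly_measurableP; exists (fun n => h \o q n) => [n|x Dx].
  exact: finval_comp.
by apply: continuous_cvg; [exact: ch|exact: qp].
Qed.

Lemma strongly_measurableZfun D (mD : measurable D) (p : T -> R) F :
  measurable_fun D p -> strongly_measurable D F ->
  strongly_measurable D (fun x => (p x)%:C *: F x).
Proof.
move=> mp /strongly_measurableP[f ff fF]; have [q qq qp] := real_finval_approx mD mp.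
apply/strongly_measurableP; exists (fun n x => (q n x)%:C *: f n x) => [n|x Dx].
  exact: (finval_op (fun a v => a%:C *: v)).
apply: cvgZ; last exact: fF.
have /cvgrPdist_lt h := qp x Dx.
apply/cvgrPdist_lt => -[e e']; rewrite ltcE /= => /andP[/eqP -> e0].
by apply: filterS (h _ e0) => n; rewrite -rmorphB nrmE ltcR nrm_real.
Qed.

Lemma strongly_measurable_sum D (I : Type) (r : seq I) (F : I -> T -> E) :
  (forall i, strongly_measurable D (F i)) ->
  strongly_measurable D (fun x => \sum_(i <- r) F i x).
Proof.
move=> sF; elim: r => [|i r IH].
  rewrite (_ : (fun x => _) = fun=> 0); last by apply/funext => x; rewrite big_nil.
  exact: strongly_measurable_cst.
rewrite (_ : (fun x => _) = F i \+ (fun x => \sum_(j <- r) F j x)).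
  exact: strongly_measurableD.
by apply/funext => x; rewrite big_cons.
Qed.

End strongly_measurable_theory.

(** * The Bochner integral *)

Section bochner_theory.
Context {R : realType} d (T : measurableType d) (E : normedModType R[i]).
Variables (mu : {measure set T -> \bar R}) (D : set T).
Hypothesis mD : measurable D.
Implicit Types (F G : T -> E) (s t : vsimple T E).

Local Notation hbi := (has_bochner_integral mu D).

(** The sets of [s] may overlap, so the triangle inequality on the sum defining
    the integral is not enough: it is applied after refining [s] into the
    disjoint pieces of its traces. *)
Lemma nrm_vs_integral_le s : vs_integrable mu D s ->
  ((nrm (vs_integral mu D s))%:E <= \int[mu]_(x in D) (nrm (vs_fun s x))%:E)%E.
Proof.
move=> si.
pose P : finType := {ffun 'I_(vs_size s) -> bool}.
pose A (b : P) := D `&` vs_pat s @^-1` [set b].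
have mA b : measurable (A b).
  by apply: measurableI => //; exact: measurable_vs_pat.
have muS i : fine (mu (D `&` vs_set (i : 'I_(vs_size s)))) =
    \sum_(b : P) (b i)%:R * fine (mu (A b)).
  have e : mu (D `&` vs_set i) = (\sum_(b : P) ((b i)%:R)%:E * mu (A b))%E.
    rewrite -(integral_finval mu mD (c := fun b : P => (b i)%:R))//; last first.
      exact: measurable_vs_pat.
    rewrite (eq_integral (fun x => (\1_(vs_set i) x)%:E)); last first.
      by move=> x _; rewrite ffunE indicE.
    rewrite integral_indic//; last exact: vs_measurable.
    by rewrite setIC.
  have fA (b : P) : (((b i)%:R)%:E * mu (A b))%E \is a fin_num.
    case: (boolP (b i)) => [bi|_]; last by rewrite mul0e.
    rewrite fin_numM// ge0_fin_numE//; apply: le_lt_trans (si i).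
    apply: le_measure; rewrite ?inE//.
      by apply: measurableI => //; exact: vs_measurable.
    apply: setIS => x /= xb; move: bi; rewrite -xb ffunE; exact: set_mem.
  rewrite e -sum_fine//; apply: eq_bigr => b _.
  by case: (b i); rewrite ?mul0e ?mul1e ?mul0r ?mul1r.
have -> : vs_integral mu D s = \sum_(b : P) (fine (mu (A b)))%:C *: vs_patval b.
  rewrite /vs_integral (eq_bigr (fun i => \sum_(b : P)
      ((b i)%:R * fine (mu (A b)))%:C *: vs_val i)); last first.
    by move=> i _; rewrite muS -scaler_suml rmorph_sum.
  rewrite exchange_big; apply: eq_bigr => b _.
  rewrite /vs_patval scaler_sumr; apply: eq_bigr => i _.
  by rewrite scalerA mulrC rmorphM.
under eq_integral do rewrite vs_funE.
rewrite (integral_finval mu mD (c := fun b => nrm (vs_patval b))); last 2 first.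
- exact: measurable_vs_pat.
- by move=> b; exact: nrm_ge0.
apply: (@le_trans _ _ (\sum_(b : P) (nrm (vs_patval b) * fine (mu (A b)))%:E)%E).
  rewrite sumEFin lee_fin (le_trans (ler_nrm_sum _ _ _))//.
  apply: ler_sum => b _; rewrite nrmZr mulrC ger0_norm//.
apply: lee_sum => b _; rewrite EFinM; apply: lee_wpmul2l.
  by rewrite lee_fin nrm_ge0.
have [->|h] := eqVneq (mu (A b)) +oo%E; first by rewrite leey.
by rewrite fineK// ge0_fin_numE// lt_neqAle h leey.
Qed.

Definition vs_lin (a : R[i]) s t : vsimple T E :=
  VSimple (fun i : 'I_(vs_size s + vs_size t) => match fintype.split i with
                                             | inl j => a *: vs_val j
                                             | inr j => vs_val j end)
    (vs_set := fun i => match fintype.split i with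
             | inl j => vs_set j
             | inr j => vs_set j end)
    (fun i => match fintype.split i as u return measurable
        (match u with inl j => vs_set j | inr j => vs_set j end) with
             | inl j => vs_measurable j
             | inr j => vs_measurable j end).

Lemma vs_fun_lin a s t x : vs_fun (vs_lin a s t) x = a *: vs_fun s x + vs_fun t x.
Proof.
rewrite /vs_fun /= big_split_ord /= scaler_sumr; congr (_ + _); apply: eq_bigr => i _.
  by rewrite (unsplitK (inl i)) !scalerA mulrC.
by rewrite (unsplitK (inr i)).
Qed.

Lemma vs_integral_lin a s t :
  vs_integral mu D (vs_lin a s t) = a *: vs_integral mu D s + vs_integral mu D t.
Proof.
rewrite /vs_integral /= big_split_ord /= scaler_sumr.
congr (_ + _); apply: eq_bigr => i _.
  by rewrite (unsplitK (inl i)) !scalerA mulrC.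
by rewrite (unsplitK (inr i)).
Qed.

Lemma vs_integrable_lin a s t : vs_integrable mu D s -> vs_integrable mu D t ->
  vs_integrable mu D (vs_lin a s t).
Proof. by move=> hs ht i /=; case: fintype.split => j; [exact: hs|exact: ht]. Qed.

Lemma strongly_measurable_vs_fun s : strongly_measurable D (vs_fun s).
Proof. by exists (fun=> s) => x _; exact: cvg_cst. Qed.

Lemma measurable_nrm_sub F G : strongly_measurable D F -> strongly_measurable D G ->
  measurable_fun D (fun x => (nrm (F x - G x))%:E).
Proof.
move=> mF mG; apply/measurable_EFinP.
exact: (measurable_nrm (strongly_measurableB mF mG)).
Qed.

(** The triangle inequality in L1. *)
Lemma integral_nrm_dist F G H : strongly_measurable D F ->
  strongly_measurable D G -> strongly_measurable D H ->
  (\int[mu]_(x in D) (nrm (F x - H x))%:E <=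
   \int[mu]_(x in D) (nrm (F x - G x))%:E +
   \int[mu]_(x in D) (nrm (G x - H x))%:E)%E.
Proof.
move=> mF mG mH.
rewrite -ge0_integralD//; try exact: measurable_nrm_sub;
  try by move=> *; rewrite lee_fin nrm_ge0.
apply: ge0_le_integral => //.
- by move=> *; rewrite lee_fin nrm_ge0.
- exact: measurable_nrm_sub.
- by apply: emeasurable_funD; exact: measurable_nrm_sub.
- by move=> x _; rewrite -EFinD lee_fin ler_nrm_dist.
Qed.

Lemma vs_integral_dist s t : vs_integrable mu D s -> vs_integrable mu D t ->
  ((nrm (vs_integral mu D s - vs_integral mu D t))%:E <=
   \int[mu]_(x in D) (nrm (vs_fun s x - vs_fun t x))%:E)%E.
Proof.
move=> si ti.
have := nrm_vs_integral_le (@vs_integrable_lin (-1) _ _ ti si).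
rewrite vs_integral_lin scaleN1r addrC => /le_trans; apply.
rewrite le_eqVlt (eq_integral (fun x => (nrm (vs_fun s x - vs_fun t x))%:E)) ?eqxx//.
by move=> x _; rewrite vs_fun_lin scaleN1r addrC.
Qed.

(** The basic estimate, from which uniqueness and all bounds on integrals follow.
    The right-hand side may be infinite. *)
Lemma has_bochner_dist F G v w : hbi F v -> hbi G w ->
  ((nrm (v - w))%:E <= \int[mu]_(x in D) (nrm (F x - G x))%:E)%E.
Proof.
move=> [mF [s [si sF sv]]] [mG [t [ti tG tw]]].
apply/lee_addgt0Pr => e e0.
have [q e40 ->] : exists2 q : R, 0 < q & e = q + q + q + q.
  by exists (e / 4); [rewrite divr_gt0|field].
have [n [n1 n2 n3 n4]] : exists n, [/\
    (\int[mu]_(x in D) (nrm (F x - vs_fun (s n) x))%:E <= (q)%:E)%E,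
    (\int[mu]_(x in D) (nrm (G x - vs_fun (t n) x))%:E <= (q)%:E)%E,
    nrm (v - vs_integral mu D (s n)) <= q &
    nrm (w - vs_integral mu D (t n)) <= q].
  have h (u : nat -> \bar R) : u @ \oo --> 0%E -> \forall n \near \oo, (u n <= (q)%:E)%E.
    move=> u0; have : \forall n \near \oo, (u n < (q)%:E)%E.
      have /fine_cvgP[fu /(cvgr_lt (0 : R)) /(_ _ e40) lu] := u0.
      apply: filterS2 fu lu => n un; rewrite -lte_fin fineK//.
    by apply: filterS => n /ltW.
  have h1 := h _ sF; have h2 := h _ tG.
  have h3 := cvg_nrm_lt sv e40.
  have h4 := cvg_nrm_lt tw e40.
  have [n] := filter_ex (filterI (filterI h1 h2) (filterI h3 h4)).
  by move=> [[? ?] [/ltW ? /ltW ?]]; exists n.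
have m1 := strongly_measurable_vs_fun (s n).
have m2 := strongly_measurable_vs_fun (t n).
have h1 : ((nrm (vs_integral mu D (s n) - vs_integral mu D (t n)))%:E <=
    (q)%:E + (\int[mu]_(x in D) (nrm (F x - G x))%:E + (q)%:E))%E.
  apply: (le_trans (vs_integral_dist (si n) (ti n))).
  apply: (le_trans (integral_nrm_dist m1 mF m2)); apply: leeD.
    by under eq_integral do rewrite nrmB.
  apply: (le_trans (integral_nrm_dist mF mG m2)); exact: leeD2l.
have h2 : nrm (v - w) <= q + (nrm (vs_integral mu D (s n) - vs_integral mu D (t n)) + q).
  apply: (le_trans (ler_nrm_dist _ _ (vs_integral mu D (s n)))); apply: lerD => //.
  apply: (le_trans (ler_nrm_dist _ _ (vs_integral mu D (t n)))); apply: lerD => //.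
  by rewrite nrmB.
rewrite -lee_fin in h2; apply: (le_trans h2).
rewrite EFinD (EFinD (nrm _)).
apply: (le_trans (leeD (lexx _) (leeD h1 (lexx _)))).
move: (integral _ _ _) => -[r| |] //=.
by rewrite -!EFinD lee_fin; lra.
Qed.

Lemma has_bochner_cst0 : hbi (fun=> 0 : E) 0.
Proof.
split; first exact: strongly_measurable_cst.
pose z : vsimple T E := @VSimple _ _ _ _ 0 (fun=> set0) (fun=> 0) (fun=> measurable0).
have z0 x : vs_fun z x = 0 by rewrite /vs_fun big_ord0.
exists (fun=> z); split => [n []//||].
  rewrite (_ : (fun _ => _) = fun=> 0%E); first exact: cvg_cst.
  apply/funext => n; apply: integral0_eq => x _.
  by rewrite z0 subrr nrm0.
rewrite (_ : (fun _ => _) = fun=> 0); first exact: cvg_cst.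
by apply/funext => n; rewrite /vs_integral big_ord0.
Qed.

Lemma has_bochner_nrm_le F v : hbi F v ->
  ((nrm v)%:E <= \int[mu]_(x in D) (nrm (F x))%:E)%E.
Proof.
move=> hF; have := has_bochner_dist hF has_bochner_cst0.
by rewrite subr0; under eq_integral do rewrite subr0.
Qed.

Lemma has_bochner_unique F v w : hbi F v -> hbi F w -> v = w.
Proof.
move=> hv hw; apply/eqP; rewrite -subr_eq0 -nrm_eq0 eq_le nrm_ge0 andbT -lee_fin.
apply: (le_trans (has_bochner_dist hv hw)); rewrite integral0_eq// => x _.
by rewrite subrr nrm0.
Qed.

Lemma bochnerE F v : hbi F v -> bochner mu D F = v.
Proof.
move=> hF; apply: xget_unique => // w hw; exact: has_bochner_unique hw hF.
Qed.

(** [bochner] chooses an arbitrary value, but the value is unique. *)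
Lemma bochner_integrableP F : bochner_integrable mu D F <-> hbi F (bochner mu D F).
Proof.
by split=> [[v hv]|?]; [rewrite (bochnerE hv)|exists (bochner mu D F)].
Qed.

Lemma has_bochner_lin (a : R[i]) F G v w : hbi F v -> hbi G w ->
  hbi (fun x => a *: F x + G x) (a *: v + w).
Proof.
move=> [mF [s [si sF sv]]] [mG [t [ti tG tw]]]; split.
  exact: (strongly_measurableD (strongly_measurableZ a mF) mG).
exists (fun n => vs_lin a (s n) (t n)); split.
- by move=> n; exact: vs_integrable_lin.
- apply: (@squeeze_cvge _ _ _ _ (cst 0%E) _ (fun n => (nrm a)%:E *
      \int[mu]_(x in D) (nrm (F x - vs_fun (s n) x))%:E +
      \int[mu]_(x in D) (nrm (G x - vs_fun (t n) x))%:E)%E).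
  + apply: nearW => n; apply/andP; split.
      by apply: integral_ge0 => x _; rewrite lee_fin nrm_ge0.
    have ms := strongly_measurable_vs_fun (s n).
    have mt := strongly_measurable_vs_fun (t n).
    rewrite -ge0_integralZl//; last 3 first.
    * exact: measurable_nrm_sub.
    * by move=> *; rewrite lee_fin nrm_ge0.
    * by rewrite lee_fin nrm_ge0.
    rewrite -ge0_integralD//; last 4 first.
    * by move=> *; rewrite -EFinM lee_fin mulr_ge0// nrm_ge0.
    * by apply: measurable_funeM; exact: measurable_nrm_sub.
    * by move=> *; rewrite lee_fin nrm_ge0.
    * exact: measurable_nrm_sub.
    apply: ge0_le_integral => //.
    * by move=> *; rewrite lee_fin nrm_ge0.
    * apply: measurable_nrm_sub; last exact: strongly_measurable_vs_fun.
      exact: (strongly_measurableD (strongly_measurableZ a mF) mG).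
    * apply: emeasurable_funD; last exact: measurable_nrm_sub.
      by apply: measurable_funeM; exact: measurable_nrm_sub.
    * move=> x _; rewrite -EFinM -EFinD lee_fin -nrmZ vs_fun_lin.
      by rewrite opprD addrACA -scalerBr ler_nrmD.
  + exact: cvg_cst.
  + rewrite -[X in _ --> X]adde0; apply: cvgeD => //.
    by rewrite -[X in _ --> X](mule0 (nrm a)%:E); exact: cvgeZl.
- rewrite (_ : (fun _ => _) = fun n => a *: vs_integral mu D (s n) + vs_integral mu D (t n)).
    by apply: cvgD => //; exact: cvgZr.
  by apply/funext => n; rewrite vs_integral_lin.
Qed.

Lemma has_bochnerZ (a : R[i]) F v : hbi F v -> hbi (fun x => a *: F x) (a *: v).
Proof.
move=> h; have := has_bochner_lin a h has_bochner_cst0; rewrite addr0.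
by congr has_bochner_integral; apply/funext => x; rewrite addr0.
Qed.

Lemma has_bochnerD F G v w : hbi F v -> hbi G w -> hbi (F \+ G) (v + w).
Proof.
move=> hF hG; have := has_bochner_lin 1 hF hG; rewrite scale1r.
by congr has_bochner_integral; apply/funext => x /=; rewrite scale1r.
Qed.

Lemma has_bochner_sum (I : Type) (r : seq I) (F : I -> T -> E) (v : I -> E) :
  (forall i, hbi (F i) (v i)) ->
  hbi (fun x => \sum_(i <- r) F i x) (\sum_(i <- r) v i).
Proof.
move=> h; elim: r => [|i r IH].
  rewrite big_nil (_ : (fun _ => _) = fun=> 0); first exact: has_bochner_cst0.
  by apply/funext => x; rewrite big_nil.
rewrite big_cons (_ : (fun _ => _) = F i \+ (fun x => \sum_(i <- r) F i x)).
  exact: has_bochnerD.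
by apply/funext => x; rewrite big_cons.
Qed.

End bochner_theory.

Section bochner_operator.
Context {R : realType} d (T : measurableType d) (E E' : normedModType R[i]).
Variables (mu : {measure set T -> \bar R}) (D : set T).
Hypothesis mD : measurable D.

Definition vs_map (A : E -> E') (s : vsimple T E) : vsimple T E' :=
  VSimple (fun i => A (vs_val i)) (@vs_measurable _ _ _ _ s).

Variables (A : E -> E') (K : R).
Hypotheses (lA : linear A) (AK : forall v, nrm (A v) <= K * nrm v).

Let A0 : A 0 = 0.
Proof. by have := lA (-1) 0 0; rewrite !scaleN1r !addNr. Qed.

Let AD x y : A (x + y) = A x + A y.
Proof. by have := lA 1 x y; rewrite !scale1r. Qed.

Let AZ a x : A (a *: x) = a *: A x.
Proof. by have := lA a x 0; rewrite !addr0 A0 addr0. Qed.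

Let AB x y : A (x - y) = A x - A y.
Proof. by rewrite AD -scaleN1r AZ scaleN1r. Qed.

Lemma linear_bounded_cvg (F : nat -> E) v :
  F @ \oo --> v -> (fun n => A (F n)) @ \oo --> A v.
Proof.
move=> Fv; have K0 : 0 < `|K| + 1 by rewrite ltr_pwDr.
apply/cvg_nrmP => e e0; have eK : 0 < e / (`|K| + 1) by rewrite divr_gt0.
apply: filterS (cvg_nrm_lt Fv eK) => n; rewrite ltr_pdivlMr// -AB => h.
apply: le_lt_trans (AK _) _; apply: le_lt_trans h; rewrite mulrC.
by rewrite ler_wpM2l ?nrm_ge0// (le_trans (ler_norm _))// lerDl.
Qed.

Lemma strongly_measurable_op F : strongly_measurable D F ->
  strongly_measurable D (A \o F).
Proof.
move=> /strongly_measurableP[f ff fF].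
apply/strongly_measurableP; exists (fun n => A \o f n) => [n|x Dx].
  exact: finval_comp.
exact: (linear_bounded_cvg (fF x Dx)).
Qed.

Lemma has_bochner_op F v : has_bochner_integral mu D F v ->
  has_bochner_integral mu D (A \o F) (A v).
Proof.
move=> [mF [s [si sF sv]]]; have cA := linear_bounded_cvg.
have Af t x : vs_fun (vs_map A t) x = A (vs_fun t x).
  by rewrite /vs_fun (big_morph _ AD A0); apply: eq_bigr => i _; rewrite AZ.
have mAF : strongly_measurable D (A \o F) by exact: strongly_measurable_op.
split => //; exists (fun n => vs_map A (s n)); split.
- by move=> n i; exact: si.
- apply: (@squeeze_cvge _ _ _ _ (cst 0%E) _ (fun n => `|K|%:E *
      \int[mu]_(x in D) (nrm (F x - vs_fun (s n) x))%:E)%E).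
  + apply: nearW => n; apply/andP; split.
      by apply: integral_ge0 => x _; rewrite lee_fin nrm_ge0.
    have ms := strongly_measurable_vs_fun D (s n).
    rewrite -ge0_integralZl//; last 2 first.
    * exact: measurable_nrm_sub.
    * by move=> *; rewrite lee_fin nrm_ge0.
    apply: ge0_le_integral => //.
    * by move=> *; rewrite lee_fin nrm_ge0.
    * apply: measurable_nrm_sub => //; exact: strongly_measurable_vs_fun.
    * by apply: measurable_funeM; exact: measurable_nrm_sub.
    * move=> x _; rewrite -EFinM lee_fin Af /= -AB (le_trans (AK _))//.
      by rewrite ler_wpM2r ?nrm_ge0// ler_norm.
  + exact: cvg_cst.
  + by rewrite -[X in _ --> X](mule0 `|K|%:E); exact: cvgeZl.
- rewrite (_ : (fun _ => _) = fun n => A (vs_integral mu D (s n))); first exact: cA.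
  apply/funext => n; rewrite /vs_integral (big_morph _ AD A0).
  by apply: eq_bigr => i _; rewrite AZ.
Qed.

End bochner_operator.

Section bochner_complete.
Context {R : realType} d (T : measurableType d) (E : completeNormedModType R[i]).
Variables (mu : {measure set T -> \bar R}) (D : set T).
Hypothesis mD : measurable D.

Lemma nrm_cauchy_cvg (u : nat -> E) :
  (forall e : R, 0 < e -> exists N, forall n m, (N <= n)%N -> (N <= m)%N ->
     nrm (u n - u m) <= e) ->
  exists v : E, u @ \oo --> v.
Proof.
move=> h; suff cu : cvgn u by exists (limn u).
apply: cauchy_cvg; apply/cauchy_ballP => -[e e'].
rewrite ltcE /= => /andP[/eqP -> e0].
have [N hN] := h (e / 2) (divr_gt0 e0 (ltr0Sn _ _)).
have hs : (u @ \oo) (u @` [set n | (N <= n)%N]).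
  by exists N => // n /= Nn; exists n.
exists (u @` [set n | (N <= n)%N], u @` [set n | (N <= n)%N]) => //.
move=> [x y] /= [[n Nn <-] [k Nk <-]]; rewrite -ball_normE /ball_ /=.
rewrite nrmE ltcR (le_lt_trans (hN _ _ Nn Nk))//.
by rewrite ltr_pdivrMr// ltr_pMr// ltr1n.
Qed.

(** The approximants of [F] are cut off where their norm exceeds twice that of
    [F], which makes dominated convergence applicable: they converge to [F] in
    the mean, and their integrals form a Cauchy sequence. *)
Lemma bochner_exists F : strongly_measurable D F ->
  (\int[mu]_(x in D) (nrm (F x : E))%:E < +oo)%E -> bochner_integrable mu D F.
Proof.
move=> mF iF; have [f ff fF] := (strongly_measurableP _ _).1 mF.
have mnF : measurable_fun D (fun x => nrm (F x)) by exact: measurable_nrm.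
have ffm n : strongly_measurable D (f n).
  by apply/strongly_measurableP; exists (fun=> f n) => // x _; exact: cvg_cst.
pose B n := D `&` [set x | nrm (f n x) <= 2 * nrm (F x)].
have mB n : measurable (B n).
  have -> : B n = D `&` (fun x => 2 * nrm (F x) - nrm (f n x)) @^-1` `[0, +oo[.
    by apply/seteqP; split => x /= [Dx]; rewrite in_itv /= andbT subr_ge0.
  apply: measurable_funB => //; first exact: measurable_funM.
  exact: measurable_nrm.
pose g n x := if x \in B n then f n x else 0.
have fg n : finval (g n).
  exact: (finval_op (fun b v => if b then v else 0 : E) (finval_mem (mB n)) (ff n)).
have gF n x : D x -> nrm (g n x) <= 2 * nrm (F x).
  move=> Dx; rewrite /g; case: ifPn => [/set_mem[]//|_].
  by rewrite nrm0 mulr_ge0// nrm_ge0.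
have mg n : strongly_measurable D (g n).
  by apply/strongly_measurableP; exists (fun=> g n) => // x _; exact: cvg_cst.
have ig n : (\int[mu]_(x in D) (nrm (g n x))%:E < +oo)%E.
  apply: (@le_lt_trans _ _ (\int[mu]_(x in D) (2%:E * (nrm (F x))%:E))%E).
    apply: ge0_le_integral => //.
    - by move=> *; rewrite lee_fin nrm_ge0.
    - by apply/measurable_EFinP; exact: measurable_nrm.
    - by apply: measurable_funeM; apply/measurable_EFinP.
    - by move=> x Dx; rewrite -EFinM lee_fin gF.
  rewrite ge0_integralZl//; last 2 first.
  - exact/measurable_EFinP.
  - by move=> *; rewrite lee_fin nrm_ge0.
  by rewrite lte_mul_pinfty.
have /choice[s hs] n : exists s : vsimple T E,
    vs_integrable mu D s /\ forall x, vs_fun s x = g n x.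
  have [I [J [v [mJ gv]]]] := fg n.
  have [s [sg sA]] := vsimple_of_finval v mJ.
  exists s; split => [i|x]; last by rewrite sg gv.
  have [j ->] := sA i; case: ifPn => [_|vj]; first by rewrite setI0 measure0.
  have vj0 : 0 < nrm (v j) by rewrite lt_neqAle nrm_ge0 andbT eq_sym nrm_eq0.
  have := ig n; under eq_integral do rewrite gv.
  rewrite (integral_finval mu mD (c := fun j => nrm (v j)))//; last first.
    by move=> k; exact: nrm_ge0.
  rewrite (bigD1 j)//= => /(le_lt_trans (leeDl _ _)) => /(_ _) h.
  have {h} := h (sume_ge0 _ _).
  move=> h; have {}h : ((nrm (v j))%:E * mu (D `&` J @^-1` [set j]) < +oo)%E.
    apply: h => k _; rewrite mule_ge0// lee_fin; exact: nrm_ge0.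
  rewrite ltNge leye_eq; apply/negP => /eqP e; move: h.
  by rewrite e gt0_muley ?ltxx// lte_fin.
have si n : vs_integrable mu D (s n) := (hs n).1.
have sg n : vs_fun (s n) = g n by apply/funext => x; exact: (hs n).2.
have cgF x : D x -> (fun n => nrm (F x - g n x)) @ \oo --> 0.
  move=> Dx; apply: cvg_nrm_dist.
  have [F0|F0] := eqVneq (F x) 0.
    rewrite (_ : (fun _ => _) = fun=> 0); first by rewrite F0; exact: cvg_cst.
    apply/funext => n; apply/eqP; rewrite -nrm_eq0 eq_le nrm_ge0 andbT.
    by rewrite (le_trans (gF n x Dx))// F0 nrm0 mulr0.
  have nF0 : 0 < nrm (F x) by rewrite lt_neqAle nrm_ge0 andbT eq_sym nrm_eq0.
  apply/cvg_nrmP => e e0.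
  apply: filterS2 (cvg_nrm_lt (fF x Dx) e0) (cvg_nrm_lt (fF x Dx) nF0) => n h1 h2.
  rewrite /g mem_set//; split => //=.
  rewrite mulr2n mulrDl mul1r -lerBlDl; apply: le_trans (ltW h2).
  by rewrite nrmB (le_trans (ler_norm _))// ler_nrm_dist_nrm.
have cgFE x : D x -> (fun n => (nrm (F x - g n x))%:E) @ \oo --> 0%E.
  by move=> Dx; apply/fine_cvgP; split; [exact: nearW|exact: cgF].
have iFg : (fun n => \int[mu]_(x in D) (nrm (F x - g n x))%:E)%E @ \oo --> 0%E.
  have hdc := @dominated_convergence _ _ _ mu D mD
    (fun n x => (nrm (F x - g n x))%:E) (cst 0%E) (fun x => (3 * nrm (F x))%:E)
    (fun n => measurable_nrm_sub mF (mg n)) (measurable_cst _)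
    (aeW _ cgFE).
  have [||_ _] := hdc.
  - apply/integrableP; split; first by apply/measurable_EFinP; exact: measurable_funM.
    under eq_integral do rewrite gee0_abs ?lee_fin ?mulr_ge0 ?nrm_ge0// EFinM.
    rewrite ge0_integralZl//; last 2 first.
    + exact/measurable_EFinP.
    + by move=> *; rewrite lee_fin nrm_ge0.
    by rewrite lte_mul_pinfty.
  - apply: aeW => x n Dx; rewrite gee0_abs ?lee_fin ?nrm_ge0//.
    rewrite (le_trans (ler_nrmD _ _))// nrmN.
    by have := gF n x Dx; lra.
  - by rewrite integral_cst// mul0e.
have [v sv] : exists v : E, (fun n => vs_integral mu D (s n)) @ \oo --> v.
  apply: nrm_cauchy_cvg => e e0.
  have /fine_cvgP[fu /(cvgr_lt (0 : R)) /(_ (e / 2) _)] := iFg.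
  rewrite divr_gt0// => /(_ isT) lu.
  have [N _ hN] := filterI fu lu; exists N => n m Nn Nm.
  rewrite -lee_fin (le_trans (vs_integral_dist mD (si n) (si m)))// !sg.
  rewrite (le_trans (integral_nrm_dist mu mD (mg n) mF (mg m)))//.
  have [f1 l1] := hN n Nn; have [f2 l2] := hN m Nm.
  rewrite (_ : e = e / 2 + e / 2); last by field.
  rewrite EFinD leeD//; last by rewrite -(fineK f2) lee_fin ltW.
  under eq_integral do rewrite nrmB.
  by rewrite -(fineK f1) lee_fin ltW.
exists v; split => //; exists s; split => //.
by under eq_fun do (under eq_integral do rewrite sg).
Qed.

End bochner_complete.

Section bochner_scalar.
Context {R : realType} d (T : measurableType d) (E : completeNormedModType R[i]).
Variables (mu : {measure set T -> \bar R}) (D : set T).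
Hypothesis mD : measurable D.
Implicit Types (g : T -> R) (v : E).

(* The property to be proved, strengthened with integrability so that it is
   closed under linear combinations. *)
Let P v g := mu.-integrable D (EFin \o g) /\
  has_bochner_integral mu D (fun x => (g x)%:C *: v)
    ((\int[mu]_(x in D) g x)%:C *: v).

Let P0 v : P v (fun=> 0).
Proof.
split; first exact: integrable0.
rewrite Rintegral_cst// mul0r.
have := @has_bochner_cst0 _ _ T E mu D; rewrite scale0r.
by congr has_bochner_integral; apply/funext => x; rewrite scale0r.
Qed.

Let PD v g h : P v g -> P v h -> P v (fun x => g x + h x).
Proof.
move=> [ig bg] [ih bh]; split; first exact: (integrableD mD ig ih).
rewrite RintegralD// rmorphD scalerDl.
have := has_bochnerD mD bg bh.
by congr has_bochner_integral; apply/funext => x /=; rewrite rmorphD scalerDl.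
Qed.

Let PZ v a g : P v g -> P v (fun x => a * g x).
Proof.
move=> [ig bg]; split; first exact: (integrableZl mD a ig).
rewrite RintegralZl// rmorphM -scalerA.
have := has_bochnerZ mD (a%:C) bg.
by congr has_bochner_integral; apply/funext => x /=; rewrite rmorphM scalerA.
Qed.

Let P_indic v (A : set T) : measurable A -> (mu (D `&` A) < +oo)%E -> P v (\1_A).
Proof.
move=> mA fA; split.
  apply/integrableP; split; first exact/measurable_EFinP.
  under eq_integral do rewrite /= ger0_norm//.
  by rewrite integral_indic// setIC.
have := @strongly_measurable_vs_fun R d T E D.
pose s : vsimple T E := @VSimple _ _ _ _ 1 (fun=> A) (fun=> v) (fun=> mA).
have sE x : vs_fun s x = (\1_A x)%:C *: v by rewrite /vs_fun big_ord1.
move=> /(_ s) ms; split.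
  by move: ms; congr strongly_measurable; apply/funext => x.
exists (fun=> s); split => [_ i //||].
- rewrite integral0_eq; first exact: cvg_cst.
  by move=> x _; rewrite sE subrr nrm0.
- rewrite (_ : vs_integral mu D s = (\int[mu]_(x in D) \1_A x)%:C *: v).
    exact: cvg_cst.
  by rewrite /vs_integral big_ord1 /Rintegral integral_indic// setIC.
Qed.

Let P_sum v (h : T -> R) (k : seq R) : (forall y, measurable (h @^-1` [set y])) ->
  (forall y, y \in k -> y != 0 -> (mu (D `&` h @^-1` [set y]) < +oo)%E) ->
  P v (fun x => \sum_(y <- k) y * \1_(h @^-1` [set y]) x).
Proof.
move=> mh; elim: k => [_|y k IH fy].
  by have := P0 v; congr P; apply/funext => x; rewrite big_nil.
rewrite (_ : (fun _ => _) = fun x => y * \1_(h @^-1` [set y]) x +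
    \sum_(y <- k) y * \1_(h @^-1` [set y]) x); last first.
  by apply/funext => x; rewrite big_cons.
apply: PD; last by apply: IH => z zk; apply: fy; rewrite inE zk orbT.
have [->|y0] := eqVneq y 0.
  by have := P0 v; congr P; apply/funext => x; rewrite mul0r.
by apply: PZ; apply: P_indic => //; apply: fy => //; rewrite inE eqxx.
Qed.

(** The scalar and the vector integrals agree on simple functions, and both are
    continuous for convergence in the mean. *)
Lemma has_bochner_scale g v : mu.-integrable D (EFin \o g) ->
  has_bochner_integral mu D (fun x => (g x)%:C *: v)
    ((\int[mu]_(x in D) g x)%:C *: v).
Proof.
move=> ig; have [s [is_ sg sI]] := approximation_sfun_integrable mD ig.
have Ps n : P v (s n).
  have -> : (s n : T -> R) = fun x => \sum_(y <- fset_set (range (s n)))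
      y * \1_((s n) @^-1` [set y]) x.
    apply/funext => x; rewrite fimfunEord (big_nth 0) big_mkord.
    by apply: eq_bigr.
  apply: P_sum => [y|y _ y0]; first exact: measurable_sfunP.
  have : mu.-integrable D (EFin \o (fun x => \1_(s n @^-1` [set y]) x : R)).
    apply: (le_integrable mD _ _ (integrableZl mD (y^-1) (is_ n))).
      by apply/measurable_EFinP; apply: measurable_indic; exact: measurable_sfunP.
    move=> x Dx /=; rewrite lee_fin indicE.
    case: (boolP (x \in s n @^-1` [set y])) => [/set_mem /= ->|_] /=.
      by rewrite mulVf.
    by rewrite normr0.
  move=> /integrableP[_]; under eq_integral do rewrite /= ger0_norm//.
  by rewrite integral_indic// setIC.
have mg : strongly_measurable D (fun x => (g x)%:C *: v).
  apply: strongly_measurableZfun => //; last exact: strongly_measurable_cst.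
  by have /integrableP[/measurable_EFinP] := ig.
have [w hw] : bochner_integrable mu D (fun x => (g x)%:C *: v).
  apply: bochner_exists => //.
  rewrite (eq_integral (fun x => (nrm v)%:E * `|(g x)%:E|)%E); last first.
    by move=> x _; rewrite nrmZr mulrC EFinM.
  have /integrableP[mg' fg] := ig.
  rewrite ge0_integralZl//; last 2 first.
  - exact: measurableT_comp.
  - by rewrite lee_fin nrm_ge0.
  by rewrite lte_mul_pinfty// lee_fin nrm_ge0.
suff -> : (\int[mu]_(x in D) g x)%:C *: v = w by [].
apply/eqP; rewrite -subr_eq0 -nrm_eq0 eq_le nrm_ge0 andbT.
apply/ler_addgt0Pr => e e0; rewrite add0r.
pose c := 2 * nrm v + 1.
have c0 : 0 < c by rewrite ltr_wpDl// mulr_ge0// nrm_ge0.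
have ec0 : 0 < e / c by rewrite divr_gt0.
have /fine_cvgP[fu /(cvgr_lt (0 : R)) /(_ _ ec0) lu] := sI.
have [n [fn]] := filter_ex (filterI fu lu); rewrite /= => ln.
have dE : (\int[mu]_(x in D) `|(g x)%:E - (s n x)%:E| =
    (fine (\int[mu]_(x in D) `|(g x)%:E - (s n x)%:E|))%:E)%E by rewrite fineK.
set I := fine _ in ln dE.
have h1 : `|\int[mu]_(x in D) g x - \int[mu]_(x in D) s n x| <= I.
  rewrite -RintegralB//.
  apply: (le_trans (le_normr_Rintegral mD _)); last by [].
  exact: (integrableB mD ig (is_ n)).
have h2 : nrm ((\int[mu]_(x in D) s n x)%:C *: v - w) <= nrm v * I.
  rewrite -lee_fin (le_trans (has_bochner_dist mD (Ps n).2 hw))//.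
  rewrite (eq_integral (fun x => (nrm v)%:E * `|(g x)%:E - (s n x)%:E|)%E); last first.
    by move=> x _; rewrite -scalerBl -rmorphB nrmZr mulrC EFinM distrC.
  rewrite ge0_integralZl//; last 2 first.
  - apply: measurableT_comp => //; apply: emeasurable_funB.
      by have /integrableP[] := ig.
    by have /integrableP[] := is_ n.
  - by rewrite lee_fin nrm_ge0.
  by rewrite dE.
rewrite (le_trans (ler_nrm_dist _ _ ((\int[mu]_(x in D) s n x)%:C *: v)))//.
rewrite -scalerBl -rmorphB nrmZr.
have h3 : `|\int[mu]_(x in D) g x - \int[mu]_(x in D) s n x| * nrm v <= I * nrm v.
  by rewrite ler_wpM2r// nrm_ge0.
have : I * c <= e by rewrite -ler_pdivlMr// ltW.
have I0 : 0 <= I by exact: le_trans h1.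
have h4 : I * nrm v + nrm v * I <= I * c.
  by rewrite [nrm v * I]mulrC -mulr2n -mulr_natl mulrCA /c mulrDr lerDl mulr1.
by move=> Ic; apply: le_trans (le_trans h4 Ic); exact: lerD.
Qed.

End bochner_scalar.

(** * Approximation by cosines with frequencies in an interval *)

Section trigonometric_bounds.
Context {R : realType}.
Implicit Types (f df : R -> R) (x y : R).

(** The mean value theorem without a hypothesis on the order of [x] and [y]. *)
Lemma MVT_exists f df x y : (forall z : R, is_derive z 1 f (df z)) ->
  exists2 c, `|c - x| <= `|y - x| & f y - f x = df c * (y - x).
Proof.
move=> fdf.
have cf a b : {within `[a, b], continuous f}.
  by apply: derivable_within_continuous => z _; exact: ex_derive.
have [xy|/ltW yx] := leP x y.
  have [c] := MVT_segment xy (fun z _ => fdf z) (cf _ _).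
  rewrite in_itv /= => /andP[xc cy] e; exists c => //.
  by rewrite !ger0_norm ?subr_ge0// lerD2r.
have [c] := MVT_segment yx (fun z _ => fdf z) (cf _ _).
rewrite in_itv /= => /andP[yc cx] e; exists c.
  by rewrite !ler0_norm ?subr_le0// lerN2 lerD2r.
by rewrite -opprB e -mulrN opprB.
Qed.

Lemma dist_sin_le x y : `|sin y - sin x| <= `|y - x|.
Proof.
have [c _ ->] := @MVT_exists sin cos x y (fun z => is_derive_sin z).
by rewrite normrM ler_piMl// ler_norml cos_geN1 cos_le1.
Qed.

Lemma dist_cos_le x y : `|cos y - cos x| <= `|y - x|.
Proof.
have [c _ ->] := @MVT_exists cos (fun z => - sin z) x y (fun z => is_derive_cos z).
by rewrite normrM normrN ler_piMl// ler_norml sin_geN1 sin_le1.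
Qed.

Lemma sin_taylor1 x y : `|sin y - sin x - cos x * (y - x)| <= `|y - x| ^+ 2.
Proof.
have [c cx ->] := @MVT_exists sin cos x y (fun z => is_derive_sin z).
rewrite -mulrBl normrM expr2 ler_wpM2r//.
exact: le_trans (dist_cos_le _ _) cx.
Qed.

Lemma cos_taylor1 x y : `|cos y - cos x + sin x * (y - x)| <= `|y - x| ^+ 2.
Proof.
have [c cx ->] := @MVT_exists cos (fun z => - sin z) x y (fun z => is_derive_cos z).
rewrite -mulrDl addrC normrM expr2 ler_wpM2r// distrC.
exact: le_trans (dist_sin_le _ _) cx.
Qed.

End trigonometric_bounds.

Section cosine_approximation.
Context {R : realType} (E : normedModType R[i]).
Implicit Types (F G : R -> E) (v : E).

Definition cos_approx (a b : R) F := forall L e : R, 0 < e ->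
  exists2 s : seq (R * E), (forall p, p \in s -> a < p.1 < b) &
    forall t, `|t| <= L ->
      nrm (F t - \sum_(p <- s) (cos (p.1 * t))%:C *: p.2) <= e.

Variables (a b : R).
Local Notation CA := (cos_approx a b).

Lemma cos_approx0 : CA (fun=> 0).
Proof.
move=> L e e0; exists [::] => // t _.
by rewrite big_nil subr0 nrm0 ltW.
Qed.

Lemma cos_approxD F G : CA F -> CA G -> CA (fun t => F t + G t).
Proof.
move=> hF hG L e e0; have e2 : 0 < e / 2 by rewrite divr_gt0.
have [s sl sF] := hF L _ e2; have [u ul uG] := hG L _ e2.
exists (s ++ u) => [p|t tL].
  by rewrite mem_cat => /orP[/sl|/ul].
rewrite big_cat /= opprD addrACA (le_trans (ler_nrmD _ _))//.
by rewrite [leRHS](splitr e) lerD ?sF ?uG.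
Qed.

Lemma cos_approxZ (c : R[i]) F : CA F -> CA (fun t => c *: F t).
Proof.
move=> hF L e e0; have c0 : 0 < nrm c + 1 by rewrite ltr_wpDl// nrm_ge0.
have [s sl sF] := hF L _ (divr_gt0 e0 c0).
exists [seq (p.1, c *: p.2) | p <- s] => [p|t tL].
  by move=> /mapP[q /sl qs ->].
rewrite big_map /=; under eq_bigr do rewrite scalerA mulrC -scalerA.
rewrite -scaler_sumr -scalerBr nrmZ.
have := sF t tL; rewrite ler_pdivlMr// mulrC; apply: le_trans.
by rewrite ler_wpM2r ?nrm_ge0// lerDl.
Qed.

Lemma cos_approx_sum (I : eqType) (r : seq I) (F : I -> R -> E) :
  (forall i, i \in r -> CA (F i)) -> CA (fun t => \sum_(i <- r) F i t).
Proof.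
elim: r => [_|i r IH h].
  rewrite (_ : (fun _ => _) = fun=> 0); first exact: cos_approx0.
  by apply/funext => t; rewrite big_nil.
rewrite (_ : (fun _ => _) = fun t => F i t + \sum_(i <- r) F i t).
  apply: cos_approxD; first by apply: h; rewrite inE eqxx.
  by apply: IH => j jr; apply: h; rewrite inE jr orbT.
by apply/funext => t; rewrite big_cons.
Qed.

Lemma cos_approx_lim F :
  (forall L e : R, 0 < e -> exists2 G, CA G &
    forall t, `|t| <= L -> nrm (F t - G t) <= e) -> CA F.
Proof.
move=> h L e e0; have e2 : 0 < e / 2 by rewrite divr_gt0.
have [G cG FG] := h L _ e2; have [s sl sG] := cG L _ e2.
exists s => // t tL; rewrite (le_trans (ler_nrm_dist _ _ (G t)))//.
by rewrite [leRHS](splitr e) lerD ?FG ?sG.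
Qed.

(** Up to sign, the [n]-th derivative of the cosine. *)
Definition cos_sin (n : nat) : R -> R := if odd n then sin else cos.

Lemma cos_sin_taylor1 n x y :
  `|cos_sin n y - cos_sin n x - (-1) ^+ n.+1 * cos_sin n.+1 x * (y - x)| <=
  `|y - x| ^+ 2.
Proof.
rewrite /cos_sin -signr_odd /=; case: (odd n) => /=.
  by rewrite expr0 mul1r sin_taylor1.
by rewrite expr1 mulN1r mulNr opprK cos_taylor1.
Qed.

(** [t ^+ n * cos_sin n (c * t)] is, up to sign, the [n]-th derivative of
    [cos (c * t)] in the frequency [c]; each derivative is a locally uniform
    limit of difference quotients, whose frequencies stay in the interval. *)
Lemma cos_approx_monomial n c v : a < c < b ->
  CA (fun t => (t ^+ n * cos_sin n (c * t))%:C *: v).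
Proof.
elim: n c => [|n IH] c cab.
  move=> L e e0; exists [:: (c, v)] => [p|t _].
    by rewrite inE => /eqP ->.
  by rewrite big_seq1 /= expr0 mul1r subrr nrm0 ltW.
apply: cos_approx_lim => L e e0.
have /andP[ac cb] := cab.
pose q := `|L| ^+ n.+2 * nrm v + 1.
have q0 : 0 < q by rewrite ltr_wpDl// mulr_ge0 ?exprn_ge0 ?nrm_ge0.
(* the step keeps [c + h] below [b] and the Taylor remainder below [e] *)
pose h := Num.min ((b - c) / 2) (e / q).
have h0 : 0 < h by rewrite lt_min !divr_gt0// subr_gt0.
have hb : h <= (b - c) / 2 by rewrite ge_min lexx.
have he : h * q <= e by rewrite -ler_pdivlMr// ge_min lexx orbT.
have chab : a < c + h < b by apply/andP; split; lra.
pose k := (-1) ^+ n.+1 / h.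
exists (fun t => k%:C *: ((t ^+ n * cos_sin n ((c + h) * t))%:C *: v) +
                 (- k)%:C *: ((t ^+ n * cos_sin n (c * t))%:C *: v)).
  by apply: cos_approxD; apply: cos_approxZ; exact: IH.
move=> t tL; rewrite !scalerA -!rmorphM -scalerDl -rmorphD -scalerBl -rmorphB.
rewrite nrmZr.
set A := cos_sin n _; set B := cos_sin n _; set D := cos_sin n.+1 _.
have := cos_sin_taylor1 n (c * t) ((c + h) * t).
rewrite -/A -/B -/D (_ : (c + h) * t - c * t = h * t); last by ring.
move=> hT.
have s2 : ((-1) ^+ n.+1 : R) * (-1) ^+ n.+1 = 1 by rewrite -expr2 sqrr_sign.
rewrite (_ : _ - _ = - (k * t ^+ n * (A - B - (-1) ^+ n.+1 * D * (h * t)))); last first.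
  rewrite /k exprS; move: s2; set sg := (-1) ^+ n.+1 => s2.
  have e1 : sg / h * t ^+ n * (sg * D * (h * t)) = t * t ^+ n * D.
    rewrite -[RHS]mul1r -s2; field; exact: lt0r_neq0.
  by rewrite mulrBr e1; ring.
have nk : `|k| = h^-1 by rewrite normrM normrX normrN1 expr1n mul1r gtr0_norm ?invr_gt0.
rewrite normrN normrM normrM nk normrX.
apply: le_trans he; rewrite /q mulrDr mulr1 ler_wpDr ?(ltW h0)// [leRHS]mulrA.
rewrite ler_wpM2r ?nrm_ge0//.
apply: (@le_trans _ _ (h^-1 * `|t| ^+ n * (h * `|t|) ^+ 2)).
  rewrite ler_wpM2l ?mulr_ge0 ?invr_ge0 ?exprn_ge0 ?(ltW h0)//.
  by rewrite (le_trans hT)// normrM (gtr0_norm h0).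
rewrite (_ : h^-1 * `|t| ^+ n * (h * `|t|) ^+ 2 = h * `|t| ^+ n.+2).
  rewrite ler_wpM2l ?(ltW h0)// lerXn2r ?nnegrE//.
  by rewrite (le_trans tL)// ler_norm.
by rewrite !exprS expr0; field; exact: lt0r_neq0.
Qed.

End cosine_approximation.

Section bernstein.
Context {R : realType}.

(** The Bernstein operators, in a recursive form that makes their moments
    computable by induction without binomial coefficients. *)
Fixpoint bernstein (V : lmodType R[i]) (n : nat) (f : nat -> V) (x : R) : V :=
  if n is n'.+1 then
    (1 - x)%:C *: bernstein n' f x + x%:C *: bernstein n' (f \o S) x
  else f 0%N.

(** The scalar operators are kept apart: they dominate the norms of the vector
    ones, and are compared by their monotonicity. *)
Fixpoint rbernstein (n : nat) (f : nat -> R) (x : R) : R :=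
  if n is n'.+1 then
    (1 - x) * rbernstein n' f x + x * rbernstein n' (f \o S) x
  else f 0%N.

Lemma bernstein_subcst (V : lmodType R[i]) n (f : nat -> V) v x :
  bernstein n (fun k => f k - v) x = bernstein n f x - v.
Proof.
elim: n f => [//|n IH] f /=.
rewrite IH (IH (f \o S)) !scalerBr addrACA -opprD -scalerDl -rmorphD.
by rewrite subrK scale1r.
Qed.

Lemma nrm_bernstein_le (V : normedModType R[i]) n (f : nat -> V) x : 0 <= x <= 1 ->
  nrm (bernstein n f x) <= rbernstein n (fun k => nrm (f k)) x.
Proof.
move=> /andP[x0 x1]; elim: n f => [//|n IH] f /=.
rewrite (le_trans (ler_nrmD _ _))// !nrmZr !ger0_norm ?subr_ge0//.
by rewrite lerD// ler_wpM2l ?subr_ge0//; exact: (IH (f \o S)).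
Qed.

Lemma le_rbernstein n (f g : nat -> R) x : 0 <= x <= 1 ->
  (forall k, (k <= n)%N -> f k <= g k) -> rbernstein n f x <= rbernstein n g x.
Proof.
move=> /andP[x0 x1]; elim: n f g => [|n IH] f g fg /=; first exact: fg.
rewrite lerD// ler_wpM2l ?subr_ge0//; apply: IH => k kn; apply: fg => //.
exact: leqW.
Qed.

(** The first two moments of the binomial distribution. *)
Lemma rbernstein_quadratic n (al be c x : R) :
  rbernstein n (fun k => al + be * (k%:R - c) ^+ 2) x =
  al + be * ((n%:R * x - c) ^+ 2 + n%:R * x * (1 - x)).
Proof.
elim: n c => [|n IH] c /=; first by ring.
rewrite IH (_ : _ \o S = fun k => al + be * (k%:R - (c - 1)) ^+ 2).
  by rewrite IH -(natr1 n); ring.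
by apply/funext => k /=; rewrite -(natr1 k); congr (_ + _ * _ ^+ 2); ring.
Qed.

End bernstein.

Section weierstrass.
Context {R : realType} (E : normedModType R[i]).
Implicit Types (F G P : R -> E).

(** Polynomials with coefficients in [E]. *)
Definition vpoly P := exists s : seq (nat * E),
  forall t, P t = \sum_(p <- s) (t ^+ p.1)%:C *: p.2.

Lemma vpoly_cst v : vpoly (fun=> v).
Proof.
by exists [:: (0%N, v)] => t; rewrite big_seq1 /= expr0 scale1r.
Qed.

Lemma vpolyD P Q : vpoly P -> vpoly Q -> vpoly (fun t => P t + Q t).
Proof.
by move=> [s sP] [u uQ]; exists (s ++ u) => t; rewrite big_cat sP uQ.
Qed.

Lemma vpoly_affine al be P : vpoly P -> vpoly (fun t => (al * t + be)%:C *: P t).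
Proof.
move=> [s sP].
exists ([seq (p.1.+1, al%:C *: p.2) | p <- s] ++ [seq (p.1, be%:C *: p.2) | p <- s]) => t.
rewrite big_cat !big_map /= rmorphD scalerDl sP !scaler_sumr.
congr (_ + _); apply: eq_bigr => p _; rewrite !scalerA -!rmorphM; congr (_%:C *: _).
  by rewrite exprS; ring.
by rewrite mulrC.
Qed.

Lemma vpoly_bernstein n (f : nat -> E) al be :
  vpoly (fun t => bernstein n f (al * t + be)).
Proof.
elim: n f => [|n IH] f /=; first exact: vpoly_cst.
apply: vpolyD; last exact: vpoly_affine.
have := vpoly_affine (- al) (1 - be) (IH f).
by congr vpoly; apply/funext => t; congr (_%:C *: _); ring.
Qed.

Lemma continuous_nrm F : continuous F -> continuous (fun t => nrm (F t)).
Proof.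
move=> cF t; have /cvg_nrmP h := cF t; apply/cvgrPdist_lt => e e0.
by apply: filterS (h _ e0) => x; exact/le_lt_trans/ler_nrm_dist_nrm.
Qed.

Lemma heine F (L e : R) : continuous F -> 0 < e -> exists2 d, 0 < d &
  forall s t, `|s| <= L -> `|s - t| < d -> nrm (F s - F t) < e.
Proof.
move=> cF e0.
have /compact_near_coveringP K := @segment_compact R (- L) L.
have hK : \forall d \near (0 : R)^'+, `[(- L), L]%classic `<=`
    (fun s => forall t, `|s - t| < d -> nrm (F s - F t) < e).
  apply: K => s _.
  have e2 : 0 < e / 2 by rewrite divr_gt0.
  have /cvg_nrmP /(_ _ e2) /nbhs_ballP[r /= r0 hr] := cF s.
  exists (ball s (r / 2), [set d | 0 < d < r / 2]) => /=.
    split; first by apply: nbhsx_ballx; rewrite divr_gt0.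
    apply: filterS2 (nbhs_right_gt (0 : R)) (nbhs_right_lt (_ : 0 < r / 2)).
      by move=> y /= -> ->.
    by rewrite divr_gt0.
  move=> [x d] /= [sx /andP[d0 dr]] t xt.
  have sx' : `|s - x| < r / 2 by [].
  have Fx : nrm (F s - F x) < e / 2.
    by apply: hr; apply: lt_trans sx' _; rewrite ltr_pdivrMr// ltr_pMr// ltr1n.
  have Ft : nrm (F s - F t) < e / 2.
    apply: hr; rewrite /ball /= (le_lt_trans (ler_distD x _ _))//.
    by rewrite [ltRHS](splitr r) ltrD// (lt_trans xt).
  by rewrite (le_lt_trans (ler_nrm_dist _ _ (F s)))// [ltRHS](splitr e) nrmB ltrD.
have [d [d0 hd]] := filter_ex (filterI (nbhs_right_gt (0 : R)) hK).
exists d => // s t sL st; apply: (hd s) => //=.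
by rewrite in_itv /= -ler_norml.
Qed.

(** Bernstein's proof of the theorem of Weierstrass: uniform continuity bounds
    [F s - F t] by [e / 2 + K * (s - t) ^+ 2], and the Bernstein operator of
    degree [n] maps this quadratic function to at most [e / 2 + O(1 / n)]. *)
Lemma vpoly_dense F (L e : R) : continuous F -> 0 < L -> 0 < e ->
  exists2 P, vpoly P & forall t, `|t| <= L -> nrm (F t - P t) <= e.
Proof.
move=> cF L0 e0; have e2 : 0 < e / 2 by rewrite divr_gt0.
have [d d0 hd] := heine L cF e2.
have [M M0 hM] : exists2 M, 0 <= M & forall t, `|t| <= L -> nrm (F t) <= M.
  have LL : - L <= L by lra.
  have cn : {within `[- L, L], continuous (fun t => nrm (F t))}.
    by apply: continuous_subspaceT; exact: continuous_nrm.
  have [c _ hc] := EVT_max LL cn.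
  exists (nrm (F c)); first exact: nrm_ge0.
  by move=> t; rewrite ler_norml => tL; apply: hc; rewrite in_itv.
pose K := 2 * M / d ^+ 2.
have K0 : 0 <= K by apply: divr_ge0; [exact: mulr_ge0|exact: sqr_ge0].
have quad s t : `|s| <= L -> `|t| <= L -> nrm (F s - F t) <= e / 2 + K * (s - t) ^+ 2.
  move=> sL tL; have [st|st] := ltP `|s - t| d.
    by rewrite (le_trans (ltW (hd _ _ sL st)))// lerDl mulr_ge0// sqr_ge0.
  rewrite (le_trans (ler_nrmD _ _))// nrmN (le_trans (lerD (hM _ sL) (hM _ tL)))//.
  rewrite ler_wpDl// ?(ltW e2)// -mulr2n -mulr_natl /K -mulrA ler_peMr ?mulr_ge0//.
  rewrite mulrC ler_pdivlMr ?exprn_gt0// mul1r -(real_normK (num_real (s - t))).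
  by rewrite lerXn2r// nnegrE ltW.
pose n := (Num.truncn (K * (2 * L) ^+ 2 / (e / 2))).+1.
have n0 : 0 < n%:R :> R by rewrite ltr0n.
have hn : K * (2 * L) ^+ 2 / n%:R <= e / 2.
  by rewrite ler_pdivrMr// -ler_pdivrMl// mulrC ltW// truncnS_gt.
(* the affine change of variable from [[-L, L]] to [[0, 1]] *)
exists (fun t => bernstein n (fun k => F (2 * L * (k%:R / n%:R) - L))
                   ((2 * L)^-1 * t + 2^-1)).
  exact: vpoly_bernstein.
move=> t tL; set x := _ + 2^-1.
have L2 : 0 < 2 * L by rewrite mulr_gt0.
have tx : t = 2 * L * x - L by rewrite /x; field; exact: lt0r_neq0.
have /andP[tL1 tL2] : - L <= t <= L by rewrite -ler_norml.
have x01 : 0 <= x <= 1.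
  apply/andP; split.
    by rewrite -(@ler_pM2l _ (2 * L))// mulr0; lra.
  by rewrite -(@ler_pM2l _ (2 * L))// mulr1; lra.
rewrite nrmB -bernstein_subcst (le_trans (nrm_bernstein_le _ _ x01))//.
pose be := K * (2 * L / n%:R) ^+ 2.
apply: (@le_trans _ _ (rbernstein n (fun k => e / 2 + be * (k%:R - n%:R * x) ^+ 2) x)).
  apply: le_rbernstein => // k kn.
  have kn1 : 0 <= (k%:R / n%:R : R) <= 1.
    by rewrite divr_ge0//= ler_pdivrMr// mul1r ler_nat.
  have sL : `|2 * L * (k%:R / n%:R) - L| <= L.
    move: kn1 => /andP[k0 k1]; rewrite ler_norml; apply/andP; split.
      by rewrite lerBrDr addNr mulr_ge0// ltW.
    by move: k1; rewrite -(ler_pM2l L2) mulr1; lra.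
  apply: (le_trans (quad _ _ sL tL)); rewrite lerD2l /be.
  rewrite [leLHS](_ : _ = K * (2 * L / n%:R) ^+ 2 * (k%:R - n%:R * x) ^+ 2)//.
  by rewrite tx; field; exact: lt0r_neq0.
rewrite rbernstein_quadratic subrr expr0n add0r [leRHS](splitr e) lerD2l.
apply: le_trans hn; move: x01 => /andP[x0 x1].
rewrite (_ : be * _ = K * (2 * L) ^+ 2 / n%:R * (x * (1 - x))).
  apply: ler_piMr.
    by apply: divr_ge0; [apply: mulr_ge0 => //; exact: sqr_ge0|exact: ltW].
  by apply: mulr_ile1; rewrite ?subr_ge0 ?lerBlDr ?lerDl.
by rewrite /be; field; exact: lt0r_neq0.
Qed.

(** [F = (F cos) cos + (F sin) sin], and for even [F] the two brackets are
    uniform limits of even, resp. odd, polynomials; the resulting products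
    [t ^+ n * cos_sin n (c * t)] are approximated by [cos_approx_monomial]. *)
Theorem even_cos_approx a b F : a < b -> continuous F -> (forall t, F (- t) = F t) ->
  cos_approx a b F.
Proof.
move=> ab cF evF; apply: cos_approx_lim => L0 e e0.
pose L := `|L0| + 1; have L_gt0 : 0 < L by rewrite ltr_wpDl.
pose c := (a + b) / 2; have cab : a < c < b by rewrite /c; apply/andP; split; lra.
have e2 : 0 < e / 2 by rewrite divr_gt0.
have cmul (h : R -> R) : continuous h -> continuous (fun t => (h t)%:C *: F t).
  move=> ch t; apply: cvgZ; last exact: cF.
  have /cvgrPdist_lt hh := ch t.
  apply/cvgrPdist_lt => -[z z']; rewrite ltcE /= => /andP[/eqP -> z0].
  by apply: filterS (hh _ z0) => y; rewrite -rmorphB nrmE ltcR nrm_real.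
have cmc : continuous (fun t : R => c * t) by move=> t; apply: cvgZr; exact: cvg_id.
have [P [s Ps] hP] := vpoly_dense (cmul (fun t => cos (c * t))
  (fun t => continuous_comp (cmc t) (@continuous_cos _ _))) L_gt0 e2.
have [Q [u Qu] hQ] := vpoly_dense (cmul (fun t => sin (c * t))
  (fun t => continuous_comp (cmc t) (@continuous_sin _ _))) L_gt0 e2.
pose Pe t := \sum_(p <- s | ~~ odd p.1) (t ^+ p.1)%:C *: p.2.
pose Qo t := \sum_(p <- u | odd p.1) (t ^+ p.1)%:C *: p.2.
have half (v w : E) (sg : R[i]) : nrm sg = 1 -> nrm v <= e / 2 -> nrm w <= e / 2 ->
    nrm ((2^-1 : R)%:C *: (v + sg *: w)) <= e / 2.
  move=> n1 hv hw; rewrite nrmZr ger0_norm ?invr_ge0//.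
  rewrite ler_pdivrMl// (le_trans (ler_nrmD _ _))// nrmZ n1 mul1r.
  by rewrite mulr2n mulrDl mul1r lerD.
have halfE (v : E) : (2^-1 : R)%:C *: (v + v) = v.
  by rewrite -[v in v + v]scale1r -scalerDl scalerA -[1 + 1](rmorphD (real_complex R)) -rmorphM mulVf ?scale1r.
have hPe t : `|t| <= L -> nrm ((cos (c * t))%:C *: F t - Pe t) <= e / 2.
  move=> tL; have tL' : `|- t| <= L by rewrite normrN.
  have -> : (cos (c * t))%:C *: F t - Pe t = (2^-1 : R)%:C *:
      ((cos (c * t))%:C *: F t - P t + 1 *: ((cos (c * - t))%:C *: F (- t) - P (- t))).
    rewrite scale1r mulrN cosN evF addrACA scalerDr halfE; congr (_ + _).
    rewrite -opprD scalerN; congr (- _); rewrite !Ps -big_split scaler_sumr /Pe big_mkcond.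
    apply: eq_bigr => p _; rewrite exprNn /= -signr_odd.
    case: (odd p.1); rewrite /= ?expr1 ?expr0 ?mul1r ?halfE//.
    by rewrite mulN1r rmorphN scaleNr subrr scaler0.
  by apply: half; rewrite ?(nrm_real 1) ?normr1//; [exact: hP|exact: hP].
have hQo t : `|t| <= L -> nrm ((sin (c * t))%:C *: F t - Qo t) <= e / 2.
  move=> tL; have tL' : `|- t| <= L by rewrite normrN.
  have -> : (sin (c * t))%:C *: F t - Qo t = (2^-1 : R)%:C *:
      ((sin (c * t))%:C *: F t - Q t + -1 *: ((sin (c * - t))%:C *: F (- t) - Q (- t))).
    rewrite scaleN1r mulrN sinN evF rmorphN scaleNr opprD !opprK addrACA scalerDr halfE.
    congr (_ + _).
    rewrite -[- Q t + _]opprK opprD opprK scalerN; congr (- _).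
    rewrite !Qu -sumrB scaler_sumr /Qo big_mkcond.
    apply: eq_bigr => p _; rewrite exprNn /= -signr_odd.
    case: (odd p.1); rewrite /= ?expr1 ?expr0 ?mul1r ?subrr ?scaler0//.
    by rewrite mulN1r rmorphN scaleNr opprK halfE.
  by apply: half; rewrite ?nrmN ?(nrm_real 1) ?normr1//; [exact: hQ|exact: hQ].
exists (fun t => \sum_(p <- [seq p <- s | ~~ odd p.1])
          (t ^+ p.1 * cos_sin p.1 (c * t))%:C *: p.2 +
        \sum_(p <- [seq p <- u | odd p.1])
          (t ^+ p.1 * cos_sin p.1 (c * t))%:C *: p.2).
  by apply: cos_approxD; apply: cos_approx_sum => p _; exact: cos_approx_monomial.
move=> t tL0; have tL : `|t| <= L.
  by rewrite (le_trans tL0)// /L (le_trans (ler_norm _))// lerDl.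
have -> : F t = (cos (c * t))%:C *: ((cos (c * t))%:C *: F t) +
                (sin (c * t))%:C *: ((sin (c * t))%:C *: F t).
  by rewrite !scalerA -!rmorphM -scalerDl -rmorphD -!expr2 cos2Dsin2 scale1r.
rewrite !big_filter.
have -> : \sum_(p <- s | ~~ odd p.1) (t ^+ p.1 * cos_sin p.1 (c * t))%:C *: p.2 =
    (cos (c * t))%:C *: Pe t.
  rewrite /Pe scaler_sumr; apply: eq_bigr => p op.
  by rewrite /cos_sin (negbTE op) scalerA -rmorphM mulrC.
have -> : \sum_(p <- u | odd p.1) (t ^+ p.1 * cos_sin p.1 (c * t))%:C *: p.2 =
    (sin (c * t))%:C *: Qo t.
  rewrite /Qo scaler_sumr; apply: eq_bigr => p op.
  by rewrite /cos_sin op scalerA -rmorphM mulrC.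
rewrite opprD addrACA -!scalerBr (le_trans (ler_nrmD _ _))// !nrmZr [leRHS](splitr e).
apply: lerD.
  apply: le_trans (hPe t tL); rewrite ler_piMl ?nrm_ge0// ler_norml.
  by rewrite cos_geN1 cos_le1.
apply: le_trans (hQo t tL); rewrite ler_piMl ?nrm_ge0// ler_norml.
by rewrite sin_geN1 sin_le1.
Qed.

End weierstrass.

(** * Monotone functionals on nonnegative functions *)

Section functionals.
Context {R : realType} d (T : measurableType d).
Implicit Types (f g : T -> \bar R) (I J : (T -> \bar R) -> \bar R).
Local Open Scope ereal_scope.

Definition nnm f := measurable_fun setT f /\ forall x, 0 <= f x.

(** The properties of the map [f |-> \int f] on nonnegative functions that
    determine a measure. Identities between iterated integrals are proved below
    as equalities of such functionals. *)
Record mono_functional I : Prop := MonoFunctional {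
  mf_ge0 : forall f, nnm f -> 0 <= I f;
  mfD : forall f g, nnm f -> nnm g -> I (f \+ g) = I f + I g;
  mfZ : forall (c : R) f, nnm f -> (0 <= c)%R -> I (fun x => c%:E * f x) = c%:E * I f;
  mf_le : forall f g, nnm f -> nnm g -> (forall x, f x <= g x) -> I f <= I g;
  mf_cvg : forall (u : nat -> T -> \bar R) f, (forall n, nnm (u n)) -> nnm f ->
    (forall x n m, (n <= m)%N -> u n x <= u m x) ->
    (forall x, (fun n => u n x) @ \oo --> f x) ->
    (fun n => I (u n)) @ \oo --> I f }.

Lemma nnm_indic (A : set T) : measurable A -> nnm (fun x => (\1_A x)%:E).
Proof.
by move=> mA; split => [|x]; [exact/measurable_EFinP/measurable_indic|rewrite lee_fin].
Qed.

Lemma nnmD f g : nnm f -> nnm g -> nnm (f \+ g).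
Proof.
by move=> [mf f0] [mg g0]; split => [|x]; [exact: emeasurable_funD|exact: adde_ge0].
Qed.

Lemma nnmZ (c : R) f : (0 <= c)%R -> nnm f -> nnm (fun x => c%:E * f x).
Proof.
by move=> c0 [mf f0]; split => [|x]; [exact: measurable_funeM|exact: mule_ge0].
Qed.

Lemma nnmM f g : nnm f -> nnm g -> nnm (f \* g).
Proof.
by move=> [mf f0] [mg g0]; split => [|x]; [exact: emeasurable_funM|exact: mule_ge0].
Qed.

Lemma nnm_cst (c : \bar R) : 0 <= c -> nnm (fun=> c).
Proof. by move=> c0; split. Qed.

Lemma nnm_simple (h : {nnsfun T >-> R}) : nnm (fun x => (h x)%:E).
Proof.
by split => [|x]; [exact/measurable_EFinP|rewrite lee_fin].
Qed.

Lemma mono_functional_ext I J : mono_functional I -> mono_functional J ->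
  (forall A, measurable A -> I (fun x => (\1_A x)%:E) = J (fun x => (\1_A x)%:E)) ->
  forall f, nnm f -> I f = J f.
Proof.
move=> hI hJ IJ f [mf f0].
have z0 : nnm (fun=> 0%R%:E) by exact: nnm_cst.
have I0 K : mono_functional K -> K (fun=> 0%R%:E) = 0.
  by move=> hK; have := mfZ hK z0 (lexx 0%R); rewrite !mul0e.
have IJs (r : seq R) (h : {nnsfun T >-> R}) :
    nnm (fun x => (\sum_(y <- r) `|y| * \1_(h @^-1` [set y]) x)%:E) /\
    I (fun x => (\sum_(y <- r) `|y| * \1_(h @^-1` [set y]) x)%:E) =
    J (fun x => (\sum_(y <- r) `|y| * \1_(h @^-1` [set y]) x)%:E).
  elim: r => [|y r [n1 IH]].
    rewrite (_ : (fun _ => _) = fun=> 0%R%:E); first by rewrite !I0.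
    by apply/funext => x; rewrite big_nil.
  have my : measurable (h @^-1` [set y]) by exact: measurable_sfunP.
  have n2 := nnm_indic my.
  rewrite (_ : (fun _ => _) = (fun x => `|y|%:E * (\1_(h @^-1` [set y]) x)%:E) \+
     (fun x => (\sum_(y <- r) `|y| * \1_(h @^-1` [set y]) x)%:E)); last first.
    by apply/funext => x; rewrite big_cons EFinD EFinM.
  split; first by apply: nnmD => //; exact: nnmZ.
  rewrite (mfD hI)//; last exact: nnmZ.
  rewrite (mfD hJ)//; last exact: nnmZ.
  by rewrite (mfZ hI)// (mfZ hJ)// IJ// IH.
have IJn (h : {nnsfun T >-> R}) : I (fun x => (h x)%:E) = J (fun x => (h x)%:E).
  have -> : (fun x => (h x)%:E) = fun x => (\sum_(y <- fset_set (range h))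
      `|y| * \1_(h @^-1` [set y]) x)%:E.
    apply/funext => x; congr EFin; rewrite fimfunEord (big_nth 0%R) big_mkord.
    apply: eq_bigr => i _; set y := nth _ _ _.
    have : y \in fset_set (range h) by rewrite mem_nth.
    by rewrite in_fset_set// inE => -[t _ <-]; rewrite ger0_norm.
  exact: (IJs _ h).2.
pose u n x := (nnsfun_approx measurableT mf n x)%:E.
have un n : nnm (u n) by exact: nnm_simple.
have uI K : mono_functional K -> (fun n => K (u n)) @ \oo --> K f.
  move=> hK; apply: (mf_cvg hK) => //.
  - by move=> x n m nm; rewrite lee_fin; exact/lefP/nd_nnsfun_approx.
  - by move=> x; exact: cvg_nnsfun_approx.
apply: (@cvg_unique _ (@ereal_hausdorff R) ((fun n => I (u n)) @ \oo)).
  exact: uI.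
by rewrite (_ : (fun _ => _) = fun n => J (u n)); [exact: uI|apply/funext => n; exact: IJn].
Qed.

Lemma mono_functional_int (mu : {measure set T -> \bar R}) :
  mono_functional (fun f => \int[mu]_x f x).
Proof.
split.
- by move=> f [mf f0]; exact: integral_ge0.
- by move=> f g [mf f0] [mg g0]; rewrite ge0_integralD.
- by move=> c f [mf f0] c0; rewrite ge0_integralZl.
- by move=> f g [mf f0] [mg g0] fg; exact: ge0_le_integral.
- move=> u f un [mf f0] uh uf.
  rewrite (eq_integral (fun x => limn (fun n => u n x))); last first.
    by move=> x _; apply/esym/cvg_lim => //; exact: uf.
  apply: cvg_monotone_convergence => //.
  + by move=> n; case: (un n).
  + by move=> n x _; case: (un n).
  + by move=> x _ n m; exact: uh.
Qed.

End functionals.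

Section functionals2.
Context {R : realType} d (T : measurableType d) d' (S : measurableType d').
Local Open Scope ereal_scope.

(** By monotone convergence, applied twice. The weight may be infinite. *)
Lemma mono_functional_weight (mu : {measure set S -> \bar R}) (w : S -> \bar R)
    (K : S -> (T -> \bar R) -> \bar R) :
  nnm w -> (forall s, mono_functional (K s)) ->
  (forall f, nnm f -> measurable_fun setT (fun s => K s f)) ->
  mono_functional (fun f => \int[mu]_s (w s * K s f)).
Proof.
move=> hw hK mK.
have nn f : nnm f -> nnm (fun s => w s * K s f).
  move=> nf; apply: (nnmM hw); split; first exact: mK.
  by move=> s; exact: mf_ge0.
have hI := mono_functional_int mu; split.
- by move=> f nf; exact: (mf_ge0 hI (nn _ nf)).
- move=> f g nf ng; rewrite -(mfD hI (nn _ nf) (nn _ ng)).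
  apply: eq_integral => s _ /=; rewrite (mfD (hK s))//.
  by rewrite ge0_muleDr// (mf_ge0 (hK s)).
- move=> c f nf c0; rewrite -(mfZ hI (nn _ nf) c0).
  by apply: eq_integral => s _ /=; rewrite (mfZ (hK s))// muleCA.
- move=> f g nf ng fg; apply: (mf_le hI (nn _ nf) (nn _ ng)) => s.
  by apply: lee_wpmul2l; [exact: (hw.2 s)|exact: (mf_le (hK s))].
- move=> u f un nf uh uf.
  apply: (mf_cvg hI (fun n => nn _ (un n)) (nn _ nf)) => s.
    move=> n m nm; apply: lee_wpmul2l; first exact: (hw.2 s).
    by apply: (mf_le (hK s)) => // x; exact: uh.
  have Kc := mf_cvg (hK s) un nf uh uf.
  have uf0 := mf_ge0 (hK s) nf; have un0 n := mf_ge0 (hK s) (un n).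
  have [winf|wfin] := eqVneq (w s) +oo; last first.
    by apply: cvgeZl => //; rewrite ge0_fin_numE ?(hw.2 s)// lt_neqAle wfin leey.
  (* an infinite weight makes the products stationary *)
  have [[n0 un0p]|all0] := pselect (exists n, 0 < K s (u n)).
    have le_uf n : K s (u n) <= K s f.
      apply: (mf_le (hK s)) => // x; apply: (cvge_ge _ (uf x)).
      by exists n => // k /= nk; exact: uh.
    rewrite winf gt0_mulye; last exact: lt_le_trans (le_uf n0).
    apply: cvg_near_cst; exists n0 => // n /= n0n; rewrite gt0_mulye//.
    apply: (lt_le_trans un0p); apply: (mf_le (hK s)) => // x; exact: uh.
  have u0 n : K s (u n) = 0.
    apply/eqP; rewrite eq_le un0 andbT leNgt; apply/negP => p.
    by apply: all0; exists n.
  have <- : 0 = K s f.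
    apply: (@cvg_unique _ (@ereal_hausdorff R) ((fun n => K s (u n)) @ \oo)) => //.
    by rewrite (_ : (fun n => K s (u n)) = fun=> 0); [exact: cvg_cst|exact/funext].
  rewrite mule0 (_ : (fun n => w s * K s (u n)) = fun=> 0); first exact: cvg_cst.
  by apply/funext => n; rewrite u0 mule0.
Qed.

End functionals2.

Lemma indic_disjU {R : realType} T (A B : set T) : A `&` B = set0 ->
  \1_(A `|` B) = (fun x => \1_A x + \1_B x) :> (T -> R).
Proof.
move=> AB; apply/funext => x; rewrite !indicE in_setU.
have [xA|xA] := boolP (x \in A); have [xB|xB] := boolP (x \in B);
  rewrite ?addr0 ?add0r//=.
have ABx : (A `&` B) x by split; exact: set_mem.
by rewrite AB in ABx.
Qed.

Section functional_measure.
Context {R : realType} d (T : measurableType d).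
Variables (I : (T -> \bar R) -> \bar R) (hI : mono_functional I).
Local Open Scope ereal_scope.

(** Nothing is known of [I] on the indicator of a nonmeasurable set, whereas a
    measure has to be nonnegative on all sets. *)
Definition mf_measure of mono_functional I := fun A : set T =>
  if `[< measurable A >] then I (fun x => (\1_A x)%:E) else 0.

Local Notation mu := (mf_measure hI).

Lemma mf_measureE A : measurable A -> mu A = I (fun x => (\1_A x)%:E).
Proof. by move=> mA; rewrite /mf_measure asboolT. Qed.

Lemma mono_functional0 : I (fun=> 0) = 0.
Proof.
have z0 : nnm (fun _ : T => 0%R%:E : \bar R) by exact: nnm_cst.
by have := mfZ hI z0 (lexx 0%R); rewrite !mul0e.
Qed.

Let mu0 : mu set0 = 0.
Proof.
rewrite mf_measureE// -[RHS]mono_functional0; congr I.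
by apply/funext => x; rewrite indic0.
Qed.

Let mu_ge0 A : 0 <= mu A.
Proof.
rewrite /mf_measure; case: asboolP => // mA.
exact: (mf_ge0 hI (nnm_indic mA)).
Qed.

Let mu_sigma_additive : semi_sigma_additive mu.
Proof.
move=> F mF tF mU.
have mS n : measurable (\big[setU/set0]_(i < n) F i) by exact: bigsetU_measurable.
rewrite (_ : (fun _ => _) = fun n => I (fun x => (\1_(\big[setU/set0]_(i < n) F i) x)%:E)).
  rewrite mf_measureE//; apply: (mf_cvg hI).
  - by move=> n; exact: nnm_indic.
  - exact: nnm_indic.
  - move=> x n m nm; rewrite lee_fin; rewrite !indicE ler_nat.
    have [/set_mem xA|//] := boolP (x \in \big[setU/set0]_(i < n) F i).
    by rewrite mem_set//; move: xA; exact: subset_bigsetU.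
  - move=> x; have [[k _ Fkx]|nx] := pselect ((\bigcup_n F n) x).
      apply: cvg_near_cst; exists k.+1 => // n /= kn.
      rewrite !indicE !mem_set//; first by exists k.
      by rewrite -bigcup_mkord; exists k.
    apply: cvg_near_cst; apply: nearW => n.
    rewrite !indicE !memNset// -bigcup_mkord => -[k _ Fkx].
    by apply: nx; exists k.
apply/funext; elim=> [|n IH].
  rewrite big_geq// -[LHS]mono_functional0; congr I; apply/funext => x.
  by rewrite big_ord0 indic0.
rewrite big_nat_recr//= IH mf_measureE//.
rewrite -(mfD hI (nnm_indic (mS n)) (nnm_indic (mF n))); congr I.
apply/funext => x /=; rewrite big_ord_recr /= -EFinD; congr EFin.
rewrite indic_disjU// -subset0 => y [].
rewrite -bigcup_mkord => -[k /= kn Fky] Fny.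
by have := tF k n Logic.I Logic.I (ex_intro _ y (conj Fky Fny)) => kn'; move: kn; rewrite kn' ltnn.
Qed.

HB.instance Definition _ := isMeasure.Build _ _ _ mu mu0 mu_ge0 mu_sigma_additive.

End functional_measure.

Section sigma_finite_copy.
Context d (T : measurableType d) (R : realType).

(** An alias of [m], able to carry a canonical structure that depends on the
    proof of sigma-finiteness. *)
Definition sigma_finite_copy (m : {measure set T -> \bar R}) of sigma_finite setT m :
  set T -> \bar R := m.

HB.instance Definition _ (m : {measure set T -> \bar R}) (h : sigma_finite setT m) :=
  Measure.copy (sigma_finite_copy h) m.

HB.instance Definition _ (m : {measure set T -> \bar R}) (h : sigma_finite setT m) :=
  @Measure_isSigmaFinite.Build _ _ _ (sigma_finite_copy h) h.

(** A statement on a sigma-finite measure may be proved as if sigma-finiteness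
    were part of its structure, the form in which Fubini's theorem needs it. *)
Lemma sigma_finite_ind (P : {measure set T -> \bar R} -> Prop) :
  (forall m : {sigma_finite_measure set T -> \bar R}, P m) ->
  forall m : {measure set T -> \bar R}, sigma_finite setT m -> P m.
Proof.
move=> h m sm.
suff <- : ((sigma_finite_copy sm : {sigma_finite_measure set T -> \bar R})
  : {measure set T -> \bar R}) = m by exact: h.
exact: eq_measure.
Qed.

End sigma_finite_copy.

(** * The half-line and its Borel sets *)

Section halfline_topology.
Context {R : realType}.
Notation X := ('X_R).
Notation bX := (borel X).

Lemma val_ge0 (x : X) : 0 <= \val x.
Proof. by have := valP x; rewrite inE /halfline /= in_itv /= andbT. Qed.

Lemma proj_mem (t : R) : Num.max t 0 \in halfline R.
Proof. by rewrite inE /halfline /= in_itv /= andbT le_max lexx orbT. Qed.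

(** Composing with this retraction turns functions on the half-line into
    functions on the line, to which the theorems on intervals apply. *)
Definition proj (t : R) : X := exist _ (Num.max t 0) (proj_mem t).

Lemma val_proj t : 0 <= t -> \val (proj t) = t.
Proof. by move=> t0; rewrite /= max_l. Qed.

Lemma projK (x : X) : proj (\val x) = x.
Proof. by apply: val_inj; rewrite val_proj// val_ge0. Qed.

Lemma continuous_val : continuous (fun x : X => \val x : R).
Proof. exact: (@initial_continuous X R (@set_val R (halfline R))). Qed.

Lemma continuous_proj : continuous proj.
Proof.
apply: (@continuous_comp_initial X R R (@set_val R (halfline R)) proj) => t.
have : {for t, continuous ((fun t : R => t : R^o) \max (fun=> 0 : R^o))}.
  by apply: continuous_max; [exact: cvg_id|exact: cvg_cst].
exact.
Qed.

Lemma open_val_gt a : open [set x : X | a < \val x].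
Proof. exact: (proj1 (continuousP _) continuous_val _ (@open_gt R a)). Qed.

Lemma open_val_lt a : open [set x : X | \val x < a].
Proof. exact: (proj1 (continuousP _) continuous_val _ (@open_lt R a)). Qed.

Definition oo_set (a b : R) : set X := [set x | a < \val x < b].

Lemma oo_setE a b : oo_set a b = [set x | a < \val x] `&` [set x | \val x < b].
Proof. by apply/seteqP; split => x; rewrite /oo_set /=; [move=> /andP|move=> [-> ->]]. Qed.

Lemma open_oo_set a b : open (oo_set a b).
Proof. by rewrite oo_setE; apply: openI; [exact: open_val_gt|exact: open_val_lt]. Qed.

Lemma open_rat_nbhs (U : set X) x : open U -> U x ->
  exists p q : rat, oo_set (ratr p) (ratr q) x /\ oo_set (ratr p) (ratr q) `<=` U.
Proof.
move=> [V oV <-] Vx.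
have /nbhs_ballP[e /= e0 eV] : nbhs (\val x : R) V by exact: open_nbhs_nbhs.
have [p] := @rat_in_itvoo R (\val x - e) (\val x) ltac:(rewrite ltrBlDr ltrDl//).
have [q] := @rat_in_itvoo R (\val x) (\val x + e) ltac:(rewrite ltrDl//).
rewrite !in_itv /= => /andP[xq qe] /andP[ep px].
exists p, q; split; first by rewrite /oo_set /= px xq.
move=> y /= /andP[py yq]; apply: eV; rewrite /ball /= ltr_distlC.
by rewrite (lt_trans ep)//= (lt_trans yq).
Qed.

Lemma compact_le (n : R) : compact [set x : X | \val x <= n].
Proof.
have -> : [set x : X | \val x <= n] = proj @` `[0, n].
  apply/seteqP; split => [x /= xn|x /= [t]]; last first.
    by rewrite in_itv /= => /andP[t0 tn] <-; rewrite /= max_l.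
  by exists (\val x); [rewrite in_itv /= val_ge0|exact: projK].
apply: continuous_compact; last exact: segment_compact.
exact/continuous_subspaceT/continuous_proj.
Qed.

Lemma open_measurable_X (U : set X) : open U -> measurable (U : set bX).
Proof. by move=> oU; apply: sub_sigma_algebra. Qed.

Lemma measurable_oo_set a b : measurable (oo_set a b : set bX).
Proof. by apply: open_measurable_X; exact: open_oo_set. Qed.

Definition oo_sets : set (set bX) := [set A | exists a b, A = oo_set a b].

Lemma setI_closed_oo_sets : setI_closed oo_sets.
Proof.
move=> _ _ [a [b ->]] [c [d ->]]; exists (Num.max a c), (Num.min b d).
apply/seteqP; split => x; rewrite /oo_set /= gt_max lt_min.
  by move=> [/andP[-> ->] /andP[-> ->]].
by move=> /andP[/andP[-> ->] /andP[-> ->]].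
Qed.

Lemma borel_oo_sets : @measurable _ bX = <<s oo_sets >>.
Proof.
apply/seteqP; split => A; last first.
  apply: smallest_sub; first exact: sigma_algebra_measurable.
  by move=> _ [a [b ->]]; exact: measurable_oo_set.
apply: smallest_sub; first exact: smallest_sigma_algebra.
move=> U oU.
pose f (pq : rat * rat) : set X := oo_set (ratr pq.1) (ratr pq.2).
have -> : U = \bigcup_(pq in [set pq | f pq `<=` U]) f pq.
  apply/seteqP; split => [x Ux|x [pq /= pqU]]; last exact: pqU.
  by have [p [q [xpq pqU]]] := open_rat_nbhs oU Ux; exists (p, q).
rewrite bigcup_mkcond.
apply: (@countable_bigcupT_measurable _ (g_sigma_algebraType oo_sets)).
  exact: countableP.
move=> pq; case: ifPn => // _; apply: sub_sigma_algebra.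
by exists (ratr pq.1), (ratr pq.2).
Qed.

(** The neighbourhoods may be taken among the countably many rational
    intervals. *)
Lemma locally_null (mu : {measure set bX -> \bar R}) (A : set bX) :
  measurable A ->
  (forall x, A x -> exists U : set X, [/\ open U, U x & mu U = 0%E]) -> mu A = 0%E.
Proof.
move=> mA h.
pose f (pq : rat * rat) : set X := oo_set (ratr pq.1) (ratr pq.2).
pose F (n : nat) : set bX := if choice.unpickle n is Some pq then
  (if mu (f pq) == 0%E then f pq else set0) else set0.
have : mu.-negligible (\bigcup_n F n).
  apply: negligible_bigcup => n; rewrite /F; case: (choice.unpickle n) => [pq|]; last first.
    exact: negligible_set0.
  case: ifPn => [/eqP f0|_]; last exact: negligible_set0.
  by exists (f pq); split => //; exact: measurable_oo_set.
move=> [B [mB B0 FB]]; apply/eqP; rewrite eq_le measure_ge0 andbT -B0.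
apply: le_measure; rewrite ?inE// => x Ax; apply: FB.
have [U [oU Ux U0]] := h x Ax; have [p [q [xpq pqU]]] := open_rat_nbhs oU Ux.
have f0 : mu (f (p, q)) == 0%E.
  rewrite eq_le measure_ge0 andbT -U0; apply: le_measure; rewrite ?inE.
  - exact: measurable_oo_set.
  - exact: open_measurable_X.
  - exact: pqU.
exists (choice.pickle (p, q)); first exact: Logic.I.
rewrite /F choice.pickleK f0; exact: xpq.
Qed.

(** Tent functions, which increase to the indicators of the intervals. *)
Definition tent (a b : R) (n : nat) (x : X) : R :=
  Num.min 1 (n%:R * Num.max 0 (Num.min (\val x - a) (b - \val x))).

Lemma tent_ge0 a b n x : 0 <= tent a b n x.
Proof. by rewrite /tent le_min ler01 /= mulr_ge0// le_max lexx. Qed.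

Lemma tent_le1 a b n x : tent a b n x <= 1.
Proof. by rewrite /tent ge_min lexx. Qed.

Lemma continuous_tent a b n : continuous (tent a b n).
Proof.
move=> x; have cv : {for x, continuous (fun x : X => \val x : R^o)} by exact: continuous_val.
have c1 : {for x, continuous (fun x : X => \val x - a : R^o)}.
  exact: (cvgB cv (cvg_cst _)).
have c2 : {for x, continuous (fun x : X => b - \val x : R^o)}.
  exact: (cvgB (cvg_cst _) cv).
have c3 := continuous_min c1 c2.
have c4 : {for x, continuous ((fun=> 0 : R^o) \max ((fun x : X => \val x - a : R^o) \min (fun x : X => b - \val x : R^o)))}.
  by apply: continuous_max; [exact: cst_continuous|exact: c3].
have c5 : {for x, continuous (fun x => n%:R * ((fun=> 0) \max ((fun x : X => \val x - a : R^o) \min (fun x : X => b - \val x : R^o))) x : R^o)}.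
  exact: (cvgM (cvg_cst _) c4).
have c6 : {for x, continuous (fun _ : X => 1 : R^o)} by exact: cst_continuous.
exact: (continuous_min c6 c5).
Qed.

Lemma tent_supp a b n x : ~ oo_set a b x -> tent a b n x = 0.
Proof.
rewrite /oo_set /= => /negP; rewrite negb_and -!leNgt => h.
have hm : Num.min (\val x - a) (b - \val x) <= 0 by rewrite ge_min !subr_le0.
by rewrite /tent (max_l hm) mulr0 min_r.
Qed.

Lemma tent_nd a b x n k : (n <= k)%N -> tent a b n x <= tent a b k x.
Proof.
move=> nk; rewrite /tent le_min ge_min lexx /=.
rewrite ge_min; apply/orP; right; apply: ler_wpM2r; last by rewrite ler_nat.
by rewrite le_max lexx.
Qed.

Lemma cvg_tent a b x : (fun n => tent a b n x) @ \oo --> (\1_(oo_set a b) x : R).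
Proof.
have [xab|xab] := pselect (oo_set a b x); last first.
  rewrite indicE memNset//; apply: cvg_near_cst; apply: nearW => n.
  exact: tent_supp.
rewrite indicE mem_set//; move: (xab); rewrite /oo_set /= => /andP[ax xb].
pose c := Num.min (\val x - a) (b - \val x).
have c0 : 0 < c by rewrite lt_min !subr_gt0 ax.
apply: cvg_near_cst; exists (Num.truncn c^-1).+1 => // n /= hn.
rewrite /tent -/c max_r ?ltW// min_l// -ler_pdivrMr// mul1r ltW//.
by rewrite (lt_le_trans (truncnS_gt _))// ler_nat.
Qed.

Lemma measurable_continuous_X (f : X -> R) : continuous f ->
  measurable_fun setT (f : bX -> R).
Proof.
move=> /continuousP cf; apply: (measurability _ (RGenOpens.measurableE R)).
move=> _ [_ [a [b ->] <-]]; rewrite setTI; apply: open_measurable_X.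
by apply: cf; exact: interval_open.
Qed.

(** The tent functions converge monotonically to the indicators of the
    intervals, so the two measures defined by [I] and [J] agree on a family of
    sets that is stable under intersection and generates the Borel sets. *)
Theorem mono_functional_unique (I J : (bX -> \bar R) -> \bar R) :
  mono_functional I -> mono_functional J ->
  (forall f : X -> R, continuous f -> (forall x, 0 <= f x) ->
    (exists N : R, forall x, N < \val x -> f x = 0) ->
    I (EFin \o f) = J (EFin \o f) /\ (I (EFin \o f) < +oo)%E) ->
  forall f, nnm f -> I f = J f.
Proof.
move=> hI hJ IJ; apply: mono_functional_ext => // A mA.
have nt a b n : nnm (EFin \o (tent a b n) : bX -> \bar R).
  split => [|x]; last by rewrite lee_fin tent_ge0.
  apply/measurable_EFinP; apply: measurable_continuous_X; exact: continuous_tent.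
have It a b n : I (EFin \o tent a b n) = J (EFin \o tent a b n) /\
    (I (EFin \o tent a b n) < +oo)%E.
  apply: IJ; [exact: continuous_tent|exact: tent_ge0|].
  exists b => x bx; apply: tent_supp; rewrite /oo_set /= => /andP[_ xb].
  by have := lt_trans bx xb; rewrite ltxx.
have cI (K : (bX -> \bar R) -> \bar R) a b : mono_functional K ->
    (fun n => K (EFin \o tent a b n)) @ \oo --> K (fun x => (\1_(oo_set a b) x)%:E).
  move=> hK; apply: (mf_cvg hK) => //.
  - exact: nnm_indic (measurable_oo_set _ _).
  - by move=> x n k nk; rewrite lee_fin tent_nd.
  - move=> x; apply/fine_cvgP; split; first exact: nearW.
    exact: cvg_tent.
rewrite -(mf_measureE hI mA) -(mf_measureE hJ mA).
apply: (measure_unique oo_sets (fun n => oo_set (-1) n%:R)) => //.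
- exact: borel_oo_sets.
- exact: setI_closed_oo_sets.
- by move=> n; exists (-1), n%:R.
- apply/seteqP; split => // x _; exists (Num.truncn (\val x)).+1 => //.
  by rewrite /oo_set /= truncnS_gt andbT (lt_le_trans _ (val_ge0 x))// ltrN10.
- move=> _ [a [b ->]]; rewrite /= !mf_measureE; try exact: measurable_oo_set.
  apply: (@cvg_unique _ (@ereal_hausdorff R) ((fun n => I (EFin \o tent a b n)) @ \oo)).
    exact: cI.
  rewrite (_ : (fun _ => _) = fun n => J (EFin \o tent a b n)); first exact: cI.
  by apply/funext => n; have [] := It a b n.
- move=> n; rewrite /= mf_measureE; last exact: measurable_oo_set.
  have [_] := It (- 2) n.+1%:R 1%N; apply: le_lt_trans.
  apply: (mf_le hI) => // [|x]; first exact: nnm_indic (measurable_oo_set _ _).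
  rewrite lee_fin indicE.
  case: (boolP (x \in oo_set (-1) n%:R)) => [/set_mem|_]; last exact: tent_ge0.
  rewrite /oo_set /= => /andP[x1 xn]; rewrite /tent /= min_l// mul1r le_max le_min.
  apply/orP; right; rewrite -(natr1 n); apply/andP; split; lra.
Qed.

End halfline_topology.

(** * Commutativity and supports of point-mass products *)

Section involution.
Context {R : realType}.
Notation X := ('X_R).

(** If [s] moved [a] up to [b], it would stay below [b] to the right of [a] by
    injectivity and the intermediate value theorem, hence be bounded, and could
    not be onto. If it moved a point down, it would move the image of that point
    up. *)
Lemma continuous_involution_id (s : X -> X) : continuous s -> involutive s ->
  forall x, s x = x.
Proof.
move=> cs sK.
pose G t := \val (s (proj t)) : R.
have cG : continuous G.
  move=> t; apply: (@continuous_comp _ _ _ (s \o proj) (fun x : X => \val x : R)).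
    apply: continuous_comp; [exact: continuous_proj|exact: cs].
  exact: continuous_val.
have cGw a b : {within `[a, b], continuous G} by exact: continuous_subspaceT.
have GE (x : X) : G (\val x) = \val (s x) by rewrite /G projK.
have injG t u : 0 <= t -> 0 <= u -> G t = G u -> t = u.
  move=> t0 u0 /val_inj /(congr1 s); rewrite !sK => e.
  by rewrite -(val_proj t0) -(val_proj u0) e.
suff main a : ~ (\val a < \val (s a)).
  move=> x; apply/val_inj/eqP; rewrite eq_le !leNgt; apply/andP; split; apply/negP.
    exact: main.
  by have := @main (s x); rewrite sK.
move=> ab; set b := s a in ab.
have Ga : G (\val a) = \val b by rewrite GE.
have Gb : G (\val b) = \val a by rewrite GE sK.
have noval u : \val a < u -> G u <> \val b.
  move=> au; rewrite -Ga => /injG e.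
  have u0 : 0 <= u by rewrite (le_trans (val_ge0 a))// ltW.
  by move: au; rewrite e ?ltxx ?val_ge0.
have c1 t : \val a <= t -> G t <= \val b.
  rewrite le_eqVlt => /predU1P[<-|at_]; first by rewrite Ga.
  rewrite leNgt; apply/negP => bG.
  have [bt|tb] := leP (\val b) t.
    have [|u] := @IVT _ _ _ _ (\val b) bt (cGw _ _).
      by rewrite Gb ge_min le_max (ltW ab) (ltW bG) orbT.
    rewrite in_itv /= => /andP[bu ut]; apply: noval.
    exact: lt_le_trans bu.
  have [|u] := @IVT _ _ _ _ (\val b) (ltW tb) (cGw _ _).
    by rewrite Gb ge_min le_max (ltW ab) (ltW bG) orbT.
  rewrite in_itv /= => /andP[tu ut]; apply: noval.
  exact: lt_le_trans tu.
have [c _ hc] := @EVT_max _ G 0 (\val a) (val_ge0 a) (cGw _ _).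
pose M := Num.max (\val b) (G c).
have GM t : 0 <= t -> G t <= M.
  move=> t0; rewrite le_max; have [at_|ta] := leP (\val a) t.
    by rewrite c1.
  by rewrite hc ?orbT// in_itv /= t0 ltW.
have M0 : 0 <= M by rewrite le_max val_ge0.
have := GM (\val (s (proj (M + 1)))) (val_ge0 _).
rewrite GE sK val_proj; last by rewrite addr_ge0.
by rewrite gerDl ler10.
Qed.

End involution.

Section hypergroup_basics.
Context {R : realType} (H : @hypergroup R).
Notation X := ('X_R).
Notation bX := (borel X).
Local Notation K := (hg_conv H).
Implicit Types (x y z s t : X).

Lemma hg_inv_id x : hg_inv H x = x.
Proof.
exact: continuous_involution_id (@hg_inv_continuous _ H) (@hg_invK _ H) x.
Qed.

(** The involution reverses products, and it is the identity. *)
Lemma hg_conv_comm x y (A : set bX) : measurable A -> K x y A = K y x A.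
Proof.
move=> mA; have := hg_conv_inv H y x mA.
rewrite !hg_inv_id => ->; congr (K y x _).
by apply/seteqP; split => z /=; rewrite hg_inv_id.
Qed.

(** The involution being the identity, the support axiom says that [0] is in the
    support of [x * y] only on the diagonal. *)
Lemma msupport0 x y : msupport (K x y) (X0 : X) <-> x = y.
Proof. by rewrite hg_supp0_inv hg_inv_id; split => ->. Qed.

Lemma closed_msupport (mu : {measure set bX -> \bar R}) : open (~` msupport mu).
Proof.
rewrite openE => x /= /existsNP[U /not_implyP[oU /not_implyP[Ux /negP U0]]].
rewrite /interior /= nbhsE; exists U; first by split.
by move=> y Uy /(_ U oU Uy) h; rewrite h in U0.
Qed.

Lemma measure_off_support (mu : {measure set bX -> \bar R}) (A : set bX) :
  measurable A -> A `&` msupport mu = set0 -> mu A = 0%E.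
Proof.
move=> mA A0; apply: locally_null => // x Ax.
have : ~ msupport mu x by move=> sx; have : (A `&` msupport mu) x by []; rewrite A0.
move=> /existsNP[U /not_implyP[oU /not_implyP[Ux /negP U0]]].
exists U; split => //; apply/eqP; rewrite eq_le measure_ge0 andbT leNgt//.
Qed.

Lemma measure_meets_support (mu : {measure set bX -> \bar R}) (U : set X) :
  open U -> msupport mu `&` U !=set0 -> (0 < mu U)%E.
Proof. by move=> oU [x [sx Ux]]; exact: sx. Qed.

End hypergroup_basics.

Section caratheodory.
Context {R : realType}.
Notation X := ('X_R).
Notation bX := (borel X).

Lemma cvg_pairX T (F : set_system T) {FF : Filter F} (f g : T -> X) (a b : X) :
  f @ F --> a -> g @ F --> b -> (fun t => (f t, g t)) @ F --> (a, b).
Proof. by move=> hf hg; exact: (cvg_pair hf hg). Qed.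

(** [x] rounded down to a multiple of [1 / n.+1]. *)
Definition grid (n : nat) (x : X) : X :=
  proj ((Num.truncn (n.+1%:R * \val x))%:R / n.+1%:R).

Lemma cvg_grid x : (fun n => grid n x) @ \oo --> x.
Proof.
rewrite -{2}(projK x).
rewrite /grid; apply: continuous_cvg; first exact: continuous_proj.
apply/cvgrPdist_lt => e e0.
exists (Num.truncn e^-1).+1 => // n /= hn.
have n0 : 0 < n.+1%:R :> R by rewrite ltr0n.
have en : n.+1%:R^-1 < e.
  rewrite invf_plt ?posrE// (lt_le_trans (truncnS_gt _))// ler_nat.
  exact: leqW.
have /andP[h1 h2] := truncn_itv (mulr_ge0 (ltW n0) (val_ge0 x)).
apply: le_lt_trans en.
rewrite -(natr1 (Num.truncn _)) in h2.
set k := ((Num.truncn _)%:R : R) in h1 h2 *.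
have hf (u v w : R) : w != 0 -> u - v / w = (w * u - v) / w by move=> ?; field.
rewrite hf ?lt0r_neq0//.
rewrite ger0_norm ?divr_ge0 ?subr_ge0 ?(ltW n0)// ler_pdivrMr// mulVf ?lt0r_neq0//.
by rewrite lerBlDl ltW.
Qed.

(** The measurable structure of the product is generated by rectangles, not by
    open sets, so continuity does not give measurability directly. [F] is the
    pointwise limit of its discretizations in the first variable, which are
    measurable. *)
Lemma measurable_continuous2 (F : X * X -> R) : continuous F ->
  measurable_fun setT (F : bX * bX -> R).
Proof.
move=> cF.
apply: (@measurable_fun_cvg _ _ _ _ (fun n (p : bX * bX) => F (grid n p.1, p.2))).
  move=> n _ A mA; rewrite setTI.
  have n0 : 0 < n.+1%:R :> R by rewrite ltr0n.
  have -> : (fun p : bX * bX => F (grid n p.1, p.2)) @^-1` A =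
     \bigcup_k (([set x : X | \val x < k.+1%:R / n.+1%:R] `\`
                 [set x : X | \val x < k%:R / n.+1%:R]) `*`
               ((fun y => F (proj (k%:R / n.+1%:R), y)) @^-1` A)).
    apply/seteqP; split => [[x y] /= Axy|[x y] [k _ /= [[h1 /negP]]]].
      have /andP[h1 h2] := truncn_itv (mulr_ge0 (ltW n0) (val_ge0 x)).
      exists (Num.truncn (n.+1%:R * \val x)) => //=; split => //; split.
        by rewrite ltr_pdivlMr// [ltLHS]mulrC; exact: h2.
      by apply/negP; rewrite -leNgt ler_pdivrMr// [leRHS]mulrC; exact: h1.
    rewrite -leNgt ler_pdivrMr// [leRHS]mulrC => h2 h3; rewrite /grid.
    suff -> : Num.truncn (n.+1%:R * \val x) = k by [].
    apply/eqP; rewrite truncn_eq; last by rewrite mulr_ge0// val_ge0.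
    by rewrite h2 /= mulrC -ltr_pdivlMr.
  apply: bigcupT_measurable => k; apply: measurableX.
    by apply: measurableD; apply: open_measurable_X; exact: open_val_lt.
  have cFk : continuous (fun y => F (proj (k%:R / n.+1%:R), y)).
    move=> y; apply: (@continuous_comp _ _ _ (fun y => (proj (k%:R / n.+1%:R), y)) F).
      exact: (cvg_pairX (@cvg_cst _ _ _ (nbhs y) _) cvg_id).
    exact: cF.
  by have := measurable_continuous_X cFk measurableT mA; rewrite setTI.
move=> [x y] _ /=.
have h : (fun n => (grid n x, y)) @ \oo --> ((x, y) : X * X).
  exact: (cvg_pairX (@cvg_grid x) (@cvg_cst _ y _ \oo _)).
exact: (cvg_comp _ F h (cF (x, y))).
Qed.
End caratheodory.

(** * Generalized translation *)

Section finite_functional_measure.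
Context {R : realType} d (T : measurableType d).
Variables (I : (T -> \bar R) -> \bar R) (hI : mono_functional I).
Hypothesis I1 : (I (fun=> 1%:E) < +oo)%E.

(** A copy of [mf_measure] that carries the structure of a finite measure. *)
Definition mf_fin_measure of (I (fun=> 1%:E) < +oo)%E := mf_measure hI.
Local Notation mu := (mf_fin_measure I1).

HB.instance Definition _ := Measure.copy mu (mf_measure hI).

Let mu_fin : fin_num_fun mu.
Proof.
apply: lty_fin_num_fun; rewrite /= /mf_fin_measure mf_measureE//.
by rewrite (_ : (fun x => (\1_setT x)%:E) = fun=> 1%:E)//; apply/funext => x; rewrite indicT.
Qed.

HB.instance Definition _ := @Measure_isFinite.Build _ _ _ mu mu_fin.

End finite_functional_measure.

Section nnm_lemmas.
Context {R : realType} d (T : measurableType d) d' (S : measurableType d').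

Lemma mono_functional_comp (mu : {measure set S -> \bar R})
    (K : S -> (T -> \bar R) -> \bar R) :
  (forall s, mono_functional (K s)) ->
  (forall f, nnm f -> measurable_fun setT (fun s => K s f)) ->
  mono_functional (fun f => \int[mu]_s K s f)%E.
Proof.
move=> hK mK.
have := @mono_functional_weight _ _ _ _ _ mu (fun=> 1%E) K _ hK mK.
rewrite (_ : (fun f => _) = fun f => \int[mu]_s K s f)%E; last first.
  by apply/funext => f; under eq_integral do rewrite mul1e.
by apply; exact: nnm_cst.
Qed.

Lemma integral0_pos_null (mu : {measure set T -> \bar R}) f (W : set T) :
  nnm f -> measurable W -> (\int[mu]_x f x = 0)%E -> (forall x, W x -> (0 < f x)%E) ->
  mu W = 0%E.
Proof.
move=> [mf f0] mW If fW.
have : ae_eq mu setT f (cst 0%E).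
  apply/(ae_eq_integral_abs mu measurableT mf).
  by rewrite -[RHS]If; apply: eq_integral => x _; rewrite gee0_abs.
move=> [B [mB B0 hB]]; apply/eqP; rewrite eq_le measure_ge0 andbT -B0.
apply: le_measure; rewrite ?inE// => x Wx; apply: hB => /= /(_ Logic.I) e.
by have := fW x Wx; rewrite e ltxx.
Qed.

End nnm_lemmas.

Section translation.
Context {R : realType} (H : @hypergroup R).
Notation X := ('X_R).
Notation bX := (borel X).
Local Notation K := (hg_conv H).
Implicit Types (x y z s t : X) (f g h k : bX -> \bar R).
Local Open Scope ereal_scope.

Definition conv_kernel (p : bX * bX) : {measure set bX -> \bar R} := K p.1 p.2.

Lemma Rintegral_conv_EFin x y (f : X -> R) : continuous f ->
  (exists B : R, forall x, `|f x|%R <= B)%R ->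
  \int[K x y]_t (f t)%:E = (\int[K x y]_t f t)%:E.
Proof.
move=> cf [B fB]; rewrite /Rintegral fineK//.
apply: integrable_fin_num => //; apply: measurable_bounded_integrable => //.
- by rewrite [X in (X < _)%E]probability_setT ltry.
- exact: measurable_continuous_X.
- exists B; split; first by rewrite num_real.
  by move=> r Br t _ /=; apply: (le_trans (fB t)); exact: ltW.
Qed.

(** On intervals by the weak continuity of the convolution, through the tent
    functions; on all Borel sets by Dynkin's theorem. *)
Lemma measurable_conv_kernel (A : set bX) : measurable A ->
  measurable_fun setT (fun p => conv_kernel p A).
Proof.
rewrite [X in X A -> _]borel_oo_sets.
apply: (@dynkin_induction _ bX oo_sets (fun A => measurable_fun setT (fun p => conv_kernel p A))).
- exact: borel_oo_sets.
- exact: setI_closed_oo_sets.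
- rewrite (_ : (fun p => _) = fun=> 1); first exact: measurable_cst.
  by apply/funext => p; exact: probability_setT.
- move=> _ [a [b ->]].
  apply: (@emeasurable_fun_cvg _ _ _ _ (fun n p => \int[conv_kernel p]_t (tent a b n t)%:E)).
    move=> n.
    have bt : (exists B : R, forall x, `|tent a b n x|%R <= B)%R.
      by exists 1%R => x; rewrite ger0_norm ?tent_ge0// tent_le1.
    rewrite (_ : (fun p => _) = fun p => (\int[K p.1 p.2]_t tent a b n t)%:E); last first.
      by apply/funext => p; rewrite Rintegral_conv_EFin//; exact: continuous_tent.
    apply/measurable_EFinP; apply: measurable_continuous2.
    by apply: hg_continuous => //; exact: continuous_tent.
  move=> p _; have := mono_functional_int (conv_kernel p).
  have -> : conv_kernel p (oo_set a b) = \int[conv_kernel p]_t (\1_(oo_set a b) t)%:E.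
    by rewrite integral_indic ?setIT//; exact: measurable_oo_set.
  move=> hI; apply: (mf_cvg hI).
  - move=> n; split => [|x]; last by rewrite lee_fin tent_ge0.
    by apply/measurable_EFinP; apply: measurable_continuous_X; exact: continuous_tent.
  - exact: nnm_indic (measurable_oo_set _ _).
  - by move=> x n k nk; rewrite lee_fin tent_nd.
  - move=> x; apply/fine_cvgP; split; first exact: nearW.
    exact: cvg_tent.
- move=> S mS mf.
  rewrite (_ : (fun p => _) = fun p => 1 - conv_kernel p S); last first.
    by apply/funext => p; exact: probability_setC.
  by apply: emeasurable_funB => //; exact: measurable_cst.
- move=> F mF tF mKF.
  rewrite (_ : (fun p => _) = fun p => \sum_(0 <= k <oo) conv_kernel p (F k)); last first.
    by apply/funext => p; rewrite measure_semi_bigcup//; exact: bigcup_measurable.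
  by apply: ge0_emeasurable_sum.
Qed.

HB.instance Definition _ :=
  isKernel.Build _ _ (bX * bX)%type bX R conv_kernel measurable_conv_kernel.

Let conv_kernel_prob p : conv_kernel p setT = 1.
Proof. exact: probability_setT. Qed.

HB.instance Definition _ :=
  Kernel_isProbability.Build _ _ (bX * bX)%type bX R conv_kernel conv_kernel_prob.

(** [lam f x y] is f(x * y), with values in [[0, +oo]] so that it makes sense for
    all nonnegative functions. *)
Definition lam f x y := \int[K x y]_t f t.

Lemma nnm_lam f : nnm f -> nnm (fun p : bX * bX => lam f p.1 p.2).
Proof.
move=> [mf f0]; split => [|p]; last exact: integral_ge0.
exact: (measurable_fun_integral_kernel measurable_conv_kernel f0 mf).
Qed.

Lemma lamC f x y : nnm f -> lam f x y = lam f y x.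
Proof.
move=> [mf f0]; apply: eq_measure_integral => A mA _.
exact: hg_conv_comm.
Qed.

Lemma nnm_laml f x : nnm f -> nnm (fun y : bX => lam f x y).
Proof.
move=> /nnm_lam[mf f0]; split => [|y]; last exact: (f0 (x, y)).
exact: (measurable_fun_pair2 (x : bX) mf).
Qed.

Lemma nnm_lamr f y : nnm f -> nnm (fun x : bX => lam f x y).
Proof.
move=> /nnm_lam[mf f0]; split => [|x]; last exact: (f0 (x, y)).
exact: (measurable_fun_pair1 (y : bX) mf).
Qed.

Lemma mono_functional_lam x y : mono_functional (fun f => lam f x y).
Proof. exact: mono_functional_int. Qed.

Lemma lam_indic (A : set bX) x y : measurable A ->
  lam (fun t => (\1_A t)%:E) x y = K x y A.
Proof. by move=> mA; rewrite /lam integral_indic// setIT. Qed.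

Lemma lam_cst (c : R) x y : (0 <= c)%R -> lam (fun=> c%:E) x y = c%:E.
Proof.
move=> c0; rewrite /lam integral_cst//.
by rewrite [X in _ * X]probability_setT mule1.
Qed.

Local Notation dX x := (@dirac _ (bX : measurableType _) x R).

Lemma int_dirac x f : measurable_fun setT f -> \int[dX x]_t f t = f x.
Proof. by move=> mf; rewrite integral_dirac// diracT mul1e. Qed.

(** [K x t] is the product of two point masses in the sense of [is_mproduct]. *)
Lemma mproduct_dirac x t (B : set bX) : measurable B ->
  K x t B = \int[dX x]_x' \int[dX t]_t' K x' t' B.
Proof.
move=> mB; have mK := measurable_conv_kernel mB.
rewrite (eq_integral (fun x' : bX => K x' t B)); last first.
  by move=> x' _; rewrite int_dirac//; exact: (measurable_fun_pair2 (x' : bX) mK).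
by rewrite int_dirac//; exact: (measurable_fun_pair1 (t : bX) mK).
Qed.

(** Associativity of the convolution, applied to three point masses: both sides
    are f(x * t * y). *)
Lemma lamA f x t y : nnm f ->
  \int[K x t]_s lam f s y = \int[K t y]_s lam f x s.
Proof.
move: f.
have hI : mono_functional (fun f => \int[K x t]_s lam f s y).
  apply: mono_functional_comp => [s|f nf]; first exact: mono_functional_lam.
  by have [] := nnm_lamr y nf.
have hJ : mono_functional (fun f => \int[K t y]_s lam f x s).
  apply: mono_functional_comp => [s|f nf]; first exact: mono_functional_lam.
  by have [] := nnm_laml x nf.
apply: mono_functional_ext => // A mA.
have I1 : \int[K x t]_s lam (fun=> 1%:E) s y < +oo.
  under eq_integral do rewrite lam_cst//.
  by rewrite integral_cst// [X in _ * X]probability_setT mule1 ltry.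
have J1 : \int[K t y]_s lam (fun=> 1%:E) x s < +oo.
  under eq_integral do rewrite lam_cst//.
  by rewrite integral_cst// [X in _ * X]probability_setT mule1 ltry.
rewrite -(mf_measureE hI mA) -(mf_measureE hJ mA).
apply: (@hg_convA _ H (dirac (x : bX)) (dirac (t : bX)) (dirac (y : bX))
   (K x t) (K t y) (mf_fin_measure hI I1) (mf_fin_measure hJ J1)) => //.
- by move=> B mB; exact: mproduct_dirac.
- by move=> B mB; exact: mproduct_dirac.
- move=> B mB; rewrite /= /mf_fin_measure mf_measureE//.
  apply: eq_integral => s _; rewrite lam_indic// int_dirac//.
  exact: (measurable_fun_pair2 (s : bX) (measurable_conv_kernel mB)).
- move=> B mB; rewrite /= /mf_fin_measure mf_measureE//.
  rewrite (int_dirac x (f := fun x => integral (K t y) setT (fun s : bX => K x s B))).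
    by apply: eq_integral => s _; rewrite lam_indic.
  rewrite (_ : (fun x => _) = fun x => integral (K t y) setT (fun s : bX => lam (fun t => (\1_B t)%:E) x s)).
    have nB := nnm_lam (nnm_indic mB).
    exact: (@measurable_fun_fubini_tonelli_F _ _ _ _ _ (K t y) _ nB.1 nB.2).
  by apply/funext => z; apply: eq_integral => s _; rewrite lam_indic.
Qed.

End translation.

(** * Symmetry of the supports *)

Section supports.
Context {R : realType} (H : @hypergroup R).
Notation X := ('X_R).
Notation bX := (borel X).
Local Notation K := (hg_conv H).
Local Notation lam := (lam H).
Implicit Types (x y z s t w : X) (f g h k : bX -> \bar R).
Local Open Scope ereal_scope.

(** f(x * y * t) *)
Definition triple f x y t := \int[K x y]_s lam f s t.

(** Commutativity and associativity. *)
Lemma tripleC f x y t : nnm f -> triple f x y t = triple f x t y.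
Proof.
move=> nf; rewrite /triple.
have -> : \int[K x y]_s lam f s t = \int[K y x]_s lam f s t.
  by apply: eq_measure_integral => A mA _; exact: hg_conv_comm.
rewrite lamA//; apply: eq_integral => s _; exact: lamC.
Qed.

(** Compactness for increasing sequences of open sets. *)
Lemma near_below (Y : topologicalType) (P : nat -> set Y) (S : set Y) : compact S ->
  (forall n, open (P n)) -> (forall n m, (n <= m)%N -> P n `<=` P m) ->
  (forall w : Y, S w -> exists n, P n w) -> exists n, S `<=` P n.
Proof.
move=> /compact_near_coveringP cS oP ndP SP.
have : \forall n \near \oo, S `<=` (fun w : Y => P n w).
  apply: cS => w Sw; have [n Pnw] := SP w Sw.
  exists (P n, [set k | (n <= k)%N]) => /=.
    by split; [exact: open_nbhs_nbhs|exists n].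
  by move=> [v k] /= [Pnv nk]; exact: (ndP _ _ nk).
by move=> /filter_ex.
Qed.

Lemma open_section1 (S : set (X * X)) t : open S -> open [set w | S (w, t)].
Proof.
have c : continuous (fun w : X => (w, t)).
  by move=> w; exact: (@cvg_pairX _ X (nbhs w) _ id (fun=> t) w t cvg_id (@cvg_cst _ t _ (nbhs w) _)).
by move=> oS; exact: ((continuousP _).1 c _ oS).
Qed.

Lemma open_section2 (S : set (X * X)) t : open S -> open [set w | S (t, w)].
Proof.
have c : continuous (fun w : X => (t, w)).
  by move=> w; exact: (@cvg_pairX _ X (nbhs w) _ (fun=> t) id t w (@cvg_cst _ t _ (nbhs w) _) cvg_id).
by move=> oS; exact: ((continuousP _).1 c _ oS).
Qed.

Lemma open_X0 (U : set X) : open U -> U X0 ->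
  exists n : nat, forall x, (\val x <= n.+1%:R^-1)%R -> U x.
Proof.
move=> oU U0; have [p [q [/andP[p0 q0] pqU]]] := open_rat_nbhs oU U0.
exists (Num.truncn (ratr q : R)^-1).+1 => x xn; apply: pqU.
rewrite /oo_set /= (lt_le_trans p0 (val_ge0 x))/= (le_lt_trans xn)//.
rewrite invf_plt ?posrE// (lt_le_trans (truncnS_gt _))// ler_nat.
exact: leqW.
Qed.

(** [z] is in the support of [s * t] iff [0] is in the support of the triple
    product of [s], [t] and [z], which is symmetric. *)
Lemma msupport_swap s t z : msupport (K s t) z -> msupport (K s z) t.
Proof.
move=> zst; apply: contrapT => tsz.
pose U (n : nat) : set X := [set x | (\val x < n.+1%:R^-1)%R].
have oU n : open (U n) by exact: open_val_lt.
have mU n : measurable (U n : set bX) by exact: open_measurable_X.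
have U0 n : U n X0 by rewrite /U /= invr_gt0.
pose P n : set X := [set w | msupport (K w t) `<=` [set x | (n.+1%:R^-1 < \val x)%R]].
have [n hn] : exists n, msupport (K s z) `<=` P n.
  apply: near_below; first exact: hg_compact.
  - move=> n; have := @hg_supp_sub _ H _ (open_val_gt (n.+1%:R^-1)%R).
    exact: open_section1.
  - move=> n m nm w /= h x /h /=; apply: le_lt_trans.
    by rewrite lef_pV2 ?posrE// ler_nat.
  - move=> w sw; have : ~ msupport (K w t) (X0 : X).
      by rewrite msupport0 => wt; apply: tsz; rewrite -wt.
    move=> /(open_X0 (closed_msupport _))[n hn]; exists n => x xs /=.
    by rewrite ltNge; apply/negP => /hn.
have nU : nnm (fun x : bX => (\1_(U n) x)%:E : \bar R) by exact: nnm_indic (mU n).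
have h1 : triple (fun x => (\1_(U n) x)%:E) s z t = 0.
  have nf := nnm_lamr H t nU.
  rewrite /triple; transitivity (\int[K s z]_w `|lam (fun x => (\1_(U n) x)%:E) w t|).
    by apply: eq_integral => w _; rewrite gee0_abs// nf.2.
  apply/(ae_eq_integral_abs _ measurableT nf.1).
  exists (~` msupport (K s z)); split.
  - by apply: open_measurable_X; exact: closed_msupport.
  - apply: measure_off_support; first by apply: open_measurable_X; exact: closed_msupport.
    by rewrite setICl.
  - move=> w /= h sw; apply: h => _; rewrite lam_indic//.
    apply: measure_off_support => //; rewrite -subset0 => x [/= xn xs].
    by have := hn w sw x xs => /= /(lt_trans xn); rewrite ltxx.
rewrite tripleC// in h1.
pose W : set X := [set w | msupport (K w z) `&` U n !=set0].
have oW : open W by have := @hg_supp_meet _ H _ (oU n); exact: open_section1.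
have W0 : K s t W = 0.
  apply: (integral0_pos_null (nnm_lamr H z nU) _ h1); first exact: open_measurable_X.
  move=> w Ww; rewrite lam_indic//; exact: measure_meets_support (oU n) Ww.
have Wz : W z by exists X0; split; [exact/msupport0|exact: U0].
have Wp : 0 < K s t W by exact: zst.
by move: W0 => /eqP; rewrite gt_eqF.
Qed.

End supports.

(** * The Haar measure *)

Section haar.
Context {R : realType} (H : @hypergroup R).
Notation X := ('X_R).
Notation bX := (borel X).
Local Notation K := (hg_conv H).
Local Notation lam := (lam H).
Implicit Types (x y z s t w : X) (f g h k : bX -> \bar R).

Lemma continuous_Cc_bounded (u : X -> R) (N : R) : continuous u ->
  (forall x : X, N < \val x -> u x = 0) -> exists2 B : R, 0 <= B & forall x, `|u x| <= B.
Proof.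
move=> cu uN.
have N0 : 0 <= Num.max N 0 by rewrite le_max lexx orbT.
have c : {within `[0, Num.max N 0], continuous (fun r : R => `|u (proj r)|)}.
  apply: continuous_subspaceT => t.
  apply: (@continuous_comp _ _ _ (u \o proj) (fun r : R => `|r|)).
    by apply: continuous_comp; [exact: continuous_proj|exact: cu].
  exact: norm_continuous.
have [b _ hb] := EVT_max N0 c; exists `|u (proj b)| => // x.
have [xN|Nx] := leP (\val x) (Num.max N 0); last first.
  by rewrite uN ?normr0//; apply: le_lt_trans Nx; rewrite le_max lexx.
by have := hb (\val x); rewrite in_itv /= val_ge0 xN projK => /(_ isT).
Qed.

Lemma Cc_real (u : X -> R) (N : R) : continuous u ->
  (forall x : X, N < \val x -> u x = 0) -> Cc (fun x => (u x)%:C).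
Proof.
move=> cu uN; split.
  move=> x; have FF : Filter (nbhs x) by exact: nbhs_filter.
  have /(@cvgrPdist_lt _ _ _ _ FF) h := cu x.
  apply/(@cvgrPdist_lt _ _ _ _ FF) => -[z z'].
  rewrite ltcE /= => /andP[/eqP -> z0].
  by apply: filterS (h _ z0) => y; rewrite -rmorphB nrmE ltcR nrm_real.
exists [set x : X | \val x <= N]; first exact: compact_le.
by move=> x /= /negP; rewrite -ltNge => /uN ->.
Qed.

Local Open Scope ereal_scope.

Lemma radon_sigma_finite (m : {measure set bX -> \bar R}) : radon m ->
  sigma_finite setT m.
Proof.
move=> rm; exists (fun n : nat => [set x : X | (\val x < n%:R)%R]).
  apply/seteqP; split => // x _; exists (Num.truncn (\val x)).+1 => //=.
  exact: truncnS_gt.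
move=> n; split; first by apply: open_measurable_X; exact: open_val_lt.
have mn := rm _ (@compact_le R n%:R%R); apply: le_lt_trans mn.
apply: le_measure; rewrite ?inE.
- by apply: open_measurable_X; exact: open_val_lt.
- rewrite (_ : [set x : X | (\val x <= n%:R)%R] = ~` [set x | (n%:R < \val x)%R]).
    by apply: measurableC; apply: open_measurable_X; exact: open_val_gt.
  apply/seteqP; split => x /=; first by rewrite leNgt => /negP.
  by move=> /negP; rewrite -leNgt.
- by move=> x /= /ltW.
Qed.

Section with_haar.
Variables (m : {measure set bX -> \bar R}) (hm : haar_measure H m).

Lemma measurable_le (N : R) : measurable ([set x : X | (\val x <= N)%R] : set bX).
Proof.
rewrite (_ : [set x : X | _] = ~` [set x | (N < \val x)%R]).
  by apply: measurableC; apply: open_measurable_X; exact: open_val_gt.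
apply/seteqP; split => x /=; first by rewrite leNgt => /negP.
by move=> /negP; rewrite -leNgt.
Qed.

Lemma nnm_continuous (u : X -> R) : continuous u -> (forall x, (0 <= u x)%R) ->
  nnm (fun x : bX => (u x)%:E).
Proof.
move=> cu u0; split => [|x]; last by rewrite lee_fin.
by apply/measurable_EFinP; exact: measurable_continuous_X.
Qed.

Lemma integral_Cc_fin (u : X -> R) (N : R) : continuous u -> (forall x, (0 <= u x)%R) ->
  (forall x : X, (N < \val x)%R -> u x = 0%R) -> \int[m]_x (u x)%:E < +oo.
Proof.
move=> cu u0 uN; have [B B0 uB] := continuous_Cc_bounded cu uN.
apply: (@le_lt_trans _ _ (\int[m]_x (B%:E * (\1_([set x : X | (\val x <= N)%R]) x)%:E))).
  have nn := nnm_continuous cu u0; have ni := nnm_indic (measurable_le N).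
  apply: (mf_le (mono_functional_int m) nn (nnmZ B0 (ni R))) => x.
  have [xN|Nx] := leP (\val x) N; last first.
    by rewrite uN// mule_ge0// lee_fin.
  by rewrite -EFinM lee_fin indicE mem_set// mulr1 (le_trans (ler_norm _)).
rewrite ge0_integralZl//; last by apply/measurable_EFinP; exact: measurable_indic (measurable_le _).
rewrite integral_indic//; last exact: measurable_le.
have mN := haar_radon hm (@compact_le R N).
by rewrite setIT lte_mul_pinfty.
Qed.

Lemma haar_Rintegral (u : X -> R) (N : R) x : continuous u ->
  (forall x : X, (N < \val x)%R -> u x = 0%R) ->
  (\int[m]_y \int[K x y]_t u t = \int[m]_y u y)%R.
Proof.
move=> cu uN; have := haar_invariant hm (Cc_real cu uN) x.
by rewrite /cintegral => -[].
Qed.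

Lemma haar_exists_pos : exists (u : X -> R) (N : R), [/\ continuous u,
  forall x, (0 <= u x)%R, forall x : X, (N < \val x)%R -> u x = 0%R & 0 < \int[m]_x (u x)%:E].
Proof.
apply: contrapT => hno; have := haar_nontrivial hm; apply/negP/negPn/eqP.
apply: locally_null => // x _.
exists (oo_set (-1) (\val x + 1)); split.
- exact: open_oo_set.
- by rewrite /oo_set /= ltrDl ltr01 andbT (lt_le_trans _ (val_ge0 x))// ltrN10.
apply: contrapT => m0; apply: hno.
exists (tent (-2) (\val x + 2) 1), (\val x + 2)%R; split.
- exact: continuous_tent.
- exact: tent_ge0.
- move=> y hy; apply: tent_supp; rewrite /oo_set /= => /andP[_ yb].
  by have := lt_trans hy yb; rewrite ltxx.
apply: (@lt_le_trans _ _ (m (oo_set (-1) (\val x + 1)))).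
  by rewrite lt_neqAle measure_ge0 andbT eq_sym; apply/eqP.
have -> : m (oo_set (-1) (\val x + 1)) = \int[m]_y (\1_(oo_set (-1) (\val x + 1)) y)%:E.
  by rewrite integral_indic ?setIT//; exact: measurable_oo_set.
apply: (mf_le (mono_functional_int m)).
- exact: nnm_indic (measurable_oo_set _ _).
- by apply: nnm_continuous; [exact: continuous_tent|exact: tent_ge0].
move=> y; rewrite lee_fin indicE.
case: (boolP (y \in oo_set (-1) (\val x + 1))) => [/set_mem|_]; last exact: tent_ge0.
rewrite /oo_set /= => /andP[y1 yn]; rewrite /tent /= min_l// mul1r le_max le_min.
by apply/orP; right; apply/andP; split; lra.
Qed.

(** The invariance axiom compares real integrals, which vanish by convention when
    the integral is infinite. This is excluded by adding a function [v] of
    positive integral: if the integral of the translate of [u + v] were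
    infinite, that of [u + v] would be zero. *)
Lemma haar_Cc (u : X -> R) (N : R) x : continuous u -> (forall x, (0 <= u x)%R) ->
  (forall x : X, (N < \val x)%R -> u x = 0%R) ->
  \int[m]_y lam (fun t => (u t)%:E) x y = \int[m]_y (u y)%:E.
Proof.
move=> cu u0 uN.
have lamE (v : X -> R) (M : R) : continuous v -> (forall x : X, (M < \val x)%R -> v x = 0%R) ->
    forall y, lam (fun t => (v t)%:E) x y = (\int[K x y]_t v t)%:E.
  move=> cv vM y; have [B _ vB] := continuous_Cc_bounded cv vM.
  by rewrite -Rintegral_conv_EFin//; exists B.
have inv (v : X -> R) (M : R) : continuous v -> (forall x : X, (M < \val x)%R -> v x = 0%R) ->
    fine (\int[m]_y lam (fun t => (v t)%:E) x y) = fine (\int[m]_y (v y)%:E).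
  move=> cv vM; have := haar_Rintegral x cv vM; rewrite /Rintegral => <-.
  congr fine; apply: eq_integral => y _; exact: lamE cv vM y.
suff fin : \int[m]_y lam (fun t => (u t)%:E) x y < +oo.
  have fu := integral_Cc_fin cu u0 uN.
  have nn := nnm_continuous cu u0; have nl := nnm_laml H x nn.
  have := inv u N cu uN => /(congr1 (@EFin R)); rewrite !fineK//.
  - by rewrite ge0_fin_numE// integral_ge0// => y _; rewrite lee_fin.
  - by rewrite ge0_fin_numE// integral_ge0// => y _; exact: nl.2.
have [v [M [cv v0 vM pv]]] := haar_exists_pos.
pose w (x : X) := (u x + v x)%R.
have cw : continuous w.
  move=> z; have cuz : {for z, continuous (u : X -> R^o)} by exact: cu.
  have cvz : {for z, continuous (v : X -> R^o)} by exact: cv.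
  exact: (cvgD cuz cvz).
have wM z : (Num.max N M < \val z)%R -> w z = 0%R.
  by rewrite gt_max => /andP[h1 h2]; rewrite /w uN// vM// addr0.
have w0 z : (0 <= w z)%R by rewrite addr_ge0.
have nw := nnm_continuous cw w0; have nu := nnm_continuous cu u0.
have nv := nnm_continuous cv v0.
apply: (@le_lt_trans _ _ (\int[m]_y lam (fun t => (w t)%:E) x y)).
  apply: (mf_le (mono_functional_int m) (nnm_laml H x nu) (nnm_laml H x nw)) => y.
  apply: (mf_le (mono_functional_lam H x y) nu nw) => z.
  by rewrite lee_fin lerDl.
rewrite ltNge leye_eq; apply/negP => /eqP e.
have := inv w _ cw wM; rewrite e /= => /esym/eqP.
rewrite gt_eqF// fine_gt0// (integral_Cc_fin cw w0 wM) andbT.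
apply: (lt_le_trans pv); apply: (mf_le (mono_functional_int m) nv nw) => z.
by rewrite lee_fin lerDr.
Qed.

(** The invariance extends from continuous functions by
    [mono_functional_unique]. *)
Lemma haar_lam f x : nnm f -> \int[m]_y lam f x y = \int[m]_y f y.
Proof.
move: f; apply: mono_functional_unique.
- apply: mono_functional_comp => [y|f nf]; first exact: mono_functional_lam.
  by have [] := nnm_laml H x nf.
- exact: mono_functional_int.
- move=> u cu u0 [N uN]; rewrite (haar_Cc x cu u0 uN); split => //.
  exact: integral_Cc_fin cu u0 uN.
Qed.

(** If a neighbourhood of [0] were null, so would be, by invariance, a
    neighbourhood of every point, and [m] would be zero. *)
Lemma haar_pos (U : set X) : open U -> U X0 -> 0 < m U.
Proof.
move=> oU U0; rewrite lt_neqAle measure_ge0 andbT eq_sym; apply/eqP => mU0.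
have mU : measurable (U : set bX) by exact: open_measurable_X.
have nU : nnm (fun x : bX => (\1_U x)%:E : \bar R) by exact: nnm_indic mU.
have := haar_nontrivial hm; apply/negP/negPn/eqP.
apply: locally_null => // x _.
pose W : set X := [set w | msupport (K x w) `&` U !=set0].
have oW : open W by have := @hg_supp_meet _ H _ oU; exact: open_section2.
exists W; split => //; first by exists X0; split => //; exact/msupport0.
apply: (integral0_pos_null (nnm_laml H x nU)); first exact: open_measurable_X.
  by rewrite haar_lam// integral_indic// setIT.
by move=> w Ww; rewrite lam_indic//; exact: measure_meets_support oU Ww.
Qed.

End with_haar.
End haar.

(** * Self-adjointness of the translations *)

Section adjoint.
Context {R : realType} (H : @hypergroup R).
Notation X := ('X_R).
Notation bX := (borel X).
Local Notation K := (hg_conv H).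
Local Notation lam := (lam H).
Implicit Types (x y z s t w : X) (f g h k : bX -> \bar R).
Local Open Scope ereal_scope.

(** The kernel [y |-> K x y], with a second variable as a parameter. *)
Definition conv_kernel1 x (p : bX * bX) : {measure set bX -> \bar R} := K x p.1.

Lemma measurable_conv_kernel1 x (A : set bX) : measurable A ->
  measurable_fun setT (fun p => conv_kernel1 x p A).
Proof.
move=> mA; have mK := measurable_conv_kernel H mA.
have mx : measurable_fun setT (fun y : bX => conv_kernel H (x : bX, y) A).
  exact: (measurable_fun_pair2 (x : bX) mK).
exact: (measurableT_comp mx measurable_fst).
Qed.

HB.instance Definition _ x := isKernel.Build _ _ (bX * bX)%type bX R
  (conv_kernel1 x) (measurable_conv_kernel1 x).

Let conv_kernel1_prob x p : conv_kernel1 x p setT = 1.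
Proof. exact: probability_setT. Qed.

HB.instance Definition _ x := Kernel_isProbability.Build _ _ (bX * bX)%type bX R
  (conv_kernel1 x) (conv_kernel1_prob x).

Lemma nnm_triple k x : nnm k -> nnm (fun p : bX * bX => triple H k x p.1 p.2).
Proof.
move=> nk; have [ml l0] := nnm_lam H nk; split => [|p]; last first.
  by apply: integral_ge0 => s _; exact: (l0 (s, p.2)).
pose F (q : (bX * bX) * bX) : \bar R := lam k q.2 q.1.2.
have mF : measurable_fun setT F.
  apply: (measurableT_comp ml (_ : measurable_fun setT (fun q : (bX * bX) * bX => (q.2, q.1.2)))).
  apply: measurable_fun_pair; first exact: measurable_snd.
  exact: (measurableT_comp measurable_snd measurable_fst).
have F0 q : 0 <= F q by exact: (l0 (q.2, q.1.2)).
exact: (measurable_fun_integral_sfinite_kernel F (conv_kernel1 x) F0 mF).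
Qed.

Variables (m : {sigma_finite_measure set bX -> \bar R}) (hm : haar_measure H m).

(** The convolution [h * k], with values in [[0, +oo]]. *)
Definition hconv h k : bX -> \bar R := fun s => \int[m]_t (h t * lam k s t).

Lemma nnm_snd h : nnm h -> nnm (fun p : bX * bX => h p.2).
Proof.
by move=> [mh h0]; split => // ; exact: (measurableT_comp mh measurable_snd).
Qed.

Lemma nnm_fst h : nnm h -> nnm (fun p : bX * bX => h p.1).
Proof.
by move=> [mh h0]; split => // ; exact: (measurableT_comp mh measurable_fst).
Qed.

Lemma nnm_hconv h k : nnm h -> nnm k -> nnm (hconv h k).
Proof.
move=> nh nk; have [mF F0] := nnmM (nnm_snd nh) (nnm_lam H nk).
split => [|s]; last by apply: integral_ge0 => t _; exact: (F0 (s, t)).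
exact: (@measurable_fun_fubini_tonelli_F _ _ _ _ _ m _ mF F0).
Qed.

Lemma lam_hconv h k x y : nnm h -> nnm k ->
  lam (hconv h k) x y = \int[m]_t (h t * triple H k x y t).
Proof.
move=> nh nk; have [mF F0] := nnmM (nnm_snd nh) (nnm_lam H nk).
transitivity (\int[m]_t \int[K x y]_s (h t * lam k s t)).
  exact: (@fubini_tonelli _ _ _ _ _ (K x y) m _ mF F0).
apply: eq_integral => t _; have nl := nnm_lamr H t nk.
by rewrite ge0_integralZl//; [exact: nl.1|move=> s _; exact: nl.2|exact: nh.2].
Qed.

(** Both sides are the integral of [g y * h t] against the triple product
    [k (x * y * t)], which is symmetric in [y] and [t]. *)
Lemma integral_lam_hconvC g h k x : nnm g -> nnm h -> nnm k ->
  \int[m]_y (g y * lam (hconv h k) x y) = \int[m]_t (h t * lam (hconv g k) x t).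
Proof.
move=> ng nh nk; have nt := nnm_triple x nk.
have [mF F0] := nnmM (nnm_fst ng) (nnmM (nnm_snd nh) nt).
transitivity (\int[m]_y \int[m]_t (g y * (h t * triple H k x y t))).
  apply: eq_integral => y _; rewrite lam_hconv// ge0_integralZl//.
  - have nty : nnm (fun t : bX => triple H k x y t).
      split => [|t]; last exact: (nt.2 (y, t)).
      exact: (measurable_fun_pair2 (y : bX) nt.1).
    exact: (nnmM nh nty).1.
  - by move=> t _; rewrite mule_ge0 ?(nh.2 t)// (nt.2 (y, t)).
  - exact: ng.2.
rewrite (@fubini_tonelli _ _ _ _ _ m m _ mF F0).
apply: eq_integral => t _; rewrite lam_hconv//.
have nty : nnm (fun y : bX => triple H k x t y).
  split => [|y]; last exact: (nt.2 (t, y)).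
  exact: (measurable_fun_pair2 (t : bX) nt.1).
rewrite -ge0_integralZl//.
- by apply: eq_integral => y _; rewrite muleCA tripleC.
- exact: (nnmM ng nty).1.
- by move=> y _; rewrite mule_ge0 ?(ng.2 y)// (nt.2 (t, y)).
- exact: nh.2.
Qed.

(** The functions [bump n] are an approximate identity for the convolution. *)
Definition bump_set (n : nat) : set X := [set x | (\val x < n.+1%:R^-1)%R].

Lemma measurable_bump_set n : measurable (bump_set n : set bX).
Proof. by apply: open_measurable_X; exact: open_val_lt. Qed.

Definition bump (n : nat) (x : X) : R :=
  ((fine (m (bump_set n)))^-1 * \1_(bump_set n) x)%R.

Lemma bump_set_fin n : 0 < m (bump_set n) < +oo.
Proof.
apply/andP; split.
  apply: (haar_pos hm); first exact: open_val_lt.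
  by rewrite /bump_set /= invr_gt0.
have mn := haar_radon hm (@compact_le R (n.+1%:R^-1)%R); apply: le_lt_trans mn.
apply: le_measure; rewrite ?inE; [exact: measurable_bump_set|exact: measurable_le|].
by move=> x /ltW.
Qed.

Lemma nnm_bump n : nnm (fun x : bX => (bump n x)%:E).
Proof.
split => [|x]; last by rewrite lee_fin mulr_ge0// invr_ge0 fine_ge0.
apply/measurable_EFinP; apply: measurable_funM => //.
exact: measurable_indic (measurable_bump_set n).
Qed.

Lemma integral_bump n : \int[m]_x (bump n x)%:E = 1.
Proof.
have /andP[p f] := bump_set_fin n.
rewrite (eq_integral (fun x : bX => ((fine (m (bump_set n)))^-1)%:E * (\1_(bump_set n) x)%:E)).
  rewrite ge0_integralZl//.
  - rewrite integral_indic//; last exact: measurable_bump_set.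
    have fin : m (bump_set n) \is a fin_num by rewrite ge0_fin_numE.
    rewrite setIT -[X in _ * X](fineK fin) -EFinM mulVf// gt_eqF// fine_gt0//.
    by rewrite p.
  - by apply/measurable_EFinP; exact: measurable_indic (measurable_bump_set n).
  - by rewrite lee_fin invr_ge0 fine_ge0.
by move=> x _; rewrite EFinM.
Qed.

(** The supports of [s * z] shrink to [{s}] as [z] tends to [0], and by
    [msupport_swap] the translate of [bump n] by [s] charges [t] only if [t] is in
    the support of some [s * z] with [z] small. *)
Lemma lam_bump_near s (V : set X) : open V -> V s ->
  exists N, forall n t, (N <= n)%N -> ~ V t -> lam (fun x => (bump n x)%:E) s t = 0.
Proof.
move=> oV Vs.
have suppV : msupport (K s X0) `<=` V.
  move=> t ht; apply: contrapT => nVt.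
  have [d [od dt ds]] : exists d : set X, [/\ open d, d t & ~ d s].
    have : \val t != \val s :> R.
      by apply/eqP => /val_inj ts; apply: nVt; rewrite ts.
    rewrite neq_lt => /orP[ts|st].
      by exists [set x | (\val x < \val s)%R]; split => //=; [exact: open_val_lt|rewrite ltxx].
    by exists [set x | (\val s < \val x)%R]; split => //=; [exact: open_val_gt|rewrite ltxx].
  have hp : 0 < K s X0 d by exact: ht.
  have e0 : K s X0 d = 0.
    by rewrite (hg_convx0 H s (open_measurable_X od)) diracE memNset.
  by move: hp; rewrite e0 ltxx.
have oS : open [set z | msupport (K s z) `<=` V].
  by have := @hg_supp_sub _ H _ oV; exact: open_section2.
have [N hN] := open_X0 oS suppV.
exists N => n t Nn nVt; have mB := measurable_bump_set n.
rewrite /lam (eq_integral (fun x : bX => ((fine (m (bump_set n)))^-1)%:E * (\1_(bump_set n) x)%:E)); last first.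
  by move=> x _; rewrite EFinM.
rewrite ge0_integralZl//; last 2 first.
- by apply/measurable_EFinP; exact: measurable_indic mB.
- by rewrite lee_fin invr_ge0 fine_ge0.
rewrite integral_indic// setIT -[RHS](mule0 ((fine (m (bump_set n)))^-1)%:E).
congr (_ * _); apply: measure_off_support => //; rewrite -subset0 => z [/= zn zst].
apply: nVt; apply: hN (msupport_swap zst); rewrite (le_trans (ltW zn))//.
by rewrite lef_pV2 ?posrE// ler_nat.
Qed.

Lemma integral_lam_bump n s : \int[m]_t lam (fun x => (bump n x)%:E) s t = 1.
Proof. by rewrite haar_lam//; [exact: integral_bump|exact: nnm_bump]. Qed.

Section approximate_identity.
Variables (h : X -> R) (B : R).
Hypotheses (ch : continuous h) (h0 : forall x, (0 <= h x)%R) (hB : forall x, (h x <= B)%R).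

Let nh : nnm (fun x : bX => (h x)%:E).
Proof. exact: nnm_continuous. Qed.

Let B0 : (0 <= B)%R.
Proof. exact: le_trans (h0 X0) (hB X0). Qed.

Let hb n := hconv (fun x => (h x)%:E) (fun x => (bump n x)%:E).

Let nhb n : nnm (hb n).
Proof. exact: nnm_hconv nh (nnm_bump n). Qed.

Lemma hconv_bump_le n s : hb n s <= B%:E.
Proof.
have nl := nnm_laml H s (nnm_bump n).
apply: (@le_trans _ _ (\int[m]_t (B%:E * lam (fun x => (bump n x)%:E) s t))).
  apply: (mf_le (mono_functional_int m)).
  - exact: nnmM nh nl.
  - exact: nnmZ.
  - by move=> t; rewrite lee_wpmul2r ?lee_fin//; exact: nl.2.
rewrite ge0_integralZl//; [|exact: nl.1|by move=> t _; exact: nl.2].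
by rewrite integral_lam_bump mule1.
Qed.

(** Near [s] the function [h] is between [h s - e] and [h s + e], and far from [s]
    the weight [lam (bump n) s] vanishes. *)
Lemma cvg_hconv_bump s : (fun n => hb n s) @ \oo --> (h s)%:E.
Proof.
have fin n : hb n s \is a fin_num.
  by rewrite ge0_fin_numE ?(nhb n).2// (le_lt_trans (hconv_bump_le n s))// ltry.
apply/fine_cvgP; split; first exact: nearW.
apply/cvgrPdist_le => e e0.
pose V : set X := [set t | (`|h t - h s| < e)%R].
have oV : open V.
  have cd : continuous (fun t => `|h t - h s|%R).
    move=> t; apply: (@continuous_comp _ _ _ (fun t => (h t - h s)%R) (fun r : R => `|r|%R)).
      have cht : {for t, continuous (h : X -> R^o)} by exact: ch.
      exact: (cvgB cht (cvg_cst _)).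
    exact: norm_continuous.
  exact: ((continuousP _).1 cd _ (@open_lt R e)).
have Vs : V s by rewrite /V /= subrr normr0.
have [N hN] := lam_bump_near oV Vs; exists N => // n /= Nn.
have nl := nnm_laml H s (nnm_bump n).
have key (u v : X -> R) : continuous u -> continuous v ->
    (forall x, (0 <= u x)%R) -> (forall x, (0 <= v x)%R) ->
    (forall t, V t -> (u t <= v t)%R) ->
    \int[m]_t ((u t)%:E * lam (fun x => (bump n x)%:E) s t) <=
    \int[m]_t ((v t)%:E * lam (fun x => (bump n x)%:E) s t).
  move=> cu cv u0 v0 uv; apply: (mf_le (mono_functional_int m)).
  - exact: nnmM (nnm_continuous cu u0) nl.
  - exact: nnmM (nnm_continuous cv v0) nl.
  - move=> t; have [Vt|nVt] := pselect (V t); last by rewrite hN// !mule0.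
    by rewrite lee_wpmul2r ?lee_fin ?uv//; exact: nl.2.
have cst (c : R) : (0 <= c)%R ->
    \int[m]_t (c%:E * lam (fun x => (bump n x)%:E) s t) = c%:E.
  move=> c0; rewrite ge0_integralZl//; [|exact: nl.1|by move=> t _; exact: nl.2].
  by rewrite integral_lam_bump mule1.
have cc (c : R) : continuous (fun _ : X => c) by exact: cst_continuous.
have up : hb n s <= (h s + e)%:E.
  rewrite -(cst (h s + e)%R); last by rewrite addr_ge0// ltW.
  apply: key => // [t|t]; first by rewrite addr_ge0// ltW.
  by rewrite /V /= ltr_distl => /andP[_ /ltW].
have lo : (h s)%:E <= hb n s + e%:E.
  rewrite -(cst e (ltW e0)) -ge0_integralD//; last 4 first.
  - by move=> t _; exact: (nnmM nh nl).2.
  - exact: (nnmM nh nl).1.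
  - by move=> t _; exact: (nnmZ (ltW e0) nl).2.
  - exact: (nnmZ (ltW e0) nl).1.
  rewrite -{1}(cst (h s))//.
  rewrite [leRHS](eq_integral (fun t : bX => ((h t + e)%R)%:E * lam (fun x => (bump n x)%:E) s t)); last first.
    by move=> t _; rewrite EFinD ge0_muleDl ?lee_fin// ltW.
  apply: key => //.
  - move=> t; have cht : {for t, continuous (h : X -> R^o)} by exact: ch.
    exact: (cvgD cht (cvg_cst _)).
  - by move=> t; rewrite addr_ge0// ltW.
  - by move=> t; rewrite /V /= ltr_distl ltrBlDr => /andP[/ltW].
rewrite ler_distl; apply/andP; split.
  by rewrite lerBlDr -lee_fin fineK.
by rewrite -lee_fin EFinD fineK.
Qed.

Lemma cvg_lam_hconv_bump x y :
  (fun n => lam (hb n) x y) @ \oo --> lam (fun x => (h x)%:E) x y.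
Proof.
apply: (@dominated_cvg _ _ _ (K x y) setT measurableT _ _ (cst B%:E)) => //.
- by move=> n; have [] := nhb n.
- by move=> t _; exact: cvg_hconv_bump.
- apply: measurable_bounded_integrable => //; first by rewrite [X in X < _]probability_setT ltry.
  exists `|B|%R; split; first by rewrite num_real.
  by move=> r Br t _ /=; exact: ltW.
- move=> n t _; rewrite gee0_abs ?(nhb n).2//; exact: hconv_bump_le.
Qed.

Lemma lam_le_bound x y : lam (fun x => (h x)%:E) x y <= B%:E.
Proof.
rewrite -(lam_cst H x y B0); apply: (mf_le (mono_functional_lam H x y)) => //.
Qed.

Lemma lam_hconv_bump_le n x y : lam (hb n) x y <= B%:E.
Proof.
rewrite -(lam_cst H x y B0); apply: (mf_le (mono_functional_lam H x y)) => //.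
exact: hconv_bump_le.
Qed.

Lemma cvg_integral_lam_hconv_bump (g : X -> R) x :
  m.-integrable setT (fun y : bX => (g y)%:E) -> (forall y, (0 <= g y)%R) ->
  (fun n => \int[m]_y ((g y)%:E * lam (hb n) x y)) @ \oo -->
  \int[m]_y ((g y)%:E * lam (fun x => (h x)%:E) x y).
Proof.
move=> ig g0; have mg : measurable_fun setT (fun y : bX => (g y)%:E).
  by have /integrableP[] := ig.
apply: (@dominated_cvg _ _ _ m setT measurableT _ _ (fun y => B%:E * (g y)%:E)) => //.
- by move=> n; apply: emeasurable_funM => //; have [] := nnm_laml H x (nhb n).
- by move=> y _; apply: cvgeZl => //; exact: cvg_lam_hconv_bump.
- exact: integrableZl.
- move=> n y _; rewrite gee0_abs; last first.
    by rewrite mule_ge0 ?lee_fin//; exact: (nnm_laml H x (nhb n)).2.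
  by rewrite muleC lee_wpmul2r ?lee_fin//; exact: lam_hconv_bump_le.
Qed.

End approximate_identity.

Lemma integrable_Cc (u : X -> R) (N : R) : continuous u -> (forall x, (0 <= u x)%R) ->
  (forall x : X, (N < \val x)%R -> u x = 0%R) -> m.-integrable setT (fun x : bX => (u x)%:E).
Proof.
move=> cu u0 uN; have [mu nu] := nnm_continuous cu u0.
apply/integrableP; split => //.
under eq_integral do rewrite gee0_abs ?lee_fin//.
exact: (integral_Cc_fin hm cu u0 uN).
Qed.

(** [integral_lam_hconvC] with [k] running through the approximate identity. *)
Lemma adjoint_Cc (g h : X -> R) (M N : R) x :
  continuous g -> (forall x, (0 <= g x)%R) -> (forall x : X, (M < \val x)%R -> g x = 0%R) ->
  continuous h -> (forall x, (0 <= h x)%R) -> (forall x : X, (N < \val x)%R -> h x = 0%R) ->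
  \int[m]_y ((g y)%:E * lam (fun x => (h x)%:E) x y) =
  \int[m]_y ((h y)%:E * lam (fun x => (g x)%:E) x y).
Proof.
move=> cg g0 gM ch h0 hN.
have [A _ gA] := continuous_Cc_bounded cg gM; have [B _ hB] := continuous_Cc_bounded ch hN.
have gA' z : (g z <= A)%R by rewrite (le_trans (ler_norm _)).
have hB' z : (h z <= B)%R by rewrite (le_trans (ler_norm _)).
have c1 := cvg_integral_lam_hconv_bump (x := x) ch h0 hB' (integrable_Cc cg g0 gM) g0.
have c2 := cvg_integral_lam_hconv_bump (x := x) cg g0 gA' (integrable_Cc ch h0 hN) h0.
have e n : \int[m]_y ((g y)%:E *
      lam (hconv (fun x => (h x)%:E) (fun x => (bump n x)%:E)) x y) =
    \int[m]_y ((h y)%:E *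
      lam (hconv (fun x => (g x)%:E) (fun x => (bump n x)%:E)) x y).
  apply: integral_lam_hconvC; [exact: nnm_continuous|exact: nnm_continuous|].
  exact: nnm_bump.
have ee := funext e.
rewrite ee in c1; exact: (cvg_unique (@ereal_hausdorff R) c1 c2).
Qed.

Lemma mono_functional_eval x : mono_functional (fun f : bX -> \bar R => f x).
Proof.
split => //.
- by move=> f [_ f0].
Qed.

Lemma adjoint_Cc_nnm (g : X -> R) (M : R) x h :
  continuous g -> (forall x, (0 <= g x)%R) -> (forall x : X, (M < \val x)%R -> g x = 0%R) ->
  nnm h ->
  \int[m]_y ((g y)%:E * lam h x y) =
  \int[m]_y (lam (fun x => (g x)%:E) x y * h y).
Proof.
move=> cg g0 gM; move: h; have ng := nnm_continuous cg g0.
apply: mono_functional_unique.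
- apply: mono_functional_weight => // [s|f nf]; first exact: mono_functional_lam.
  by have [] := nnm_laml H x nf.
- apply: mono_functional_weight => // [|s|f []//]; first exact: nnm_laml.
  exact: mono_functional_eval.
- move=> h ch h0 [N hN]; split.
    by rewrite (adjoint_Cc x cg g0 gM ch h0 hN); under eq_integral do rewrite muleC.
  have [B B0 hB] := continuous_Cc_bounded ch hN.
  apply: (@le_lt_trans _ _ (\int[m]_y (B%:E * (g y)%:E))).
    apply: (mf_le (mono_functional_int m)).
    - exact: nnmM ng (nnm_laml H x (nnm_continuous ch h0)).
    - exact: nnmZ.
    - move=> y; rewrite muleC lee_wpmul2r ?lee_fin//; apply: lam_le_bound => //.
      by move=> z; rewrite (le_trans (ler_norm _)).
  rewrite ge0_integralZl//; [|exact: ng.1|by move=> y _; exact: ng.2].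
  by apply: lte_mul_pinfty => //; exact: (integral_Cc_fin hm cg g0 gM).
Qed.

(** The identity holds for continuous functions of compact support by
    [adjoint_Cc], and extends to each of the two functions in turn by uniqueness
    of monotone functionals. *)
Theorem haar_adjoint x h g : nnm h -> \int[m]_y h y < +oo -> nnm g ->
  \int[m]_y (lam h x y * g y) = \int[m]_y (h y * lam g x y).
Proof.
move=> nh fh; move: g; apply: mono_functional_unique.
- apply: mono_functional_weight => // [|s|f []//]; first exact: nnm_laml.
  exact: mono_functional_eval.
- apply: mono_functional_weight => // [s|f nf]; first exact: mono_functional_lam.
  by have [] := nnm_laml H x nf.
- move=> g cg g0 [N gN]; split.
    under eq_integral do rewrite muleC.
    rewrite (adjoint_Cc_nnm x cg g0 gN nh).
    by under eq_integral do rewrite muleC.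
  have [B B0 gB] := continuous_Cc_bounded cg gN; have nl := nnm_laml H x nh.
  apply: (@le_lt_trans _ _ (\int[m]_y (B%:E * lam h x y))).
    apply: (mf_le (mono_functional_int m)).
    - exact: nnmM nl (nnm_continuous cg g0).
    - exact: nnmZ.
    - move=> y; rewrite muleC lee_wpmul2r ?lee_fin//; first exact: nl.2.
      by rewrite (le_trans (ler_norm _)).
  rewrite ge0_integralZl//; [|exact: nl.1|by move=> y _; exact: nl.2].
  by rewrite haar_lam// lte_mul_pinfty.
Qed.

End adjoint.

(** * Convolution of integrable functions *)

Section almost_everywhere_implication.
Context {R : realType} d (T : measurableType d) (mu : {measure set T -> \bar R}).
Implicit Types P Q S : set T.

Lemma ae_imply P Q : (forall x, P x -> Q x) ->
  {ae mu, forall x, P x} -> {ae mu, forall x, Q x}.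
Proof. exact: (@filterS _ _ (ae_filter_ringOfSetsType mu)). Qed.

Lemma ae_imply2 P Q S : (forall x, P x -> Q x -> S x) ->
  {ae mu, forall x, P x} -> {ae mu, forall x, Q x} -> {ae mu, forall x, S x}.
Proof. exact: (@filterS2 _ _ (ae_filter_ringOfSetsType mu)). Qed.

End almost_everywhere_implication.

(** A real-valued integral is [0] where the integral diverges; for the inner
    integrals of an integrable function this happens on a null set only. *)
Section real_fubini.
Context {R : realType} d (T : measurableType d) d' (S : measurableType d').

Lemma ae_EFin_fine (mu : {measure set T -> \bar R}) (f : T -> \bar R) :
  mu.-integrable setT f -> ae_eq mu setT (fun x => (fine (f x))%:E) f.
Proof.
move=> /(integrable_ae measurableT); apply: filterS => x h _.
by rewrite fineK// h.
Qed.

Lemma measurable_fine_comp (f : T -> \bar R) : measurable_fun setT f ->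
  measurable_fun setT (fun x => fine (f x)).
Proof. by move=> mf; apply: (measurableT_comp _ mf); exact: fine_measurable. Qed.

Lemma integrable_fine (mu : {measure set T -> \bar R}) (f : T -> \bar R) :
  mu.-integrable setT f -> mu.-integrable setT (fun x => (fine (f x))%:E).
Proof.
move=> fi; have /integrableP[mf _] := fi.
apply: (le_integrable measurableT _ _ fi).
  by apply/measurable_EFinP; exact: measurable_fine_comp.
by move=> x _; case: (f x) => [r| |] //=; rewrite normr0 leey.
Qed.

Variables (m1 : {sigma_finite_measure set T -> \bar R}).
Variables (m2 : {sigma_finite_measure set S -> \bar R}).

Lemma integrable_Rintegral (F : T * S -> R) :
  (m1 \x m2)%E.-integrable setT (fun p => (F p)%:E) ->
  m1.-integrable setT (fun x => (\int[m2]_y F (x, y))%:E).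
Proof. by move=> /integrable_fubini_F; exact: integrable_fine. Qed.

Lemma Rintegral_fine (mu : {measure set T -> \bar R}) (f : T -> \bar R) :
  mu.-integrable setT f -> \int[mu]_x fine (f x) = fine (\int[mu]_x f x)%E.
Proof.
move=> fi; congr fine; have /integrableP[mf _] := fi.
apply: ae_eq_integral => //; last exact: ae_EFin_fine.
by apply/measurable_EFinP; exact: measurable_fine_comp.
Qed.

End real_fubini.

Section real_fubini2.
Context {R : realType} d (T : measurableType d) d' (S : measurableType d').
Variables (m1 : {sigma_finite_measure set T -> \bar R}).
Variables (m2 : {sigma_finite_measure set S -> \bar R}).

Lemma integrable_fubini_G (f : T * S -> \bar R) :
  (m1 \x m2)%E.-integrable setT f -> m2.-integrable setT (fubini_G m1 f).
Proof.
move=> fi; have /integrableP[mf _] := fi.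
have maf : measurable_fun setT (fun p => `|f p|%E) by exact: measurableT_comp.
apply/integrableP; split; first exact: (@measurable_fubini_G _ _ _ _ _ m1 m2 _ fi).
apply: le_lt_trans ((integrable21ltyP m1 m2 mf).1 fi).
apply: ge0_le_integral => //.
- by apply: measurableT_comp => //; exact: (@measurable_fubini_G _ _ _ _ _ m1 m2 _ fi).
- apply: (@measurable_fun_fubini_tonelli_G _ _ _ _ _ m1 _ maf) => p.
  exact: abse_ge0.
- move=> y _; apply: le_abse_integral => //.
  exact: (measurable_fun_pair1 y mf).
Qed.

Lemma RFubini (F : T * S -> R) :
  (m1 \x m2)%E.-integrable setT (fun p => (F p)%:E) ->
  \int[m1]_x \int[m2]_y F (x, y) = \int[m2]_y \int[m1]_x F (x, y).
Proof.
move=> iF; rewrite (Rintegral_fine (integrable_fubini_F iF)).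
rewrite (Rintegral_fine (integrable_fubini_G iF)).
by congr fine; exact: (Fubini iF).
Qed.

End real_fubini2.

Section real_convolution.
Context {R : realType} (H : @hypergroup R).
Notation X := ('X_R).
Notation bX := (borel X).
Local Notation K := (hg_conv H).
Local Notation lam := (lam H).
Implicit Types (x y z s t : X) (u v w p : X -> R).

(** The real counterpart of [lam]: the real part of [translate] when [w] is the
    real part of a complex function. *)
Definition rlam w x y : R := \int[K x y]_t w t.

Local Notation Ew w := (fun x : bX => (w x)%:E : \bar R).
Local Notation Aw w := (fun x : bX => (`|w x|)%:E : \bar R).

Lemma nnm_abs w : measurable_fun setT (w : bX -> R) -> nnm (Aw w).
Proof.
move=> mw; split => [|x]; last by rewrite lee_fin.
by apply/measurable_EFinP; exact: measurableT_comp.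
Qed.

Lemma measurable_rlam w : measurable_fun setT (w : bX -> R) ->
  measurable_fun setT (fun q : bX * bX => rlam w q.1 q.2).
Proof.
move=> mw.
have mE : measurable_fun setT (Ew w) by apply/measurable_EFinP.
have np : nnm (fun x : bX => (Ew w)^\+%E x).
  by split => [|x]; [exact: measurable_funepos|exact: funepos_ge0].
have nn : nnm (fun x : bX => (Ew w)^\-%E x).
  by split => [|x]; [exact: measurable_funeneg|exact: funeneg_ge0].
rewrite (_ : (fun q => _) = (fun q : bX * bX => fine (lam (Ew w)^\+%E q.1 q.2 - lam (Ew w)^\-%E q.1 q.2)%E)).
  apply: measurable_fine_comp; apply: emeasurable_funB.
    by have [] := nnm_lam H np.
  by have [] := nnm_lam H nn.
by apply/funext => q; rewrite /rlam /Rintegral integralE.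
Qed.

Lemma abs_rlam_le w x y : measurable_fun setT (w : bX -> R) ->
  ((`|rlam w x y|)%:E <= lam (Aw w) x y)%E.
Proof.
move=> mw; have nA := nnm_abs mw.
have [lf|lf] := eqVneq (lam (Aw w) x y) +oo%E; first by rewrite lf leey.
have iw : (K x y).-integrable setT (Ew w).
  apply/integrableP; split; first exact/measurable_EFinP.
  by rewrite lt_neqAle leey andbT.
have /integrableP[mE _] := iw.
have h := le_abse_integral (K x y) measurableT mE.
by rewrite /rlam /Rintegral -abse_EFin fineK ?integrable_fin_num.
Qed.

Lemma rlamC w x y : measurable_fun setT (w : bX -> R) -> rlam w x y = rlam w y x.
Proof.
move=> mw; congr fine; apply: eq_measure_integral => A mA _.
exact: hg_conv_comm.
Qed.

Variables (m : {sigma_finite_measure set bX -> \bar R}) (hm : haar_measure H m).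

(** The real counterpart of [fconv]. *)
Definition rconv u w x : R := \int[m]_y (u y * rlam w x y).

Local Notation int1 u := (m.-integrable setT (Ew u)).

Lemma int1_measurable u : int1 u -> measurable_fun setT (u : bX -> R).
Proof. by move=> /integrableP[/measurable_EFinP]. Qed.

Lemma int1_abs u : int1 u -> (\int[m]_x (`|u x|)%:E < +oo)%E.
Proof. by move=> /integrableP[]. Qed.

(** By the theorem of Tonelli and the invariance of the Haar measure; hence the
    convolution of integrable functions converges absolutely almost
    everywhere. *)
Lemma integral_abs_conv u w : int1 u -> int1 w ->
  (\int[m]_x \int[m]_y ((`|u y|)%:E * lam (Aw w) x y) =
   \int[m]_x (`|u x|)%:E * \int[m]_x (`|w x|)%:E)%E.
Proof.
move=> iu iw; have nu := nnm_abs (int1_measurable iu).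
have nw := nnm_abs (int1_measurable iw).
have [mF F0] := nnmM (nnm_snd nu) (nnm_lam H nw).
rewrite (@fubini_tonelli _ _ _ _ _ m m _ mF F0).
rewrite (eq_integral (fun y : bX => (\int[m]_x (`|w x|)%:E * (`|u y|)%:E)%E)); last first.
  move=> y _ /=; have nl := nnm_lamr H y nw.
  rewrite ge0_integralZl//; [|exact: nl.1|by move=> x _; exact: nl.2].
  rewrite muleC; congr (_ * _)%E.
  rewrite -(haar_lam hm y nw); apply: eq_integral => x _; exact: lamC.
rewrite ge0_integralZl//; [exact: muleC|exact: nu.1|].
by apply: integral_ge0.
Qed.

Definition conv_integrand u w (q : bX * bX) : R := u q.2 * rlam w q.1 q.2.

Lemma measurable_conv_integrand u w : measurable_fun setT (u : bX -> R) ->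
  measurable_fun setT (w : bX -> R) -> measurable_fun setT (conv_integrand u w).
Proof.
move=> mu mw; apply: measurable_funM; last exact: measurable_rlam.
exact: (measurableT_comp mu measurable_snd).
Qed.

Lemma integral_abs_conv_integrand u w : int1 u -> int1 w ->
  (\int[m]_x \int[m]_y `|(conv_integrand u w (x, y))%:E| <=
   \int[m]_x (`|u x|)%:E * \int[m]_x (`|w x|)%:E)%E.
Proof.
move=> iu iw; have mu := int1_measurable iu; have mw := int1_measurable iw.
have nu := nnm_abs mu; have nw := nnm_abs mw.
have nF := nnmM (nnm_snd nu) (nnm_lam H nw).
have nG : nnm (fun q : bX * bX => `|(conv_integrand u w q)%:E|%E).
  split => [|q]; last by rewrite abse_ge0.
  by apply: measurableT_comp => //; apply/measurable_EFinP; exact: measurable_conv_integrand.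
rewrite -integral_abs_conv//.
have section (F : bX * bX -> \bar R) x : nnm F -> nnm (fun y : bX => F (x, y)).
  move=> [mF F0]; split => [|y]; last exact: F0.
  exact: (measurable_fun_pair2 (x : bX) mF).
have fub (F : bX * bX -> \bar R) : nnm F -> nnm (fun x : bX => \int[m]_y F (x, y))%E.
  move=> [mF F0]; split => [|x]; last by apply: integral_ge0.
  exact: (@measurable_fun_fubini_tonelli_F _ _ _ _ _ m _ mF F0).
apply: (mf_le (mono_functional_int m) (fub _ nG) (fub _ nF)) => x.
apply: (mf_le (mono_functional_int m) (section _ x nG) (section _ x nF)) => y /=.
rewrite /conv_integrand /= normrM EFinM lee_wpmul2l//.
exact: abs_rlam_le.
Qed.

Lemma integrable_conv_integrand u w : int1 u -> int1 w ->
  (m \x m)%E.-integrable setT (fun q => (conv_integrand u w q)%:E).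
Proof.
move=> iu iw; have mu := int1_measurable iu; have mw := int1_measurable iw.
apply/integrable12ltyP; first by apply/measurable_EFinP; exact: measurable_conv_integrand.
apply: le_lt_trans (integral_abs_conv_integrand iu iw) _.
by apply: lte_mul_pinfty; [exact: integral_ge0|rewrite ge0_fin_numE ?integral_ge0// int1_abs|exact: int1_abs].
Qed.

Lemma integrable_rconv u w : int1 u -> int1 w -> int1 (rconv u w).
Proof. by move=> iu iw; exact: (integrable_Rintegral (integrable_conv_integrand iu iw)). Qed.

Lemma ae_integrable_conv u w : int1 u -> int1 w ->
  {ae m, forall x, m.-integrable setT (fun y : bX => (u y * rlam w x y)%:E)}.
Proof. by move=> iu iw; exact: (ae_integrable1 (integrable_conv_integrand iu iw)). Qed.

Lemma int1_bounded_mul u p (B : R) : int1 u -> measurable_fun setT (p : bX -> R) ->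
  (forall x, `|p x| <= B) -> int1 (fun x => u x * p x).
Proof.
move=> iu mp pB; have mu := int1_measurable iu.
apply: (le_integrable measurableT _ _ (integrableZl measurableT B iu)).
  by apply/measurable_EFinP; exact: measurable_funM.
move=> x _ /=; rewrite lee_fin !normrM mulrC ler_wpM2r//.
by rewrite (le_trans (pB x))// ler_norm.
Qed.

Lemma ae_eq_Rintegral u v : measurable_fun setT (u : bX -> R) ->
  measurable_fun setT (v : bX -> R) -> {ae m, forall x, u x = v x} ->
  \int[m]_x u x = \int[m]_x v x.
Proof.
move=> mu mv uv; congr fine; apply: ae_eq_integral => //; try exact/measurable_EFinP.
by apply: (ae_imply _ uv) => x -> _.
Qed.

Lemma measurable_rlaml w y : measurable_fun setT (w : bX -> R) ->
  measurable_fun setT ((fun x => rlam w x y) : bX -> R).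
Proof. by move=> /measurable_rlam; exact: measurable_fun_pair1. Qed.

Lemma int1_rlam w y : int1 w -> int1 (fun x => rlam w x y).
Proof.
move=> iw; have mw := int1_measurable iw; have nA := nnm_abs mw.
apply/integrableP; split; first by apply/measurable_EFinP; exact: measurable_rlaml.
apply: le_lt_trans (int1_abs iw); rewrite -(haar_lam hm y nA).
rewrite [leRHS](eq_integral (fun x : bX => lam (Aw w) x y)); last first.
  by move=> x _; exact: lamC.
apply: ge0_le_integral => //.
- apply: measurableT_comp => //; apply/measurable_EFinP; exact: measurable_rlaml.
- by have [] := nnm_lamr H y nA.
- by move=> x _; exact: abs_rlam_le.
Qed.

(** For a fixed [y] the translate of [|w|] has the finite integral of [|w|], hence
    is finite almost everywhere. *)
Lemma int1_ae_lam w y : int1 w ->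
  {ae m, forall x, (K x y).-integrable setT (Ew w)}.
Proof.
move=> iw; have mw := int1_measurable iw; have nA := nnm_abs mw.
have nl := nnm_lamr H y nA.
have : m.-integrable setT (fun x : bX => lam (Aw w) x y).
  apply/integrableP; split; first exact: nl.1.
  rewrite (eq_integral (fun x : bX => lam (Aw w) y x)); last first.
    by move=> x _; rewrite gee0_abs ?nl.2//; exact: lamC.
  by rewrite haar_lam//; exact: int1_abs.
move=> /(integrable_ae measurableT); apply: filterS => x /(_ Logic.I) h.
apply/integrableP; split; first exact/measurable_EFinP.
by move: h; rewrite ge0_fin_numE// nl.2.
Qed.

Let Radjoint_pos w p (B : R) y : int1 w -> (forall x, 0 <= w x) -> continuous p ->
  (forall x, 0 <= p x) -> (forall x, p x <= B) ->
  \int[m]_x (rlam w x y * p x) = \int[m]_x (w x * rlam p x y).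
Proof.
move=> iw w0 cp p0 pB; have mw := int1_measurable iw.
have mp : measurable_fun setT (p : bX -> R) by exact: measurable_continuous_X.
have nw : nnm (Ew w) by split => [|x]; [exact/measurable_EFinP|rewrite lee_fin].
have np : nnm (Ew p) by split => [|x]; [exact/measurable_EFinP|rewrite lee_fin].
have fw : (\int[m]_x (w x)%:E < +oo)%E.
  apply: le_lt_trans (int1_abs iw); apply: (mf_le (mono_functional_int m) nw (nnm_abs mw)).
  by move=> x; rewrite lee_fin ler_norm.
have adj := haar_adjoint hm y nw fw np.
congr fine; transitivity (\int[m]_x (lam (Ew w) y x * (p x)%:E))%E; last first.
  rewrite adj; apply: eq_integral => x _; rewrite EFinM; congr (_ * _)%E.
  rewrite rlamC// /rlam -Rintegral_conv_EFin//.
  by exists B => t; rewrite ger0_norm.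
apply: ae_eq_integral => //.
- apply/measurable_EFinP; apply: measurable_funM => //; exact: measurable_rlaml.
- by apply: emeasurable_funM; [exact: (nnm_laml H y nw).1|exact: np.1].
apply: (ae_imply _ (int1_ae_lam y iw)) => x h _.
rewrite EFinM; congr (_ * _)%E; rewrite (lamC H y x nw).
by rewrite /rlam /Rintegral fineK//; exact: integrable_fin_num.
Qed.

Let pos w x : R := Num.max (w x) 0.
Let neg w x : R := Num.max (- w x) 0.

Let posneg w x : w x = pos w x - neg w x.
Proof.
rewrite /pos /neg; have [w0|w0] := leP (w x) 0.
  by rewrite max_l ?oppr_ge0// opprK add0r.
by rewrite max_r ?subr0// oppr_le0 ltW.
Qed.

Let int1_pos w : int1 w -> int1 (pos w).
Proof.
move=> iw; have mw := int1_measurable iw.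
apply: (le_integrable measurableT _ _ iw).
  by apply/measurable_EFinP; apply: measurable_maxr.
move=> x _; rewrite lee_fin ger0_norm ?le_max ?lexx ?orbT//.
by rewrite /pos ge_max ler_norm normr_ge0.
Qed.

Let int1_neg w : int1 w -> int1 (neg w).
Proof.
move=> iw; have mw := int1_measurable iw.
apply: (le_integrable measurableT _ _ iw).
  by apply/measurable_EFinP; apply: measurable_maxr => //; exact: measurableT_comp.
move=> x _; rewrite lee_fin ger0_norm ?le_max ?lexx ?orbT//.
by rewrite /neg ge_max -normrN ler_norm normr_ge0.
Qed.

Lemma rlam_bounded p (B : R) x y : continuous p -> (forall x, `|p x| <= B) ->
  `|rlam p x y| <= B.
Proof.
move=> cp pB; have mp : measurable_fun setT (p : bX -> R) by exact: measurable_continuous_X.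
rewrite -lee_fin (le_trans (abs_rlam_le _ _ mp))//.
have B0 : 0 <= B by exact: le_trans (pB X0).
rewrite -(lam_cst H x y B0); apply: (mf_le (mono_functional_lam H x y)).
- exact: nnm_abs.
- exact: nnm_cst.
- by move=> t; rewrite lee_fin.
Qed.

Let Radjoint_posp w p (B : R) y : int1 w -> continuous p ->
  (forall x, 0 <= p x) -> (forall x, p x <= B) ->
  \int[m]_x (rlam w x y * p x) = \int[m]_x (w x * rlam p x y).
Proof.
move=> iw cp p0 pB; have mw := int1_measurable iw.
have mp : measurable_fun setT (p : bX -> R) by exact: measurable_continuous_X.
have ip := int1_pos iw; have in_ := int1_neg iw.
have pB' x : `|p x| <= B by rewrite ger0_norm.
have rB x : `|rlam p x y| <= B by exact: rlam_bounded.
have i1 (v : X -> R) : int1 v -> int1 (fun x => rlam v x y * p x).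
  by move=> iv; apply: (@int1_bounded_mul _ p B) => //; exact: int1_rlam.
have i2 (v : X -> R) : int1 v -> int1 (fun x => v x * rlam p x y).
  by move=> iv; apply: (@int1_bounded_mul _ (fun x => rlam p x y) B) => //; exact: measurable_rlaml.
transitivity (\int[m]_x (rlam (pos w) x y * p x - rlam (neg w) x y * p x)).
  apply: ae_eq_Rintegral.
  - exact: int1_measurable (i1 _ iw).
  - by apply: measurable_funB; [exact: int1_measurable (i1 _ ip)|exact: int1_measurable (i1 _ in_)].
  - apply: (ae_imply2 _ (int1_ae_lam y ip) (int1_ae_lam y in_)) => x h1 h2.
    rewrite -mulrBl -RintegralB//; congr (_ * _).
    by apply: eq_Rintegral => t _; rewrite posneg.
rewrite RintegralB//; [|exact: i1|exact: i1].
rewrite (Radjoint_pos y ip _ cp p0 pB); last by move=> x; rewrite le_max lexx orbT.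
rewrite (Radjoint_pos y in_ _ cp p0 pB); last by move=> x; rewrite le_max lexx orbT.
rewrite -RintegralB//; [|exact: i2|exact: i2].
by apply: eq_Rintegral => x _; rewrite -mulrBl -posneg.
Qed.

(** [haar_adjoint] for signed functions: [w] is split into its positive and
    negative parts, and [p] is made nonnegative by adding its bound. *)
Lemma Radjoint w p (B : R) y : int1 w -> continuous p -> (forall x, `|p x| <= B) ->
  \int[m]_x (rlam w x y * p x) = \int[m]_x (w x * rlam p x y).
Proof.
move=> iw cp pB.
have B0 : 0 <= B by exact: le_trans (pB X0).
have hp x : 0 <= p x + B <= 2 * B.
  by have := pB x; rewrite ler_norml => /andP[? ?]; apply/andP; split; lra.
have cq : continuous (fun x => p x + B).
  move=> t; have cpt : {for t, continuous (p : X -> R^o)} by exact: cp.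
  exact: (cvgD cpt (cvg_cst _)).
have cB : continuous (fun _ : X => B) by exact: cst_continuous.
have e1 := @Radjoint_posp w _ (2 * B) y iw cq (fun x => proj1 (andP (hp x))) (fun x => proj2 (andP (hp x))).
have e2 := @Radjoint_posp w _ B y iw cB (fun=> B0) (fun=> lexx B).
have mp : measurable_fun setT (p : bX -> R) by exact: measurable_continuous_X.
have intK (q : X -> R) x : continuous q -> (exists A, forall z, `|q z| <= A) ->
    (K x y).-integrable setT (Ew q).
  move=> cq' [A qA]; apply: measurable_bounded_integrable => //.
  - by rewrite [X in (X < _)%E]probability_setT ltry.
  - exact: measurable_continuous_X.
  - exists A; split; first by rewrite num_real.
    by move=> r Ar t _ /=; apply: (le_trans (qA t)); exact: ltW.
have bq : exists A, forall z, `|p z| <= A by exists B.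
have bB : exists A, forall z : X, `|B| <= A by exists `|B|.
have rq x : rlam (fun x => p x + B) x y = rlam p x y + rlam (fun=> B) x y.
  by rewrite /rlam RintegralD//; exact: intK.
have i1 : int1 (fun x => rlam w x y * p x).
  by apply: (@int1_bounded_mul _ p B) => //; exact: int1_rlam.
have i2 : int1 (fun x => rlam w x y * B).
  apply: (@int1_bounded_mul _ (fun=> B) B) => //; first exact: int1_rlam.
  by move=> x; rewrite ger0_norm.
have i3 : int1 (fun x => w x * rlam p x y).
  apply: (@int1_bounded_mul _ (fun x => rlam p x y) B) => //.
    exact: measurable_rlaml.
  by move=> x; exact: rlam_bounded.
have i4 : int1 (fun x => w x * rlam (fun=> B) x y).
  apply: (@int1_bounded_mul _ (fun x => rlam (fun=> B) x y) B) => //.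
    exact: measurable_rlaml.
  by move=> x; apply: rlam_bounded => // z; rewrite ger0_norm.
move: e1; under eq_Rintegral do rewrite mulrDr.
rewrite RintegralD//.
under [X in _ = X -> _]eq_Rintegral do rewrite rq mulrDr.
by rewrite RintegralD// e2 => /addIr.
Qed.

(** Integrating first in [x], the left-hand side is the integral of
    [u y * rlam w x y * p x]; by self-adjointness the translation moves from [w]
    to [p], where it factorizes. *)
Theorem Rintegral_rconv u w p (B : R) : int1 u -> int1 w -> continuous p ->
  (forall x, `|p x| <= B) -> (forall x y, rlam p x y = p x * p y) ->
  \int[m]_x (rconv u w x * p x) =
  (\int[m]_x (u x * p x)) * (\int[m]_x (w x * p x)).
Proof.
move=> iu iw cp pB pM.
have mp : measurable_fun setT (p : bX -> R) by exact: measurable_continuous_X.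
have iF := integrable_conv_integrand iu iw.
pose G (q : bX * bX) : R := conv_integrand u w q * p q.1.
have mG : measurable_fun setT G.
  apply: measurable_funM.
    by have /integrableP[/measurable_EFinP] := iF.
  exact: (measurableT_comp mp measurable_fst).
have iG : (m \x m)%E.-integrable setT (fun q => (G q)%:E).
  apply: (le_integrable measurableT _ _ (integrableZl measurableT B iF)).
    exact/measurable_EFinP.
  move=> q _ /=; rewrite lee_fin /G !normrM mulrC ler_wpM2r//.
  by rewrite (le_trans (pB _))// ler_norm.
transitivity (\int[m]_x \int[m]_y G (x, y)).
  apply: ae_eq_Rintegral.
  - apply: measurable_funM => //; exact: int1_measurable (integrable_rconv iu iw).
  - exact: int1_measurable (integrable_Rintegral iG).
  - apply: (ae_imply _ (ae_integrable_conv iu iw)) => x ix.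
    by rewrite /G /= RintegralZr.
rewrite (RFubini iG).
transitivity (\int[m]_y (u y * p y * \int[m]_x (w x * p x))).
  apply: eq_Rintegral => y _; rewrite /G /conv_integrand /=.
  under eq_Rintegral do rewrite -mulrA.
  rewrite RintegralZl//; last first.
    by apply: (@int1_bounded_mul _ p B) => //; exact: int1_rlam.
  rewrite (Radjoint y iw cp pB) -mulrA; congr (_ * _).
  under eq_Rintegral do rewrite pM mulrA.
  rewrite RintegralZr//; first exact: mulrC.
  exact: (@int1_bounded_mul _ p B).
rewrite RintegralZr//.
exact: (@int1_bounded_mul _ p B).
Qed.

End real_convolution.

Section real_convolution2.
Context {R : realType} (H : @hypergroup R).
Notation X := ('X_R).
Notation bX := (borel X).
Local Notation K := (hg_conv H).
Local Notation lam := (lam H).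
Local Notation rlam := (rlam H).
Implicit Types (x y z s t : X) (u v w p : X -> R).

Local Notation Ew w := (fun x : bX => (w x)%:E : \bar R).
Local Notation Aw w := (fun x : bX => (`|w x|)%:E : \bar R).

(** The supports of [x * y] for [x] and [y] in the compact interval [[0, N]] are
    contained in a common bounded set, by compactness of the square and the
    upper semicontinuity of the supports. *)
Lemma msupport_bounded (N : R) : exists M : nat, forall x y z,
  \val x <= N -> \val y <= N -> msupport (K x y) z -> \val z < M%:R.
Proof.
pose A : set X := [set x : X | \val x <= N].
pose P (n : nat) : set (X * X) :=
  [set q | msupport (K q.1 q.2) `<=` [set z | \val z < n%:R]].
have [M hM] : exists M, A `*` A `<=` P M.
  apply: near_below.
  - by apply: compact_setX; exact: compact_le.
  - by move=> n; apply: (@hg_supp_sub _ H); exact: open_val_lt.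
  - by move=> n k nk q /= h z /h /= zn; rewrite (lt_le_trans zn)// ler_nat.
  - move=> [x y] _.
    have [n hn] : exists n, msupport (K x y) `<=` [set z | \val z < n%:R].
      apply: near_below; first exact: hg_compact.
      + by move=> n; exact: open_val_lt.
      + by move=> n k nk z /= zn; rewrite (lt_le_trans zn)// ler_nat.
      + by move=> z _; exists (Num.truncn (\val z)).+1 => /=; exact: truncnS_gt.
    by exists n.
by exists M => x y z xN yN; exact: (hM (x, y) (conj xN yN)).
Qed.

Variables (m : {sigma_finite_measure set bX -> \bar R}) (hm : haar_measure H m).
Local Notation rconv := (rconv H m).
Local Notation int1 u := (m.-integrable setT (Ew u)).

(** If [w (x * y)] is not zero with [y <= N], the support of [x * y] contains some
    [z <= N], and then [x] is in the support of [y * z] by [msupport_swap]. *)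
Lemma rconv_support (N : R) : exists M : nat, forall u w,
  (forall x, N < \val x -> u x = 0) -> (forall x, N < \val x -> w x = 0) ->
  measurable_fun setT (w : bX -> R) ->
  forall x, M%:R < \val x -> rconv u w x = 0.
Proof.
have [M hM] := msupport_bounded N; exists M => u w u0 w0 mw x Mx.
transitivity (\int[m]_(y in setT) cst (0 : R) y); last by rewrite Rintegral_cst// mul0r.
apply: eq_Rintegral => y _ /=.
have [yN|/u0 ->] := leP (\val y) N; last by rewrite mul0r.
suff -> : rlam w x y = 0 by rewrite mulr0.
rewrite rlamC//.
have mN : measurable ([set z : X | \val z <= N] : set bX) by exact: measurable_le.
have K0 : K y x [set z : X | \val z <= N] = 0%E.
  apply: measure_off_support => //; rewrite -subset0 => z [/= zN].
  move=> /msupport_swap /(hM _ _ _ yN zN) /lt_trans /(_ Mx).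
  by rewrite ltxx.
suff h : (\int[K y x]_t (w t)%:E = 0)%E by rewrite /rlam /Rintegral h.
transitivity (\int[K y x]_(t in setT) (cst 0%E : bX -> \bar R) t)%E; last exact: integral0.
apply: ae_eq_integral => //.
- exact/measurable_EFinP.
- exists [set z : X | \val z <= N]; split=> // z /= h.
  by rewrite leNgt; apply/negP => /w0 wz; apply: h => _ /=; rewrite wz.
Qed.

Lemma integral_abs_rconv_le u w : int1 u -> int1 w ->
  (\int[m]_x (`|rconv u w x|)%:E <=
   \int[m]_x (`|u x|)%:E * \int[m]_x (`|w x|)%:E)%E.
Proof.
move=> iu iw; apply: le_trans (integral_abs_conv_integrand hm iu iw).
have mF : measurable_fun setT (fun q => (conv_integrand H u w q)%:E).
  by have /integrableP[] := integrable_conv_integrand hm iu iw.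
have maf : measurable_fun setT (fun q => `|(conv_integrand H u w q)%:E|%E).
  exact: measurableT_comp.
apply: ge0_le_integral => //.
- apply/measurable_EFinP; apply: measurableT_comp => //.
  exact: int1_measurable (integrable_rconv hm iu iw).
- by apply: (@measurable_fun_fubini_tonelli_F _ _ _ _ _ m _ maf) => p; exact: abse_ge0.
move=> x _; have mFx := measurable_fun_pair2 (x : bX) mF.
have [h|h] := eqVneq (\int[m]_y `|(conv_integrand H u w (x, y))%:E|)%E +oo%E.
  by rewrite h leey.
rewrite -abse_EFin /rconv /Rintegral fineK; first exact: le_abse_integral.
apply: integrable_fin_num => //; apply/integrableP; split; first exact: mFx.
by rewrite lt_neqAle leey andbT.
Qed.

(** The convolution is bilinear only almost everywhere: divergent integrals are
    [0] by convention. *)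
Lemma ae_rconvDl u v w : int1 u -> int1 v -> int1 w ->
  {ae m, forall x, rconv (fun y => u y + v y) w x = rconv u w x + rconv v w x}.
Proof.
move=> iu iv iw; apply: (ae_imply2 _ (ae_integrable_conv hm iu iw)
  (ae_integrable_conv hm iv iw)) => x ux vx.
by rewrite /rconv -RintegralD//; apply: eq_Rintegral => y _; rewrite mulrDl.
Qed.

Lemma ae_rconvDr u v w : int1 u -> int1 v -> int1 w ->
  {ae m, forall x, rconv u (fun y => v y + w y) x = rconv u v x + rconv u w x}.
Proof.
move=> iu iv iw; apply: (ae_imply2 _ (ae_integrable_conv hm iu iv)
  (ae_integrable_conv hm iu iw)) => x vx wx.
have ivw : int1 (fun y => v y + w y) by exact: (integrableD measurableT iv iw).
have mr (f : X -> R) : int1 f -> measurable_fun setT (fun y : bX => u y * rlam f x y).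
  move=> fi; apply: measurable_funM; first exact: int1_measurable iu.
  exact: (measurable_fun_pair2 (x : bX) (measurable_rlam H (int1_measurable fi))).
rewrite /rconv -RintegralD//; apply: ae_eq_Rintegral.
- exact: mr.
- by apply: measurable_funD; exact: mr.
apply: (ae_imply2 _ (int1_ae_lam hm x iv) (int1_ae_lam hm x iw)) => y vy wy.
rewrite -mulrDr; congr (_ * _).
rewrite !(rlamC H x y); [exact: RintegralD|exact: int1_measurable iw|
  exact: int1_measurable iv|exact: int1_measurable ivw].
Qed.

End real_convolution2.

(** * Integrals of operators against scalar weights *)

Section weighted_operators.
Context {R : realType} d (T : measurableType d) (E : completeNormedModType R[i]).
Variable m : {measure set T -> \bar R}.
Implicit Types (u w : T -> R) (v : E) (F : T -> E).

(** The estimate by which approximations of a vector-valued function by scalar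
    functions with vector coefficients pass to its integral. *)
Lemma has_bochner_dist_sum D (mD : measurable D) F z n (q : 'I_n -> T -> R)
    (y : 'I_n -> E) :
  (forall i, m.-integrable D (EFin \o q i)) -> has_bochner_integral m D F z ->
  ((nrm (z - \sum_i (\int[m]_(x in D) q i x)%:C *: y i))%:E <=
   \int[m]_(x in D) (nrm (F x - \sum_i (q i x)%:C *: y i))%:E)%E.
Proof.
move=> iq hF; apply: (has_bochner_dist mD hF).
by apply: has_bochner_sum => // i; exact: has_bochner_scale.
Qed.

Local Notation Ew w := (fun x : T => (w x)%:E : \bar R).
Local Notation int1 u := (m.-integrable setT (Ew u)).

Definition norm1 u : R := \int[m]_x `|u x|.

Lemma norm1E u : int1 u -> ((norm1 u)%:E = \int[m]_x (`|u x|)%:E)%E.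
Proof.
move=> iu; rewrite /norm1 /Rintegral fineK// integrable_fin_num//.
exact: integrable_abse iu.
Qed.

Lemma norm1_ge0 u : 0 <= norm1 u.
Proof. by apply: Rintegral_ge0 => x _. Qed.

Variables (Phi : T -> E -> E) (B : R).
Hypothesis B_ge0 : 0 <= B.
Hypothesis Phi_lin : forall x, linear (Phi x).
Hypothesis Phi_le : forall x v, nrm (Phi x v) <= B * nrm v.
Hypothesis Phi_meas : forall v, strongly_measurable setT (fun x => Phi x v).

Definition wop u v : E := bochner m setT (fun x => (u x)%:C *: Phi x v).

Lemma integral_weight_le u F (c : R) : int1 u ->
  strongly_measurable setT F -> 0 <= c -> (forall x, u x != 0 -> nrm (F x) <= c) ->
  (\int[m]_x (nrm ((u x)%:C *: F x))%:E <= (c * norm1 u)%:E)%E.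
Proof.
move=> iu sF c0 Fc; have mu : measurable_fun setT u by have /integrableP[/measurable_EFinP] := iu.
have mau : measurable_fun setT (fun x => (`|u x|)%:E).
  by apply/measurable_EFinP; exact: measurableT_comp.
rewrite EFinM norm1E// -ge0_integralZl//.
apply: ge0_le_integral => //.
- by move=> x _; rewrite lee_fin nrm_ge0.
- apply/measurable_EFinP; apply: measurable_nrm.
  exact: strongly_measurableZfun.
- exact: measurable_funeM.
move=> x _; rewrite lee_fin nrmZr mulrC.
have [->|ux] := eqVneq (u x) 0; first by rewrite normr0 !mulr0.
by rewrite ler_wpM2r// Fc.
Qed.

Lemma has_bochner_wop u v : int1 u ->
  has_bochner_integral m setT (fun x => (u x)%:C *: Phi x v) (wop u v).
Proof.
move=> iu; have mu : measurable_fun setT u by have /integrableP[/measurable_EFinP] := iu.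
apply/(bochner_integrableP m measurableT)/bochner_exists => //.
  exact: strongly_measurableZfun.
apply: le_lt_trans (@integral_weight_le u (fun x => Phi x v) (B * nrm v) iu _ _ _) _ => //.
- by rewrite mulr_ge0// nrm_ge0.
- by rewrite ltry.
Qed.

Lemma nrm_wop_le u v : int1 u -> nrm (wop u v) <= B * nrm v * norm1 u.
Proof.
move=> iu; rewrite -lee_fin.
apply: le_trans (has_bochner_nrm_le measurableT (has_bochner_wop v iu)) _.
by apply: integral_weight_le => //; rewrite mulr_ge0// nrm_ge0.
Qed.

Lemma wop_linear u : int1 u -> linear (wop u).
Proof.
move=> iu a v w; apply: (bochnerE measurableT).
rewrite (_ : (fun x => _) =
  (fun x => a *: ((u x)%:C *: Phi x v) + (u x)%:C *: Phi x w)).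
  by apply: has_bochner_lin => //; exact: has_bochner_wop.
apply/funext => x; have -> : Phi x (a *: v + w) = a *: Phi x v + Phi x w by exact: Phi_lin.
by rewrite scalerDr !scalerA mulrC.
Qed.

Lemma wopD u w v : int1 u -> int1 w ->
  wop (fun x => u x + w x) v = wop u v + wop w v.
Proof.
move=> iu iw; apply: (bochnerE measurableT).
rewrite (_ : (fun x => _) =
  (fun x => (u x)%:C *: Phi x v) \+ (fun x => (w x)%:C *: Phi x v)).
  by apply: has_bochnerD => //; exact: has_bochner_wop.
by apply/funext => x; rewrite /= rmorphD /= scalerDl.
Qed.

Lemma wop_ae u w v : int1 u -> int1 w -> {ae m, forall x, u x = w x} ->
  wop u v = wop w v.
Proof.
move=> iu iw uw; apply/eqP; rewrite -subr_eq0 -nrm_eq0; apply/eqP/le_anti.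
rewrite nrm_ge0 andbT -lee_fin.
have hu := has_bochner_wop v iu; have hw := has_bochner_wop v iw.
apply: le_trans (has_bochner_dist measurableT hu hw) _.
rewrite (ae_eq_integral (cst 0%E)) ?integral0//.
- apply/measurable_EFinP; apply: measurable_nrm.
  by apply: strongly_measurableB; [case: hu|case: hw].
- apply: (@filterS _ _ (ae_filter_ringOfSetsType m) _ _ _ uw) => x /= -> _.
  by rewrite subrr nrm0.
Qed.

Lemma nrm_wop_dist_sum u F z n (p : 'I_n -> T -> R) (y : 'I_n -> E) (c : R) :
  int1 u -> strongly_measurable setT F ->
  has_bochner_integral m setT (fun x => (u x)%:C *: F x) z ->
  (forall i, measurable_fun setT (p i)) ->
  (forall i, int1 (fun x => u x * p i x)) -> 0 <= c ->
  (forall x, u x != 0 -> nrm (F x - \sum_i (p i x)%:C *: y i) <= c) ->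
  nrm (z - \sum_i (\int[m]_x (u x * p i x))%:C *: y i) <= c * norm1 u.
Proof.
move=> iu sF hz mp ip c0 Fc; rewrite -lee_fin.
apply: le_trans (has_bochner_dist_sum measurableT y ip hz) _.
have -> : (\int[m]_x (nrm ((u x)%:C *: F x - \sum_i (u x * p i x)%:C *: y i))%:E =
  \int[m]_x (nrm ((u x)%:C *: (F x - \sum_i (p i x)%:C *: y i)))%:E)%E.
  apply: eq_integral => x _; congr (nrm _)%:E; rewrite scalerBr scaler_sumr; congr (_ - _).
  by apply: eq_bigr => i _; rewrite scalerA rmorphM.
apply: integral_weight_le => //; apply: strongly_measurableB => //.
apply: strongly_measurable_sum => i; apply: strongly_measurableZfun => //.
exact: strongly_measurable_cst.
Qed.

End weighted_operators.

(** * Truncation *)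

Lemma le0_of_small {R : realFieldType} (a c : R) : 0 <= c ->
  (forall e : R, 0 < e -> a <= e * c) -> a <= 0.
Proof.
move=> c0 h; apply/ler_addgt0Pr => e e0; rewrite add0r.
have c1 : 0 < c + 1 by lra.
apply: (le_trans (h (e / (c + 1)) (divr_gt0 e0 c1))).
by rewrite -mulrA ler_piMr ?(ltW e0)// ler_pdivrMl//; lra.
Qed.

Section tails.
Context {R : realType}.
Notation X := ('X_R).
Notation bX := (borel X).
Variable m : {measure set bX -> \bar R}.
Implicit Types (u : X -> R).
Local Notation int1 u := (m.-integrable setT (fun x : bX => (u x)%:E : \bar R)).

Definition trunc u (N : R) (x : X) : R := if \val x <= N then u x else 0.
Definition tail u (N : R) (x : X) : R := if \val x <= N then 0 else u x.

Lemma trunc_tail u N x : u x = tail u N x + trunc u N x.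
Proof. by rewrite /trunc /tail; case: ifP => _; rewrite ?add0r ?addr0. Qed.

Lemma measurable_tail u N : measurable_fun setT (u : bX -> R) ->
  measurable_fun setT (tail u N : bX -> R).
Proof.
move=> mu; apply: measurable_fun_ifT => //.
apply: (@measurable_fun_bool _ _ _ _ true).
rewrite setTI; exact: measurable_le.
Qed.

Lemma measurable_trunc u N : measurable_fun setT (u : bX -> R) ->
  measurable_fun setT (trunc u N : bX -> R).
Proof.
move=> mu; apply: measurable_fun_ifT => //.
apply: (@measurable_fun_bool _ _ _ _ true).
rewrite setTI; exact: measurable_le.
Qed.

Lemma integrable_tail u N : int1 u -> int1 (tail u N).
Proof.
move=> iu; have /integrableP[/measurable_EFinP mu _] := iu.
apply: (le_integrable measurableT _ _ iu).
  by apply/measurable_EFinP; exact: measurable_tail.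
by move=> x _; rewrite lee_fin /tail; case: ifP => // _; rewrite normr0.
Qed.

Lemma integrable_trunc u N : int1 u -> int1 (trunc u N).
Proof.
move=> iu; have /integrableP[/measurable_EFinP mu _] := iu.
apply: (le_integrable measurableT _ _ iu).
  by apply/measurable_EFinP; exact: measurable_trunc.
by move=> x _; rewrite lee_fin /trunc; case: ifP => // _; rewrite normr0.
Qed.

Lemma norm1_trunc_le u N : int1 u -> norm1 m (trunc u N) <= norm1 m u.
Proof.
move=> iu; apply: le_Rintegral => //.
- exact: integrable_abse (integrable_trunc N iu).
- exact: integrable_abse iu.
by move=> x _; rewrite /trunc; case: ifP => // _; rewrite normr0.
Qed.

Lemma norm1_tail_small u (e : R) : int1 u -> 0 < e ->
  exists N : nat, norm1 m (tail u N%:R) <= e.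
Proof.
move=> iu e0; have /integrableP[/measurable_EFinP mu _] := iu.
have c : (fun n : nat => \int[m]_x (`|tail u n%:R x|)%:E)%E @ \oo --> (\int[m]_x (cst 0 x))%E.
  apply: (@dominated_cvg _ _ _ m setT measurableT _ _ (fun x => (`|u x|)%:E)).
  - move=> n; apply/measurable_EFinP; apply: measurableT_comp => //.
    exact: measurable_tail.
  - move=> x _; apply: (@cvg_near_cst _ _ 0%E).
    exists (Num.truncn (\val x)).+1 => // n /= xn; rewrite /tail ifT ?normr0//.
    by rewrite (le_trans (ltW (truncnS_gt _)))// ler_nat.
  - by [].
  - exact: integrable_abse iu.
  - move=> n x _; rewrite lee_fin normr_id /tail; case: ifP => // _.
    by rewrite normr0.
rewrite integral0 in c.
have c' : (fun n : nat => (norm1 m (tail u n%:R))%:E) @ \oo --> (0 : R)%:E.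
  rewrite (_ : (fun n : nat => _) = (fun n : nat => \int[m]_x (`|tail u n%:R x|)%:E)%E)//.
  by apply/funext => n; rewrite norm1E//; exact: integrable_tail.
have c2 : (fun n : nat => norm1 m (tail u n%:R)) @ \oo --> (0 : R) by exact: (fine_cvg c').
have [N _ /(_ N (leqnn N)) /= h] := (cvgrPdist_lt _ _).1 c2 e e0.
by exists N; move: h; rewrite sub0r normrN; move=> /(le_lt_trans (ler_norm _))/ltW.
Qed.

End tails.

(** * Homomorphisms from approximable families *)

(** [wop] for a complex weight; [TA] is the case of [phiA]. *)
Definition cwop {R : realType} (E : normedModType R[i]) (Phi : 'X_R -> E -> E)
    (m : {measure set (borel 'X_R) -> \bar R}) (f : 'X_R -> R[i]) (v : E) : E :=
  bochner m setT (fun x => f x *: Phi x v).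

Section multiplicativity.
Context {R : realType} (H : @hypergroup R).
Notation X := ('X_R).
Notation bX := (borel X).
Variable E : completeNormedModType R[i].
Local Notation rlam := (rlam H).
Implicit Types (x y z s t : X) (u w p : X -> R) (v : E).

Definition bounded_multiplicative_real p :=
  [/\ continuous p, exists A, forall x, `|p x| <= A &
   forall x y, rlam p x y = p x * p y].

(** The second estimate, with the same coefficients as the first, stands for the
    functional equation [Phi x (Phi t v) = Phi (x * t) v] of a character; it avoids
    integrating [Phi] against the product of two point masses. *)
Definition approximable (Phi : X -> E -> E) := forall v (N e : R), 0 < e ->
  exists n (p : 'I_n -> X -> R) (y : 'I_n -> E),
  [/\ forall i, bounded_multiplicative_real (p i),
      forall x, \val x <= N -> nrm (Phi x v - \sum_i (p i x)%:C *: y i) <= e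
    & forall x t, \val x <= N -> \val t <= N ->
        nrm (Phi x (Phi t v) - \sum_i (p i x * p i t)%:C *: y i) <= e].

Variables (Phi : X -> E -> E) (B : R).
Hypothesis B_ge0 : 0 <= B.
Hypothesis Phi_lin : forall x, linear (Phi x).
Hypothesis Phi_le : forall x v, nrm (Phi x v) <= B * nrm v.
Hypothesis Phi_approx : approximable Phi.

(** Locally uniform limits of continuous functions are continuous. *)
Lemma approximable_continuous v : continuous (fun x => Phi x v).
Proof.
move=> x; apply: (proj2 (@cvg_nrmP R E X (nbhs x) (nbhs_filter x) _ _)) => e e0.
have e4 : 0 < e / 4 by lra.
have [n [p [y [gp hp _]]]] := Phi_approx v (\val x + 1) e4.
pose c i := (n.+1%:R * (nrm (y i) + 1)) : R.
have c0 i : 0 < c i by rewrite mulr_gt0// ltr_wpDl// nrm_ge0.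
have near_p : \forall t \near x, forall i, `|p i x - p i t| < e / 4 / c i.
  apply: (@filter_forall _ _ _ (nbhs x) (nbhs_filter x)) => i; have [cp _ _] := gp i.
  exact: (proj1 (@cvgrPdist_lt _ _ _ (nbhs x) (nbhs_filter x) _ _) (cp x) _ (divr_gt0 e4 (c0 i))).
near=> t.
have tx : \val t <= \val x + 1.
  near: t; have : open_nbhs x [set t : X | \val t < \val x + 1].
    by split; [exact: open_val_lt|rewrite /= ltrDl].
  by move=> /open_nbhs_nbhs; apply: filterS => t /ltW.
have xx : \val x <= \val x + 1 by rewrite lerDl.
have pt : forall i, `|p i x - p i t| < e / 4 / c i by near: t.
pose S z := \sum_i (p i z)%:C *: y i.
have dS : nrm (S x - S t) <= e / 4.
  rewrite /S -sumrB (le_trans (ler_nrm_sum _ _ _))//.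
  apply: (@le_trans _ _ (\sum_(i < n) e / 4 / n.+1%:R)).
    apply: ler_sum => i _; rewrite -scalerBl -rmorphB nrmZr.
    apply: (@le_trans _ _ (e / 4 / c i * nrm (y i))).
      by rewrite ler_wpM2r ?nrm_ge0// ltW.
    rewrite /c invfM mulrA -[leRHS]mulr1 -!mulrA ler_wpM2l// ?(ltW e0)//.
    rewrite ler_wpM2l// ler_wpM2l// ler_pdivrMl ?mulr1 ?lerDl//.
    by rewrite ltr_wpDl// nrm_ge0.
  rewrite sumr_const card_ord -[leLHS]mulr_natr -mulrA ler_piMr//; first by lra.
  by rewrite ler_pdivrMl// mulr1 ler_nat.
have h1 := hp x xx; have h2 := hp t tx; rewrite nrmB in h2.
have h3 := ler_nrm_dist (Phi x v) (Phi t v) (S x).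
have h4 := ler_nrm_dist (S x) (Phi t v) (S t).
rewrite -/(S x) in h1; rewrite -/(S t) in h2.
lra.
Unshelve. all: by end_near.
Qed.

Lemma approximable_measurable v : strongly_measurable setT (fun x : bX => Phi x v).
Proof.
rewrite (_ : (fun x => _) = (fun t : R => Phi (proj t) v) \o (fun x : bX => \val x)).
  apply: strongly_measurable_comp => //.
    by apply: measurable_continuous_X; exact: continuous_val.
  move=> t; apply: (@continuous_comp _ _ _ (@proj R) (fun x => Phi x v)).
    exact: continuous_proj.
  exact: approximable_continuous.
by apply/funext => x /=; rewrite projK.
Qed.

Variables (m : {sigma_finite_measure set bX -> \bar R}) (hm : haar_measure H m).
Local Notation rconv := (rconv H m).
Local Notation int1 u := (m.-integrable setT (fun x : bX => (u x)%:E : \bar R)).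
Local Notation T := (wop m Phi).
Local Notation N1 := (norm1 m).

Let Phi_meas := approximable_measurable.

Let hbw u v (iu : int1 u) :
  has_bochner_integral m setT (fun x : bX => (u x)%:C *: Phi x v) (T u v) :=
  @has_bochner_wop _ _ bX _ m Phi B B_ge0 Phi_le Phi_meas u v iu.
Let Tle u v (iu : int1 u) : nrm (T u v) <= B * nrm v * N1 u :=
  @nrm_wop_le _ _ bX _ m Phi B B_ge0 Phi_le Phi_meas u v iu.
Let Tlin u (iu : int1 u) : linear (T u) :=
  @wop_linear _ _ bX _ m Phi B B_ge0 Phi_lin Phi_le Phi_meas u iu.
Let TD u w v (iu : int1 u) (iw : int1 w) : T (fun x => u x + w x) v = T u v + T w v :=
  @wopD _ _ bX _ m Phi B B_ge0 Phi_le Phi_meas u w v iu iw.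
Let Tae u w v (iu : int1 u) (iw : int1 w) :
  {ae m, forall x, u x = w x} -> T u v = T w v :=
  @wop_ae _ _ bX _ m Phi B B_ge0 Phi_le Phi_meas u w v iu iw.

Lemma norm1_rconv_le u w : int1 u -> int1 w -> N1 (rconv u w) <= N1 u * N1 w.
Proof.
move=> iu iw; rewrite -lee_fin EFinM !norm1E//; last exact: integrable_rconv.
exact: integral_abs_rconv_le.
Qed.

(** With [S] the sum of the [(\int u p_i) (\int w p_i)] times [y i], both sides are
    close to [S]: the left one by [Rintegral_rconv] and because the convolution
    has bounded support, the right one by the second part of [approximable],
    integrated in each variable successively. *)
Lemma wop_rconv_bounded u w v (N : R) : int1 u -> int1 w ->
  (forall x, N < \val x -> u x = 0) -> (forall x, N < \val x -> w x = 0) ->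
  T (rconv u w) v = T u (T w v).
Proof.
move=> iu iw u0 w0; have [M hM] := rconv_support H m N.
have r0 := hM u w u0 w0 (int1_measurable iw).
have ir := integrable_rconv hm iu iw.
pose L := Num.max N M%:R.
have on (f : X -> R) K : K <= L -> (forall x, K < \val x -> f x = 0) ->
    forall x, f x != 0 -> \val x <= L.
  by move=> KL f0 x; apply: contraR; rewrite -ltNge => /(le_lt_trans KL)/f0 ->.
have NL : N <= L by rewrite le_max lexx.
have ML : M%:R <= L by rewrite le_max lexx orbT.
apply/eqP; rewrite -subr_eq0 -nrm_eq0; apply/eqP/le_anti; rewrite nrm_ge0 andbT.
apply: (@le0_of_small _ _ (N1 (rconv u w) + N1 w * N1 u)).
  by rewrite addr_ge0 ?mulr_ge0 ?norm1_ge0.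
move=> e e0; have [n [p [y [gp hp hpp]]]] := Phi_approx v L e0.
have mp i : measurable_fun setT (p i : bX -> R).
  by have [cp _ _] := gp i; exact: measurable_continuous_X.
have ip (f : X -> R) i : int1 f -> int1 (fun x => f x * p i x).
  by move=> fi; have [_ [A pA] _] := gp i; exact: int1_bounded_mul fi (mp i) pA.
pose c i := \int[m]_x (w x * p i x).
pose S := \sum_i (\int[m]_x (u x * p i x))%:C *: ((c i)%:C *: y i).
have e1 : nrm (T (rconv u w) v - S) <= e * N1 (rconv u w).
  have -> : S = \sum_i (\int[m]_x (rconv u w x * p i x))%:C *: y i.
    apply: eq_bigr => i _; have [cp [A pA] pM] := gp i.
    by rewrite (Rintegral_rconv hm iu iw cp pA pM) rmorphM scalerA.
  apply: (@nrm_wop_dist_sum _ _ _ _ m (rconv u w) (fun x => Phi x v)) => //.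
  - exact: (hbw v ir).
  - by move=> i; exact: ip.
  - exact: ltW.
  - by move=> x /(on _ _ ML r0); exact: hp.
have e2 x : \val x <= L -> nrm (Phi x (T w v) - \sum_i (p i x)%:C *: ((c i)%:C *: y i)) <= e * N1 w.
  move=> xL; have -> : \sum_i (p i x)%:C *: ((c i)%:C *: y i) =
      \sum_i (\int[m]_t (w t * p i t))%:C *: ((p i x)%:C *: y i).
    by apply: eq_bigr => i _; rewrite !scalerA mulrC.
  apply: (@nrm_wop_dist_sum _ _ _ _ m w (fun t => Phi x (Phi t v))) => //.
  - exact: (strongly_measurable_op (Phi_lin x) (Phi_le x) (Phi_meas v)).
  - have := has_bochner_op measurableT (Phi_lin x) (Phi_le x)
      (hbw v iw).
    congr has_bochner_integral; apply/funext => t /=.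
    have := Phi_lin x (w t)%:C (Phi t v) 0; rewrite addr0 => ->.
    have := Phi_lin x (-1) 0 0; rewrite scaler0 addr0 scaleN1r.
    by rewrite addNr => ->; rewrite addr0.
  - by move=> i; exact: ip.
  - exact: ltW.
  - move=> t /(on _ _ NL w0) tL.
    under eq_bigr do rewrite scalerA -rmorphM mulrC.
    exact: hpp.
have e3 : nrm (T u (T w v) - S) <= e * N1 w * N1 u.
  apply: (@nrm_wop_dist_sum _ _ _ _ m u (fun x => Phi x (T w v))) => //.
  - exact: (hbw (T w v) iu).
  - by move=> i; exact: ip.
  - by rewrite mulr_ge0 ?norm1_ge0// ltW.
  - by move=> x /(on _ _ NL u0); exact: e2.
rewrite (le_trans (ler_nrm_dist _ _ S))// mulrDr lerD//.
by rewrite nrmB mulrA.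
Qed.

(** The defect [D u w] of multiplicativity is biadditive, bounded by a multiple of
    the product of the norms, and zero on functions of bounded support, which
    are dense. *)
Theorem wop_rconv u w v : int1 u -> int1 w -> T (rconv u w) v = T u (T w v).
Proof.
pose D (u w : X -> R) := T (rconv u w) v - T u (T w v).
have DDl u1 u2 w1 : int1 u1 -> int1 u2 -> int1 w1 ->
    D (fun x => u1 x + u2 x) w1 = D u1 w1 + D u2 w1.
  move=> i1 i2 iw1; rewrite /D (TD _ i1 i2).
  rewrite (@Tae _ _ _ _ _ (ae_rconvDl hm i1 i2 iw1)) //.
  - by rewrite TD; [rewrite opprD addrACA|exact: integrable_rconv|exact: integrable_rconv].
  - by apply: integrable_rconv => //; exact: (integrableD measurableT i1 i2).
  - exact: (integrableD measurableT (integrable_rconv hm i1 iw1) (integrable_rconv hm i2 iw1)).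
have DDr u1 w1 w2 : int1 u1 -> int1 w1 -> int1 w2 ->
    D u1 (fun x => w1 x + w2 x) = D u1 w1 + D u1 w2.
  move=> i1 iw1 iw2; rewrite /D (TD _ iw1 iw2).
  rewrite (@Tae _ _ _ _ _ (ae_rconvDr hm i1 iw1 iw2)) //.
  - rewrite TD; [|exact: integrable_rconv|exact: integrable_rconv].
    have -> : T u1 (T w1 v + T w2 v) = T u1 (T w1 v) + T u1 (T w2 v).
      by have := Tlin i1 1 (T w1 v) (T w2 v); rewrite !scale1r.
    by rewrite opprD addrACA.
  - by apply: integrable_rconv => //; exact: (integrableD measurableT iw1 iw2).
  - exact: (integrableD measurableT (integrable_rconv hm i1 iw1) (integrable_rconv hm i1 iw2)).
pose c := B * nrm v + B * (B * nrm v).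
have Bv : 0 <= B * nrm v by rewrite mulr_ge0 ?nrm_ge0.
have c0 : 0 <= c by rewrite addr_ge0// mulr_ge0.
have Dle u1 w1 : int1 u1 -> int1 w1 -> nrm (D u1 w1) <= c * (N1 u1 * N1 w1).
  move=> i1 iw1; rewrite /D (le_trans (ler_nrmD _ _))// nrmN /c mulrDl lerD//.
    rewrite (le_trans (Tle _ (integrable_rconv hm i1 iw1)))//.
    by rewrite ler_wpM2l// norm1_rconv_le.
  rewrite (le_trans (Tle _ i1))//.
  rewrite mulrCA mulrC ler_wpM2l ?norm1_ge0// -mulrA ler_wpM2l//.
  exact: Tle.
have D0 u1 w1 (N N' : R) : int1 u1 -> int1 w1 -> D (trunc u1 N) (trunc w1 N') = 0.
  move=> i1 iw1; apply/eqP; rewrite subr_eq0; apply/eqP.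
  apply: (@wop_rconv_bounded _ _ _ (Num.max N N')).
  - exact: integrable_trunc.
  - exact: integrable_trunc.
  - by move=> x; rewrite gt_max => /andP[h _]; rewrite /trunc leNgt h.
  - by move=> x; rewrite gt_max => /andP[_ h]; rewrite /trunc leNgt h.
move=> iu iw; apply/eqP; rewrite -subr_eq0 -/(D u w); clearbody D.
rewrite -nrm_eq0.
apply/eqP/le_anti; rewrite nrm_ge0 andbT.
apply: (@le0_of_small _ _ (c * (N1 w + N1 u))).
  by rewrite mulr_ge0// addr_ge0 ?norm1_ge0.
move=> e e0; have [N hN] := norm1_tail_small iu e0.
have [N' hN'] := norm1_tail_small iw e0.
have itu := integrable_tail N%:R iu; have itw := integrable_tail N'%:R iw.
have icu := integrable_trunc N%:R iu; have icw := integrable_trunc N'%:R iw.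
rewrite {1}(_ : u = fun x => tail u N%:R x + trunc u N%:R x); last first.
  by apply/funext => x; exact: trunc_tail.
rewrite DDl//.
rewrite {2}(_ : w = fun x => tail w N'%:R x + trunc w N'%:R x); last first.
  by apply/funext => x; exact: trunc_tail.
rewrite DDr//.
rewrite D0// addr0 (le_trans (ler_nrmD _ _))//.
have h1 := Dle _ _ itu iw; have h2 := Dle _ _ icu itw.
have h3 : N1 (tail u N%:R) * N1 w <= e * N1 w by rewrite ler_wpM2r ?norm1_ge0.
have h4 : N1 (trunc u N%:R) * N1 (tail w N'%:R) <= N1 u * e.
  by rewrite ler_pM ?norm1_ge0// norm1_trunc_le.
apply: (le_trans (lerD h1 h2)); rewrite -mulrDr.
apply: (le_trans (ler_wpM2l c0 (lerD h3 h4))).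
by rewrite le_eqVlt; apply/orP; left; apply/eqP; ring.
Qed.

Local Notation L1 := (L1 (m : {measure set bX -> \bar R})).
Local Notation fconv := (fconv H m).
Local Notation cwop := (cwop Phi m).
Implicit Types f g : X -> R[i].

Definition re f x : R := complex.Re (f x).
Definition im f x : R := complex.Im (f x).

Lemma has_bochner_cwop f v : L1 f ->
  has_bochner_integral m setT (fun x : bX => f x *: Phi x v)
    (T (re f) v + 'i *: T (im f) v).
Proof.
move=> [fr fi]; rewrite (_ : (fun x => _) = ((fun x => (re f x)%:C *: Phi x v) \+
    (fun x => 'i *: ((im f x)%:C *: Phi x v))))//.
  apply: has_bochnerD => //; first exact: hbw.
  by apply: has_bochnerZ => //; exact: hbw.
apply/funext => x /=; rewrite scalerA -scalerDl; congr (_ *: _).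
by rewrite /re /im; case: (f x) => r i; simpc.
Qed.

Lemma cwopE f v : L1 f -> cwop f v = T (re f) v + 'i *: T (im f) v.
Proof. by move=> /(has_bochner_cwop v); apply: bochnerE. Qed.

Lemma cwop_integrable f v : L1 f ->
  bochner_integrable m setT (fun x : bX => f x *: Phi x v).
Proof. by move=> /(has_bochner_cwop v) h; exists (T (re f) v + 'i *: T (im f) v). Qed.

Lemma cwop_bounded f : L1 f -> bounded_operator (cwop f).
Proof.
move=> Lf; have [fr fi] := Lf; split.
  move=> a v w; rewrite !cwopE// (Tlin fr) (Tlin fi) !scalerDr !scalerA.
  by rewrite ['i * a]mulrC addrACA.
exists (B * N1 (re f) + nrm ('i : R[i]) * (B * N1 (im f))) => v.
rewrite cwopE// (le_trans (ler_nrmD _ _))// nrmZ mulrDl lerD//.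
  by rewrite mulrAC; exact: Tle.
by rewrite -mulrA ler_wpM2l ?nrm_ge0// mulrAC; exact: Tle.
Qed.

Lemma cwop_lin (a : R[i]) f g v : L1 f -> L1 g ->
  cwop (fun x => a * f x + g x) v = a *: cwop f v + cwop g v.
Proof.
move=> Lf Lg; apply: (bochnerE measurableT).
rewrite (_ : (fun x : bX => _) = (fun x : bX => a *: (f x *: Phi x v) + g x *: Phi x v)).
  rewrite (cwopE v Lf) (cwopE v Lg).
  by apply: has_bochner_lin; [|exact: has_bochner_cwop..].
by apply/funext => x; rewrite scalerDl scalerA.
Qed.

Lemma cwop_ae f g v : L1 f -> L1 g -> {ae m, forall x, f x = g x} -> cwop f v = cwop g v.
Proof.
move=> Lf Lg fg; rewrite (cwopE v Lf) (cwopE v Lg); have [fr fi] := Lf; have [gr gi] := Lg.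
have aer : {ae m, forall x, re f x = re g x}.
  by apply: (ae_imply _ fg) => x; rewrite /re => ->.
have aei : {ae m, forall x, im f x = im g x}.
  by apply: (ae_imply _ fg) => x; rewrite /im => ->.
by rewrite (Tae v fr gr aer) (Tae v fi gi aei).
Qed.

Lemma re_fconv f g x : re (fconv f g) x =
  \int[m]_y (conv_integrand H (re f) (re g) (x, y) - conv_integrand H (im f) (im g) (x, y)).
Proof.
by apply: eq_Rintegral => y _; rewrite /conv_integrand /re /im /=; case: (f y).
Qed.

Lemma im_fconv f g x : im (fconv f g) x =
  \int[m]_y (conv_integrand H (re f) (im g) (x, y) + conv_integrand H (im f) (re g) (x, y)).
Proof.
by apply: eq_Rintegral => y _; rewrite /conv_integrand /re /im /=; case: (f y).
Qed.

Lemma L1_fconv f g : L1 f -> L1 g -> L1 (fconv f g).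
Proof.
move=> [fr fi] [gr gi]; split.
  have := integrable_Rintegral (integrableB measurableT (integrable_conv_integrand hm fr gr) (integrable_conv_integrand hm fi gi)).
  by apply: eq_integrable => // x _; rewrite -re_fconv.
have := integrable_Rintegral (integrableD measurableT (integrable_conv_integrand hm fr gi) (integrable_conv_integrand hm fi gr)).
by apply: eq_integrable => // x _; rewrite -im_fconv.
Qed.

(** The real case, extended by bilinearity to the real and imaginary parts. *)
Lemma cwop_fconv f g v : L1 f -> L1 g -> cwop (fconv f g) v = cwop f (cwop g v).
Proof.
move=> Lf Lg; have Lfg := L1_fconv Lf Lg.
have fr : int1 (re f) := Lf.1; have fi : int1 (im f) := Lf.2.
have gr : int1 (re g) := Lg.1; have gi : int1 (im g) := Lg.2.
have fgr : int1 (re (fconv f g)) := Lfg.1; have fgi : int1 (im (fconv f g)) := Lfg.2.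
rewrite (cwopE v Lfg) (cwopE _ Lf) (cwopE v Lg).
have Rm u w (iu : int1 u) (iw : int1 w) := wop_rconv v iu iw.
have irc u w (iu : int1 u) (iw : int1 w) := integrable_rconv hm iu iw.
have -> : T (re (fconv f g)) v = T (re f) (T (re g) v) - T (im f) (T (im g) v).
  apply/eqP; rewrite eq_sym subr_eq; apply/eqP; rewrite -(Rm _ _ fr gr) -(Rm _ _ fi gi).
  rewrite -(TD v fgr (irc _ _ fi gi)); apply: Tae.
  - exact: irc.
  - exact: (integrableD measurableT fgr (irc _ _ fi gi)).
  apply: (ae_imply2 _ (ae_integrable_conv hm fr gr) (ae_integrable_conv hm fi gi)) => x h1 h2.
  by rewrite re_fconv RintegralB// subrK.
have -> : T (im (fconv f g)) v = T (re f) (T (im g) v) + T (im f) (T (re g) v).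
  rewrite -(Rm _ _ fr gi) -(Rm _ _ fi gr) -(TD v (irc _ _ fr gi) (irc _ _ fi gr)).
  apply: Tae; first exact: fgi.
    exact: (integrableD measurableT (irc _ _ fr gi) (irc _ _ fi gr)).
  apply: (ae_imply2 _ (ae_integrable_conv hm fr gi) (ae_integrable_conv hm fi gr)) => x h1 h2.
  by rewrite im_fconv RintegralD.
have lin u (iu : int1 u) (v1 v2 : E) : T u (v1 + 'i *: v2) = T u v1 + 'i *: T u v2.
  by rewrite addrC (Tlin iu) addrC.
have ii : 'i * 'i = -1 :> R[i] by simpc.
rewrite (lin _ fr) (lin _ fi) !scalerDr scalerA ii scaleN1r.
rewrite -!addrA; congr (_ + _); rewrite [LHS]addrC -!addrA; congr (_ + _).
Qed.

End multiplicativity.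

Theorem approximable_homomorphism (R : realType) (H : @hypergroup R)
    (m : {measure set (borel 'X_R) -> \bar R}) (m_haar : haar_measure H m)
    (E : completeNormedModType R[i]) (Phi : 'X_R -> E -> E) (B : R) :
  0 <= B -> (forall x, linear (Phi x)) ->
  (forall x v, nrm (Phi x v) <= B * nrm v) -> approximable H Phi ->
  (forall f, L1 m f ->
    (forall v, bochner_integrable m setT (fun x => f x *: Phi x v)) /\
    bounded_operator (cwop Phi m f)) /\
  (forall f g, L1 m f -> L1 m g ->
    L1 m (fconv H m f g) /\
    forall v, cwop Phi m (fconv H m f g) v = cwop Phi m f (cwop Phi m g v)) /\
  (forall (a : R[i]) f g, L1 m f -> L1 m g -> forall v,
    cwop Phi m (fun x => a * f x + g x) v = a *: cwop Phi m f v + cwop Phi m g v) /\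
  (forall f g, L1 m f -> L1 m g -> {ae m, forall x, f x = g x} ->
    forall v, cwop Phi m f v = cwop Phi m g v).
Proof.
move=> B0 linP leP appP; have sm : sigma_finite setT m by exact: (radon_sigma_finite (haar_radon m_haar)).
move: m sm m_haar; apply: sigma_finite_ind => m hm.
split; [|split; [|split]].
- move=> f Lf; split; last exact: (cwop_bounded B0 linP leP appP).
  by move=> v; exact: (cwop_integrable B0 leP appP).
- move=> f g Lf Lg; split; first exact: (L1_fconv hm).
  by move=> v; exact: (cwop_fconv B0 linP leP appP hm).
- by move=> a f g Lf Lg v; exact: (cwop_lin B0 leP appP).
- by move=> f g Lf Lg fg v; exact: (cwop_ae B0 leP appP).
Qed.

(** * Cosine families integrated against the Laplace measures *)

Section operator_norm.
Context {R : realType} (E : normedModType R[i]).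
Implicit Types (A : E -> E) (v : E).

Lemma linear0 A : linear A -> A 0 = 0.
Proof. by move=> lA; have := lA (-1) 0 0; rewrite scaler0 addr0 scaleN1r addNr. Qed.

Lemma linearZ A a v : linear A -> A (a *: v) = a *: A v.
Proof. by move=> lA; have := lA a v 0; rewrite (linear0 lA) !addr0. Qed.

Let nonempty A : [set nrm (A v) | v in [set v | nrm v <= 1]] !=set0.
Proof. by exists (nrm (A 0)); exists 0 => //=; rewrite nrm0. Qed.

Lemma opnorm_ub A v : bounded_operator A -> nrm v <= 1 -> nrm (A v) <= opnorm A.
Proof.
move=> [lA [K AK]] v1; apply: ub_le_sup; last by exists v.
exists `|K| => _ [w /= w1 <-]; rewrite (le_trans (AK w))//.
by rewrite (le_trans (ler_wpM2r (nrm_ge0 _) (ler_norm K)))// ler_piMr.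
Qed.

Lemma opnorm_ge0 A : bounded_operator A -> 0 <= opnorm A.
Proof.
move=> bA; have [lA _] := bA; rewrite -(nrm0 E) -{1}(linear0 lA).
by apply: opnorm_ub => //; rewrite nrm0.
Qed.

Lemma nrm_le_opnorm A v : bounded_operator A -> nrm (A v) <= opnorm A * nrm v.
Proof.
move=> bA; have [lA _] := bA.
have [->|v0] := eqVneq v 0; first by rewrite (linear0 lA) !nrm0 mulr0.
have nv : 0 < nrm v by rewrite lt_neqAle nrm_ge0 andbT eq_sym nrm_eq0.
have := @opnorm_ub A (((nrm v)^-1)%:C *: v) bA.
rewrite (linearZ _ _ lA) !nrmZr ger0_norm ?invr_ge0 ?nrm_ge0//.
rewrite mulVf ?gt_eqF// lexx => /(_ isT).
by rewrite mulrC ler_pdivrMr.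
Qed.

Lemma opnorm_le A K : 0 <= K -> (forall v, nrm (A v) <= K * nrm v) -> opnorm A <= K.
Proof.
move=> K0 AK; apply: ge_sup; first exact: nonempty.
by move=> _ [v /= v1 <-]; rewrite (le_trans (AK v))// ler_piMr.
Qed.

End operator_norm.

Section cosh_lemmas.
Context {R : realType}.
Implicit Types t : R.

Lemma cosh_even t : cosh (- t) = cosh t.
Proof. by rewrite /cosh opprK addrC. Qed.

Lemma cosh_ge1 t : 1 <= cosh t.
Proof.
rewrite /cosh ler_pdivlMr// mul1r.
have e0 := expR_gt0 t; have eV : expR t * expR (- t) = 1.
  by rewrite -expRD subrr expR0.
have : 0 <= (expR t - 1) ^+ 2 by exact: sqr_ge0.
have := sqr_ge0 (expR t - expR (- t)).
nra.
Qed.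

Lemma cosh0 : cosh (0 : R) = 1.
Proof. by rewrite /cosh oppr0 expR0 -mulr2n -mulr_natr mul1r divff. Qed.

Lemma measurable_cosh (w : R) : measurable_fun setT (fun t => cosh (w * t)).
Proof.
apply: measurable_funM => //; apply: measurable_funD.
- by apply: measurableT_comp => //; exact: measurable_funM.
- by apply: measurableT_comp => //; exact: measurableT_comp.
Qed.

End cosh_lemmas.

Section cosine_integral.
Context {R : realType} (E : completeNormedModType R[i]).
Notation X := ('X_R).
Variables (tau : X -> {measure set (measurableTypeR R) -> \bar R}) (M0 omega0 : R).
Hypothesis M0_gt0 : 0 < M0.
Hypothesis tau_cosh : forall x : X,
  (\int[tau x]_(t in symitv x) (cosh (omega0 * t))%:E <= M0%:E)%E.
Variables (C : R -> E -> E) (C_cos : cosine_family C) (kappa : R).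
Hypothesis C_le : forall t, 0 <= t -> opnorm (C t) <= kappa * cosh (t * omega0).
Implicit Types (x y : X) (s t l : R) (v : E).

Let bounded_C := cosine_bounded C_cos.
Let linC t : linear (C t) := (cosine_bounded C_cos t).1.

Lemma cosine_even t v : C (- t) v = C t v.
Proof.
have := cosineD C_cos 0 t v; rewrite sub0r add0r (cosine0 C_cos).
by rewrite scaler_nat mulr2n => /addIr.
Qed.

Lemma kappa_ge0 : 0 <= kappa.
Proof.
by have := C_le (lexx 0); rewrite mul0r cosh0 mulr1; apply: le_trans; exact: opnorm_ge0.
Qed.

(** The bound is assumed for nonnegative times; the family is even. *)
Lemma nrm_cosine_le t v : nrm (C t v) <= kappa * cosh (omega0 * t) * nrm v.
Proof.
have pos r : 0 <= r -> nrm (C r v) <= kappa * cosh (omega0 * r) * nrm v.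
  move=> r0; apply: (le_trans (nrm_le_opnorm v (bounded_C r))).
  by rewrite ler_wpM2r ?nrm_ge0// (le_trans (C_le r0))// [r * _]mulrC.
have [t0|t0] := leP 0 t; first exact: pos.
by rewrite -cosine_even -cosh_even -mulrN; apply: pos; rewrite oppr_ge0 ltW.
Qed.

Lemma symitvE x t : symitv x t = (`|t| <= \val x) :> Prop.
Proof. by rewrite /symitv /= in_itv /= ler_norml. Qed.

Lemma measurable_symitv x : measurable (symitv x : set (measurableTypeR R)).
Proof. exact: measurable_itv. Qed.
Local Notation mS := measurable_symitv.

(** The hyperbolic cosine is at least [1]. *)
Lemma tau_mass_le x : (tau x (symitv x) <= M0%:E)%E.
Proof.
apply: le_trans (tau_cosh x); rewrite -[leLHS]mul1e -integral_cst//; last exact: mS.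
apply: ge0_le_integral => //.
- exact: mS.
- by apply/measurable_EFinP; apply: measurable_funTS; exact: measurable_cosh.
- by move=> t _; rewrite lee_fin cosh_ge1.
Qed.

Lemma strongly_measurable_cosine x v :
  strongly_measurable (symitv x : set (measurableTypeR R)) (fun t => C t v).
Proof.
apply: (@strongly_measurable_comp _ _ _ _ _ (mS x) id (fun t => C t v)) => //.
exact: cosine_continuous.
Qed.

Lemma integral_nrm_cosine_le x v :
  (\int[tau x]_(t in symitv x) (nrm (C t v))%:E <= (kappa * M0 * nrm v)%:E)%E.
Proof.
have mc : measurable_fun (symitv x) (fun t : measurableTypeR R => (cosh (omega0 * t))%:E).
  by apply/measurable_EFinP; apply: measurable_funTS; exact: measurable_cosh.
have kv : 0 <= kappa * nrm v by rewrite mulr_ge0 ?nrm_ge0// kappa_ge0.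
apply: (@le_trans _ _ (\int[tau x]_(t in symitv x)
    ((kappa * nrm v)%:E * (cosh (omega0 * t))%:E))%E).
  apply: ge0_le_integral => //.
  - exact: mS.
  - by move=> t _; rewrite lee_fin nrm_ge0.
  - apply/measurable_EFinP; apply: measurable_nrm; exact: strongly_measurable_cosine.
  - exact: measurable_funeM.
  - by move=> t _; rewrite -EFinM lee_fin mulrAC nrm_cosine_le.
rewrite ge0_integralZl//; [|exact: mS|].
  by rewrite mulrAC [leRHS]EFinM; apply: lee_wpmul2l => //.
by move=> t _; rewrite lee_fin (le_trans _ (cosh_ge1 _)).
Qed.

Lemma cosine_integrable x v : bochner_integrable (tau x) (symitv x) (fun t => C t v).
Proof.
apply: bochner_exists; [exact: mS|exact: strongly_measurable_cosine|].
by rewrite (le_lt_trans (integral_nrm_cosine_le x v))// ltry.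
Qed.

Lemma has_bochner_phiA x v :
  has_bochner_integral (tau x) (symitv x) (fun t => C t v) (phiA tau C x v).
Proof. by apply/(bochner_integrableP (tau x) (mS x)); exact: cosine_integrable. Qed.

Lemma phiA_linear x : linear (phiA tau C x).
Proof.
move=> a v w; apply: (bochnerE (mS x)).
rewrite (_ : (fun t => _) = (fun t => a *: C t v + C t w)).
  by apply: has_bochner_lin; [exact: mS|exact: has_bochner_phiA..].
by apply/funext => t; exact: linC.
Qed.

Lemma nrm_phiA_le x v : nrm (phiA tau C x v) <= kappa * M0 * nrm v.
Proof.
rewrite -lee_fin; apply: (le_trans (has_bochner_nrm_le (mS x) (has_bochner_phiA x v))).
exact: integral_nrm_cosine_le.
Qed.

(** This is [phi l x] when [l] is in the support of the Plancherel measure, see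
    [laplace_cos_transform]. *)
Definition cos_transform l x : R := \int[tau x]_(t in symitv x) cos (l * t).

Lemma integrable_cos_tau x l :
  (tau x).-integrable (symitv x) (EFin \o (fun t => cos (l * t))).
Proof.
apply: measurable_bounded_integrable.
- exact: mS.
- by rewrite (le_lt_trans (tau_mass_le x))// ltry.
- apply: measurable_funTS; apply: measurableT_comp.
    by apply: continuous_measurable_fun; exact: continuous_cos.
  exact: measurable_funM.
- exists 1; split; first by rewrite num_real.
  by move=> r r1 t _ /=; rewrite (le_trans _ (ltW r1))// ler_norml cos_geN1 cos_le1.
Qed.

Lemma cos_transform_dist x (F : R -> E) z n (l : 'I_n -> R) (y : 'I_n -> E) (e : R) :
  0 <= e -> has_bochner_integral (tau x) (symitv x) F z ->
  (forall t, `|t| <= \val x -> nrm (F t - \sum_i (cos (l i * t))%:C *: y i) <= e) ->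
  nrm (z - \sum_i (cos_transform (l i) x)%:C *: y i) <= e * M0.
Proof.
move=> e0 hF Fe; rewrite -lee_fin.
have ic i : (tau x).-integrable (symitv x) (EFin \o (fun t => cos (l i * t))).
  exact: integrable_cos_tau.
apply: (le_trans (has_bochner_dist_sum (mS x) y ic hF)).
apply: (@le_trans _ _ (\int[tau x]_(t in symitv x) e%:E)%E).
  apply: ge0_le_integral => //.
  - exact: mS.
  - by move=> t _; rewrite lee_fin nrm_ge0.
  - apply/measurable_EFinP; apply: measurable_nrm; apply: strongly_measurableB.
      by case: hF.
    apply: strongly_measurable_sum => i; apply: strongly_measurableZfun.
    + exact: mS.
    + by have /integrableP[/measurable_EFinP] := ic i.
    + exact: strongly_measurable_cst.
  - by move=> t; rewrite symitvE lee_fin => /Fe.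
rewrite integral_cst; last exact: mS.
by rewrite EFinM lee_wpmul2l// tau_mass_le.
Qed.

Lemma cosine_product s t v :
  C s (C t v) = (2^-1 : R)%:C *: (C (s - t) v + C (s + t) v).
Proof.
rewrite (cosineD C_cos) scaler_nat -[C s (C t v) *+ 2]scaler_nat scalerA.
rewrite (_ : 2%:R = (2%:R : R)%:C :> R[i]); last by rewrite rmorph_nat.
by rewrite -rmorphM /= mulVf// scale1r.
Qed.

Lemma cos_product s t : cos s * cos t = 2^-1 * (cos (s - t) + cos (s + t)).
Proof. by rewrite cosB cosD; field. Qed.

Variables (H : @hypergroup R) (a b : R).
Hypothesis ab : a < b.
Hypothesis good : forall l, a < l < b -> bounded_multiplicative_real H (cos_transform l).

(** [C t v] is approximated on [[-2 * N, 2 * N]] by a combination of cosines whose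
    frequencies parametrize multiplicative functions. Integrating against
    [tau x] gives the first estimate. For the second, [C s] and [C t] are
    multiplied by [cosine_product], the cosines by [cos_product], and [s + t] and
    [s - t] stay in the interval of approximation. *)
Theorem phiA_approximable : approximable H (phiA tau C).
Proof.
move=> v N e e0; have M1 : 0 < M0 + 1 by rewrite addr_gt0.
(* the two integrations multiply the error by at most [M0] each *)
pose d := e / (M0 + 1) ^+ 2.
have d0 : 0 < d by rewrite divr_gt0// exprn_gt0.
have [s sab sC] := even_cos_approx ab (@cosine_continuous _ _ _ C_cos v)
  (fun t => cosine_even t v) (2 * N) d0.
pose l (i : 'I_(size s)) := (tnth (in_tuple s) i).1.
pose y (i : 'I_(size s)) := (tnth (in_tuple s) i).2.
have lab i : a < l i < b by apply: sab; exact: mem_tnth.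
have Cd t : `|t| <= 2 * N -> nrm (C t v - \sum_i (cos (l i * t))%:C *: y i) <= d.
  by move=> /sC; rewrite big_tnth.
have dM : d * M0 <= e.
  rewrite /d mulrAC ler_pdivrMr ?exprn_gt0// ler_wpM2l ?(ltW e0)//.
  by rewrite expr2; nra.
have dMM : d * M0 * M0 <= e.
  rewrite -mulrA /d mulrAC ler_pdivrMr ?exprn_gt0// ler_wpM2l ?(ltW e0)//.
  by rewrite expr2 ler_pM ?(ltW M0_gt0)// lerDl.
exists (size s), (fun i => cos_transform (l i)), y; split.
- by move=> i; exact: good.
- move=> x xN; apply: le_trans dM.
  apply: (@cos_transform_dist x (fun t => C t v)); first exact: ltW.
    exact: has_bochner_phiA.
  by move=> t tx; apply: Cd; have := val_ge0 x; lra.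
move=> x t xN tN; apply: le_trans dMM.
have step r : `|r| <= \val x -> nrm (C r (phiA tau C t v) -
    \sum_i (cos (l i * r))%:C *: ((cos_transform (l i) t)%:C *: y i)) <= d * M0.
  move=> rx; have -> : \sum_i (cos (l i * r))%:C *: ((cos_transform (l i) t)%:C *: y i) =
      \sum_i (cos_transform (l i) t)%:C *: ((cos (l i * r))%:C *: y i).
    by apply: eq_bigr => i _; rewrite !scalerA mulrC.
  apply: (@cos_transform_dist t (fun q => C r (C q v))); first exact: ltW.
    apply: (has_bochner_op (mS t) (linC r) (nrm_cosine_le r)).
    exact: has_bochner_phiA.
  move=> q qt; rewrite cosine_product.
  have -> : \sum_i (cos (l i * q))%:C *: ((cos (l i * r))%:C *: y i) =
      (2^-1 : R)%:C *: (\sum_i (cos (l i * (r - q)))%:C *: y i +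
                        \sum_i (cos (l i * (r + q)))%:C *: y i).
    rewrite -big_split scaler_sumr; apply: eq_bigr => i _ /=.
    rewrite -scalerDl !scalerA; congr (_ *: _).
    rewrite mulrC [l i * (r - q)]mulrBr [l i * (r + q)]mulrDr.
    by rewrite -[LHS]rmorphM cos_product rmorphM rmorphD.
  rewrite -scalerBr nrmZr ger0_norm ?invr_ge0// opprD addrACA.
  have h1 : nrm (C (r - q) v - \sum_i (cos (l i * (r - q)))%:C *: y i) <= d.
    by apply: Cd; have := ler_normB r q; lra.
  have h2 : nrm (C (r + q) v - \sum_i (cos (l i * (r + q)))%:C *: y i) <= d.
    by apply: Cd; have := ler_normD r q; lra.
  have := ler_nrmD (C (r - q) v - \sum_i (cos (l i * (r - q)))%:C *: y i)
    (C (r + q) v - \sum_i (cos (l i * (r + q)))%:C *: y i).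
  lra.
have -> : \sum_i (cos_transform (l i) x * cos_transform (l i) t)%:C *: y i =
    \sum_i (cos_transform (l i) x)%:C *: ((cos_transform (l i) t)%:C *: y i).
  by apply: eq_bigr => i _; rewrite scalerA rmorphM.
apply: (@cos_transform_dist x (fun r => C r (phiA tau C t v))) => //.
  by rewrite mulr_ge0// ltW.
exact: has_bochner_phiA.
Qed.

End cosine_integral.

(** * The Laplace representation *)

Section laplace_transform.
Context {R : realType} (H : @hypergroup R).
Notation X := ('X_R).
Variable pi0 : {measure set (borel (dual H)) -> \bar R}.
Variables (Lam : set R[i]) (phi : R[i] -> X -> R[i]) (phi0 : X -> R[i]).
Variable tau : X -> {measure set (measurableTypeR R) -> \bar R}.
Hypothesis phi_param : parametrization H Lam phi.
Hypothesis lap : laplace_representation pi0 Lam phi phi0 tau.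

Lemma ccos_real (l t : R) : ccos (l%:C * t%:C) = (cos (l * t))%:C.
Proof.
rewrite -rmorphM /ccos /= cosh0 /sinh oppr0 subrr mul0r mulr0 oppr0 mulr1.
by [].
Qed.

Lemma laplace_cos_transform l x : Lam l%:C -> planch_supp pi0 (phi l%:C) ->
  phi l%:C x = (cos_transform tau l x)%:C.
Proof.
move=> Ll pl; rewrite (laplace_cos lap Ll pl) /cintegral.
under [X in X +i* _]eq_Rintegral do rewrite ccos_real /=.
under [X in _ +i* X]eq_Rintegral do rewrite ccos_real /=.
by rewrite Rintegral_cst ?mul0r//; exact: measurable_itv.
Qed.

(** On the interval given by the Laplace representation the parameters are real
    and belong to bounded multiplicative functions, whose values are the cosine
    transforms of [tau]. *)
Lemma cos_transform_multiplicative : exists a b, a < b /\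
  forall l, a < l < b -> bounded_multiplicative_real H (cos_transform tau l).
Proof.
have [a [b [/andP[a0 ab] lab]]] := laplace_itv lap.
exists a, b; split => // l /lab[Ll pl].
have : bounded_multiplicative H (phi l%:C).
  by rewrite -phi_param; exists l%:C.
move=> [[cphi _ mphi] [A phiA]].
have phiE x : phi l%:C x = (cos_transform tau l x)%:C by exact: laplace_cos_transform.
split.
- move=> x; apply: (proj2 (@cvgrPdist_lt _ _ _ (nbhs x) (nbhs_filter x) _ _)) => e e0.
  have := proj1 (@cvg_nrmP R R[i]^o X (nbhs x) (nbhs_filter x) _ _) (cphi x) e e0.
  apply: filterS => t; apply: le_lt_trans.
  by rewrite !phiE -rmorphB (le_trans _ (normRe_le_nrm _)).
- by exists A => x; rewrite (le_trans _ (phiA x))// (le_trans _ (normRe_le_nrm _))// phiE.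
- move=> x y; have := mphi x y; rewrite !phiE -rmorphM => /(congr1 (@complex.Re R)) /= <-.
  by apply: eq_Rintegral => t _; rewrite phiE.
Qed.

End laplace_transform.

Theorem proposition4p1 (R : realType) (H : @hypergroup R)
  (m : {measure set (borel 'X_R) -> \bar R}) (m_haar : haar_measure H m)
  (pi0 : {measure set (borel (dual H)) -> \bar R})
  (pi0_planch : plancherel_measure m pi0)
  (Lam : set R[i]) (phi : R[i] -> 'X_R -> R[i])
  (phi_param : parametrization H Lam phi)
  (phi0 : 'X_R -> R[i]) (phi0_pos : unique_positive_character pi0 phi0)
  (tau : 'X_R -> {measure set (measurableTypeR R) -> \bar R})
  (lap : laplace_representation pi0 Lam phi phi0 tau)
  (M0 omega0 : R) (M0_gt0 : 0 < M0) (omega0_gt0 : 0 < omega0)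
  (tau_cosh : forall x : 'X_R,
    (\int[tau x]_(t in symitv x) (cosh (omega0 * t))%:E <= M0%:E)%E)
  (E : completeNormedModType R[i]) (E_sep : separable_space E)
  (C : R -> E -> E) (C_cos : cosine_family C)
  (kappa : R)
  (C_le : forall t, 0 <= t -> opnorm (C t) <= kappa * cosh (t * omega0)) :
  (* phi_A(x) is well defined as a strong operator integral *)
  (forall (x : 'X_R) v, bochner_integrable (tau x) (symitv x) (fun t => C t v)) /\
  (* (i) *)
  ((forall x : 'X_R, bounded_operator (phiA tau C x)) /\
   exists K : R, forall x : 'X_R, 0 < \val x -> opnorm (phiA tau C x) <= K) /\
  (* (ii) *)
  (forall f, L1 m f ->
    (forall v, bochner_integrable m setT (fun x => f x *: phiA tau C x v)) /\
    bounded_operator (TA m tau C f)) /\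
  (* (iii) *)
  (forall f g, L1 m f -> L1 m g ->
    L1 m (fconv H m f g) /\
    forall v, TA m tau C (fconv H m f g) v = TA m tau C f (TA m tau C g v)) /\
  (* T_A is linear, and well defined on classes of functions *)
  (forall (a : R[i]) f g, L1 m f -> L1 m g -> forall v,
    TA m tau C (fun x => a * f x + g x) v = a *: TA m tau C f v + TA m tau C g v) /\
  (forall f g, L1 m f -> L1 m g -> {ae m, forall x, f x = g x} ->
    forall v, TA m tau C f v = TA m tau C g v).
Proof.
have kM : 0 <= kappa * M0 by rewrite mulr_ge0 ?(ltW M0_gt0)// (kappa_ge0 C_cos C_le).
have phi_lin := phiA_linear tau_cosh C_cos C_le.
have phi_le := nrm_phiA_le tau_cosh C_cos C_le.
have [a [b [ab good]]] := cos_transform_multiplicative phi_param lap.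
have phi_approx := phiA_approximable M0_gt0 tau_cosh C_cos C_le ab good.
split; first by move=> x v; exact: (cosine_integrable tau_cosh C_cos C_le x v).
split; last exact: (approximable_homomorphism m_haar kM phi_lin phi_le phi_approx).
split; first by move=> x; split; [exact: phi_lin|exists (kappa * M0)].
by exists (kappa * M0) => x _; exact: opnorm_le.
Qed.
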